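(* Let $(M,\mathbf{g})$ be a relativistic spacetime, let $U$ be an open subset of $M$, and let $\pi: O^+M\to M$ be the positive connected component of the orthonormal frame bundle over $(M,\mathbf{g})$. Suppose there exists a curve $\gamma:[0,a)\to M$ (with $0<a\le\infty$) with finite generalised affine length and no endpoint in $M$, whose image is contained in $U$. Then there exist a $b$-incomplete singular region $V\subseteq U$ of $(M,\mathbf{g})$ and an open set $\tilde V\subseteq O^+M$ such that: (i) $\tilde V$ is bounded with respect to every natural distance function on $O^+M$; (ii) the closure $\mathrm{cl}(\tilde V)$ of $\tilde V$ in $O^+M$ is Cauchy incomplete with respect to (the restriction of) every natural distance function on $O^+M$; (iii) $\pi[\tilde V]=V$.
   Context: A (relativistic) spacetime is a pair $(M,\mathbf{g})$ where $M$ is a connected, Hausdorff, smooth $4$-manifold and $\mathbf{g}$ is a smooth Lorentz metric of signature $(3,1)$; it is assumed throughout to be time- and space-orientable, with orientations fixed. Curves and $b$-incompleteness. Curves $\gamma:[0,a)\to M$, $0<a\le\infty$, are $C^1$. Given a basis $\{\mathbf{e}_i\}_{1\le i\le 4}$ of $T_{\gamma(0)}M$, extend it along $\gamma$ by parallel transport with respect to the Levi-Civita connection of $\mathbf{g}$, and write the tangent vector of $\gamma$ at $\gamma(t)$ as $\sum_i V^i(t)\,\mathbf{e}_i|_{\gamma(t)}$. The generalised affine parameter relative to this basis is $\lambda(t)=\int_0^t\left(\sum_i V^i(t')^2\right)^{1/2}dt'$, and the generalised affine length of $\gamma$ is $\lim_{t\to a}\lambda(t)$; whether it is finite does not depend on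 the chosen basis. A point $p\in M$ is an endpoint of $\gamma$ if for every neighbourhood $N$ of $p$ there is $t\in[0,a)$ with $\gamma(t')\in N$ for all $t'>t$. The curve $\gamma$ is $b$-incomplete if it has finite generalised affine length and no endpoint in $M$. A $b$-incomplete singular region of $(M,\mathbf{g})$ is an open connected subset of $M$ that contains the image of some $b$-incomplete curve $[0,a')\to M$, $0<a'\le\infty$. Frame bundles and natural distance functions. $FM\to M$ is the frame bundle (pairs $(p,\{\mathbf{e}_i\})$ with $\{\mathbf{e}_i\}$ a basis of $T_pM$), a principal $GL(4,\mathbb{R})$-bundle. $\pi:O^+M\to M$ is the connected bundle of $\mathbf{g}$-orthonormal, oriented and time-oriented frames, a principal bundle with structure group $SO^+(3,1)$ (the identity component of $O(3,1)$). Let $\omega$ be the $\mathfrak{gl}(4,\mathbb{R})$-valued connection one-form of the Levi-Civita connection on the frame bundle, and $\theta$ the canonical $\mathbb{R}^4$-valued one-form ($\theta_u(\mathbf{X})$ is the coordinate vector of $d\pi_u(\mathbf{X})$ in the frame $u$). For any choice of Euclidean (positive definite) inner products on $\mathfrak{gl}(4,\mathbb{R})$ and $\mathbb{R}^4$, put $\mathbf{h}(\mathbf{X},\mathbf{Y})|_u=\langle\omega_u(\mathbf{X}),\omega_u(\mathbf{Y})\rangle_{\mathfrak{gl}(4,\mathbb{R})}+\langle\theta_u(\mathbf{X}),\theta_u(\mathbf{Y})\rangle_{\mathbb{R}^4}$. The restriction (pullback) of $\mathbf{h}$ to $O^+M$ is a Riemannian metric, called a natural metric on $O^+M$; the associated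 Riemannian distance function (infimum of lengths of curves in the connected manifold $O^+M$) is called a natural distance function on $O^+M$. A subset of $O^+M$ is Cauchy incomplete with respect to $d$ if, with the restricted distance, it is not a complete metric space. *)

(* Defs.v *)
From HB Require Import structures.
From mathcomp Require Import all_boot all_order all_algebra.
From mathcomp Require Import all_classical all_reals all_analysis.

Set Implicit Arguments.
Unset Strict Implicit.
Unset Printing Implicit Defensive.

Import Order.TTheory GRing.Theory Num.Theory.
Import numFieldNormedType.Exports.

Local Open Scope classical_set_scope.
Local Open Scope ring_scope.

(* Vectors of R^4 are row vectors, so that, as for the library's Jacobian,
   a linear map acts by multiplication on the right. *)

Section Calculus.
Context {R : realType}.

(* The set D is meant to be open. *)
Fixpoint Ck (k : nat) (n : nat) (D : set 'rV[R]_n) (f : 'rV[R]_n -> R) : Prop :=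
  match k with
  | 0%N => forall x, D x -> {for x, continuous f}
  | k'.+1 => (forall x, D x -> differentiable f x) /\
             (forall i, Ck k' D ('D_(delta_mx 0 i) f))
  end.

Definition smooth (n : nat) (D : set 'rV[R]_n) (f : 'rV[R]_n -> R) : Prop :=
  forall k, Ck k D f.

(* Curves are total functions on R of which only the restriction to an interval
   D matters; derivatives are taken relatively to D, hence are one-sided at the
   end points of D. *)
Definition diff_quotient (V : normedModType R) (f : R -> V) (t s : R) : V :=
  (s - t)^-1 *: (f s - f t).

Definition deriv_in (V : normedModType R) (D : set R) (f : R -> V) (t : R) : V :=
  lim (diff_quotient f t @ within D t^').

Definition C1_at (V : normedModType R) (D : set R) (f : R -> V) (t : R) : Prop :=
  cvg (diff_quotient f t @ within D t^') /\
  deriv_in D f @ within D (nbhs t) --> deriv_in D f t.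

Definition inner_product (V : lmodType R) (b : V -> V -> R) : Prop :=
  [/\ forall a x y z, b (a *: x + y) z = a * b x z + b y z,
      forall x y, b x y = b y x &
      forall x, x != 0 -> 0 < b x x].

End Calculus.

(* The topology, together with an atlas (phi_c)_c indexed by ix; psi c is the
   inverse chart, relevant on the image of phi c only.  The function chart_at
   selects a chart around each point: it expresses that the charts cover the
   manifold. *)
Record manifold (R : realType) := Manifold {
  carrier :> topologicalType;
  ix : Type;
  dom : ix -> set carrier;
  phi : ix -> carrier -> 'rV[R]_4;
  psi : ix -> 'rV[R]_4 -> carrier;
  chart_at : carrier -> ix;
  carrier_hausdorff : hausdorff_space carrier;
  carrier_connected : connected [set: carrier];
  dom_open : forall c, open (dom c);
  codom_open : forall c, open (phi c @` dom c);
  phi_cont : forall c p, dom c p -> {for p, continuous (phi c)};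
  psi_cont : forall c p, dom c p -> {for phi c p, continuous (psi c)};
  phiK : forall c p, dom c p -> psi c (phi c p) = p;
  dom_chart_at : forall p, dom (chart_at p) p;
  transition_smooth : forall c c' j,
    smooth (phi c @` (dom c `&` dom c')) (fun x => phi c' (psi c x) 0 j)
}.

Arguments dom {R} _ _.
Arguments phi {R} _ _ _.
Arguments psi {R} _ _ _.
Arguments chart_at {R} _ _.

Section Tangent.
Context {R : realType}.

Definition transition (M : manifold R) (c c' : ix M) (p : M) : 'M[R]_4 :=
  'J (fun x => phi M c' (psi M c x)) (phi M c p).

(* A k-tuple of tangent vectors at a common point: a tangent vector is the
   family of its components in all the charts around the point, related by the
   Jacobian matrices of the coordinate changes.  Row i of tcoord c holds the
   components of the i-th vector in the chart c; the components in charts not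
   containing the point are set to 0. *)
Record tang (M : manifold R) (k : nat) := Tang {
  pt : M;
  tcoord : ix M -> 'M[R]_(k, 4);
  tcoord_out : forall c, ~ dom M c pt -> tcoord c = 0;
  tcoord_change : forall c c', dom M c pt -> dom M c' pt ->
    tcoord c' = tcoord c *m transition c c' pt
}.

Lemma tmul_out (M : manifold R) (k l : nat) (B : 'M[R]_(l, k)) (u : tang M k) c :
  ~ dom M c (pt u) -> B *m tcoord u c = 0.
Proof. by move=> h; rewrite tcoord_out // mulmx0. Qed.

Lemma tmul_change (M : manifold R) (k l : nat) (B : 'M[R]_(l, k)) (u : tang M k)
    c c' : dom M c (pt u) -> dom M c' (pt u) ->
  B *m tcoord u c' = B *m tcoord u c *m transition c c' (pt u).
Proof. by move=> h h'; rewrite -mulmxA -tcoord_change. Qed.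

(* The i-th vector of tmul B u is \sum_j B i j u_j. *)
Definition tmul (M : manifold R) (k l : nat) (B : 'M[R]_(l, k)) (u : tang M k) :
    tang M l :=
  Tang (tmul_out B (u := u)) (tmul_change B (u := u)).

(* The subsets of the bundle of k-tuples that are open in a bundle chart; they
   form a basis of its manifold topology. *)
Definition tang_basic (M : manifold R) (k : nat) : set (set (tang M k)) :=
  [set W | exists c, exists2 O : set ('rV[R]_4 * 'M[R]_(k, 4)), open O &
    W = [set u | dom M c (pt u) /\ O (phi M c (pt u), tcoord u c)]].

End Tangent.

HB.instance Definition _ (R : realType) (M : manifold R) (k : nat) :=
  gen_eqMixin (tang M k).
HB.instance Definition _ (R : realType) (M : manifold R) (k : nat) :=
  gen_choiceMixin (tang M k).
HB.instance Definition _ (R : realType) (M : manifold R) (k : nat) :=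
  isSubBaseTopological.Build (tang M k) (@tang_basic R M k) id.

Definition minkowski (R : realType) : 'M[R]_4 :=
  diag_mx (\row_i (if i == ord_max then -1 else 1)).

(* Only the values of gmx c on the domain of the chart c matter. *)
Record lorentz_metric (R : realType) (M : manifold R) := LorentzMetric {
  gmx : ix M -> M -> 'M[R]_4;
  gmx_sym : forall c p, dom M c p -> (gmx c p)^T = gmx c p;
  gmx_signature : forall c p, dom M c p ->
    exists2 P : 'M[R]_4, P \in unitmx & P *m gmx c p *m P^T = minkowski R;
  gmx_change : forall c c' p, dom M c p -> dom M c' p ->
    gmx c p = transition c c' p *m gmx c' p *m (transition c c' p)^T;
  gmx_smooth : forall c i j,
    smooth (phi M c @` dom M c) (fun x => gmx c (psi M c x) i j)
}.

Section Causal.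
Context {R : realType} {M : manifold R} (g : lorentz_metric M).

(* The Gram matrix of a tuple; it does not depend on the chart. *)
Definition gram (k : nat) (u : tang M k) : 'M[R]_k :=
  let A := tcoord u (chart_at M (pt u)) in
  A *m gmx g (chart_at M (pt u)) (pt u) *m A^T.

Definition timelike : set (tang M 1) := [set v | gram v 0 0 < 0].

(* The triples of linearly independent vectors spanning a spacelike subspace. *)
Definition spacelike_triad : set (tang M 3) :=
  [set w | forall x : 'rV[R]_3, x != 0 -> 0 < (x *m gram w *m x^T) 0 0].

(* A continuous division of the timelike vectors into future and past ones. *)
Definition time_orientation (F : set (tang M 1)) : Prop :=
  [/\ F `<=` timelike, open F, open (timelike `\` F) &
      forall v, timelike v -> F (tmul (- 1%:M) v) <-> ~ F v].

Definition flip_first : 'M[R]_3 :=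
  diag_mx (\row_i (if i == ord0 then -1 else 1)).

(* A continuous division of the spacelike triads into right- and left-handed
   ones. *)
Definition space_orientation (F : set (tang M 3)) : Prop :=
  [/\ F `<=` spacelike_triad, open F, open (spacelike_triad `\` F) &
      forall w, spacelike_triad w -> F (tmul flip_first w) <-> ~ F w].

End Causal.

Record spacetime (R : realType) := Spacetime {
  base :> manifold R;
  metric : lorentz_metric base;
  future : set (tang base 1);
  right_handed : set (tang base 3);
  future_orientation : time_orientation metric future;
  right_handed_orientation : space_orientation metric right_handed
}.

Section LeviCivita.
Context {R : realType} (M : spacetime R).

Definition gcomp (c : ix M) (i j : 'I_4) (x : 'rV[R]_4) : R :=
  gmx (metric M) c (psi M c x) i j.

Definition dgcomp (c : ix M) (l i j : 'I_4) (x : 'rV[R]_4) : R :=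
  'D_(delta_mx 0 l) (gcomp c i j) x.

(* Christoffel symbol Gamma^k_{ij} of the Levi-Civita connection. *)
Definition christoffel (c : ix M) (x : 'rV[R]_4) (k i j : 'I_4) : R :=
  2^-1 * \sum_l invmx (gmx (metric M) c (psi M c x)) k l *
           (dgcomp c i j l x + dgcomp c j i l x - dgcomp c l i j x).

Definition conn (c : ix M) (x xd : 'rV[R]_4) : 'M[R]_4 :=
  \matrix_(j, k) \sum_i xd 0 i * christoffel c x k i j.

(* The covariant derivative of a k-tuple of vector fields along a curve, where
   x and xd are the position and velocity of the curve, and A and Ad the
   components of the fields and their derivatives. *)
Definition covd (k : nat) (c : ix M) (x : 'rV[R]_4) (A : 'M[R]_(k, 4))
    (xd : 'rV[R]_4) (Ad : 'M[R]_(k, 4)) : 'M[R]_(k, 4) :=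
  Ad + A *m conn c x xd.

Definition FM : set (tang M 4) :=
  [set u | forall c, dom M c (pt u) -> tcoord u c \in unitmx].

Definition OM : set (tang M 4) := [set u | gram (metric M) u = minkowski R].

Definition OplusM : set (tang M 4) :=
  [set u | [/\ OM u,
               future (tmul (row ord_max 1%:M) u) &
               right_handed (tmul (rowsub (lift ord_max) 1%:M) u)]].

Definition frame_proj (u : OplusM) : M := pt (set_val u).

(* The canonical form and the connection form of the frame bundle, evaluated at
   the frame with coordinates (x, A) on the tangent vector with coordinates
   (xd, Ad) in the bundle chart given by c.  The i-th row of A is the frame
   vector e_i; theta and omega are given by xd = \sum_i theta^i e_i and
   nabla e_j = \sum_i omega^i_j e_i, whence the transposition. *)
Definition theta (A : 'M[R]_4) (xd : 'rV[R]_4) : 'rV[R]_4 := xd *m invmx A.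

Definition omega (c : ix M) (x : 'rV[R]_4) (A : 'M[R]_4) (xd : 'rV[R]_4)
    (Ad : 'M[R]_4) : 'M[R]_4 :=
  (covd c x A xd Ad *m invmx A)^T.

Definition xpos (k : nat) (c : ix M) (u : R -> tang M k) (t : R) : 'rV[R]_4 :=
  phi M c (pt (u t)).
Definition apos (k : nat) (c : ix M) (u : R -> tang M k) (t : R) :
  'M[R]_(k, 4) := tcoord (u t) c.
Definition xvel (k : nat) (D : set R) (c : ix M) (u : R -> tang M k) (t : R) :
  'rV[R]_4 := deriv_in D (xpos c u) t.

Definition C1_curve (D : set R) (gamma : R -> M) : Prop :=
  {within D, continuous gamma} /\
  forall c t, D t -> dom M c (gamma t) -> C1_at D (fun s => phi M c (gamma s)) t.

Definition C1_frame_curve (D : set R) (u : R -> tang M 4) : Prop :=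
  [/\ {within D, continuous u},
      forall t, D t -> FM (u t) &
      forall c t, D t -> dom M c (pt (u t)) ->
        C1_at D (xpos c u) t /\ C1_at D (apos c u) t].

Definition frame_covd (D : set R) (c : ix M) (u : R -> tang M 4) (t : R) :
  'M[R]_4 :=
  covd c (xpos c u t) (apos c u t) (xvel D c u t) (deriv_in D (apos c u) t).

Definition frame_theta (D : set R) (c : ix M) (u : R -> tang M 4) (t : R) :
  'rV[R]_4 := theta (apos c u t) (xvel D c u t).

Definition frame_omega (D : set R) (c : ix M) (u : R -> tang M 4) (t : R) :
  'M[R]_4 :=
  omega c (xpos c u t) (apos c u t) (xvel D c u t) (deriv_in D (apos c u) t).

End LeviCivita.

Arguments FM {R} M _.
Arguments OM {R} M _.
Arguments OplusM {R} M _.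

Section Incompleteness.
Context {R : realType} (M : spacetime R).

Definition ray (a : \bar R) : set R := [set t | 0 <= t /\ (t%:E < a)%E].

(* The filter of t -> a in [0, a[. *)
Definition to_end (a : \bar R) : set_system R :=
  filter_from (ray a) (fun t => [set s | ray a s /\ t < s]).

Definition has_endpoint (a : \bar R) (gamma : R -> M) : Prop :=
  exists p : M, gamma @ to_end a --> p.

(* e is a basis at gamma 0 parallelly transported along gamma. *)
Definition parallel_frame (a : \bar R) (gamma : R -> M) (e : R -> tang M 4) :
    Prop :=
  [/\ C1_frame_curve (ray a) e,
      forall t, ray a t -> pt (e t) = gamma t &
      forall c t, ray a t -> dom M c (gamma t) -> frame_covd (ray a) c e t = 0].

(* The integrand is (\sum_i V^i(t)^2)^(1/2), where the V^i(t) are the components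
   of the velocity in the frame e t; the chart used is immaterial. *)
Definition gap_speed (a : \bar R) (e : R -> tang M 4) (t : R) : R :=
  Num.sqrt (\sum_i frame_theta (ray a) (chart_at M (pt (e t))) e t 0 i ^+ 2).

Definition gap (a : \bar R) (e : R -> tang M 4) (t : R) : \bar R :=
  (\int[lebesgue_measure]_(s in `[0%R, t]) (gap_speed a e s)%:E)%E.

Definition finite_gap_length (a : \bar R) (gamma : R -> M) : Prop :=
  exists2 e, parallel_frame a gamma e &
    exists l : R, gap a e @ to_end a --> l%:E.

Definition b_incomplete (a : \bar R) (gamma : R -> M) : Prop :=
  [/\ (0 < a)%E, C1_curve (ray a) gamma, finite_gap_length a gamma &
      ~ has_endpoint a gamma].

Definition b_incomplete_singular_region (V : set M) : Prop :=
  [/\ open V, connected V &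
      exists a gamma, b_incomplete a gamma /\ gamma @` ray a `<=` V].

End Incompleteness.

Section NaturalDistance.
Context {R : realType} (M : spacetime R).
Variables (b1 : 'M[R]_4 -> 'M[R]_4 -> R) (b2 : 'rV[R]_4 -> 'rV[R]_4 -> R).

(* The square root of h(u', u') at time t; the chart used is immaterial. *)
Definition natural_speed (D : set R) (u : R -> tang M 4) (t : R) : R :=
  let c := chart_at M (pt (u t)) in
  Num.sqrt (b1 (frame_omega D c u t) (frame_omega D c u t) +
            b2 (frame_theta D c u t) (frame_theta D c u t)).

(* path_length u v l: a piecewise C^1 curve, that is, a finite concatenation of
   C^1 curves, joins u to v in O^+M and has length l. *)
Inductive path_length : OplusM M -> OplusM M -> \bar R -> Prop :=
| path_arc (r s : R) (w : R -> OplusM M) : r < s ->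
    C1_frame_curve `[r, s] (fun t => set_val (w t)) ->
    path_length (w r) (w s)
      (\int[lebesgue_measure]_(t in `[r, s])
         (natural_speed `[r, s] (fun t => set_val (w t)) t)%:E)%E
| path_cat u v w l l' : path_length u v l -> path_length v w l' ->
    path_length u w (l + l')%E.

Definition natural_dist (u v : OplusM M) : \bar R :=
  ereal_inf [set l | path_length u v l].

End NaturalDistance.

Definition natural_distance {R : realType} (M : spacetime R)
    (d : OplusM M -> OplusM M -> \bar R) : Prop :=
  exists b1 b2, [/\ inner_product b1, inner_product b2 &
                    d = @natural_dist R M b1 b2].

Section Distance.
Context {R : realType} {X : Type} (d : X -> X -> \bar R).

Definition dist_bounded (A : set X) : Prop :=
  exists B : R, forall x y, A x -> A y -> (d x y <= B%:E)%E.

Definition dist_cauchy (s : nat -> X) : Prop :=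
  forall e : R, 0 < e -> exists N, forall m n, (N <= m)%N -> (N <= n)%N ->
    (d (s m) (s n) < e%:E)%E.

Definition dist_cvg (s : nat -> X) (x : X) : Prop :=
  forall e : R, 0 < e -> exists N, forall n, (N <= n)%N -> (d (s n) x < e%:E)%E.

Definition cauchy_incomplete (A : set X) : Prop :=
  ~ (forall s : nat -> X, (forall n, A (s n)) -> dist_cauchy s ->
       exists2 x, A x & dist_cvg s x).

End Distance.

(* Main.v *)
Require Import Defs.
From mathcomp Require Import all_boot all_order all_algebra.
From mathcomp Require Import all_classical all_reals all_analysis.
From mathcomp Require Import measurable_realfun ring lra.

Set Implicit Arguments.
Unset Strict Implicit.
Unset Printing Implicit Defensive.

Import Order.TTheory GRing.Theory Num.Theory.
Import numFieldNormedType.Exports.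

Local Open Scope classical_set_scope.
Local Open Scope ring_scope.

(* A parallel frame along gamma has a constant Gram matrix, hence, multiplied by
   a constant matrix, it becomes a horizontal curve u in O^+M; the orientations
   are preserved by connectedness.  As omega vanishes on u', the natural length
   of u is at most a constant times the generalised affine length of gamma, so
   for every natural distance u is bounded and its tails are Cauchy.  If u had a
   limit x in O^+M for some sequence of times, then gamma would converge to the
   projection of x, because a short path ending at x stays over a small
   neighbourhood of that projection (this rests on |x'| + |A'| <= C (|omega| +
   |theta|) in a chart, and on omega not depending on the chart).

   Around each u(t), take a coordinate box of frames so small that Gram-Schmidt
   orthonormalisation turns the straight segments of the box into paths of O^+M
   along which |omega| <= 1 and |theta| <= 1, whatever the inner products.  The
   union of these boxes is the open set sought; its projection is the union of
   small chart balls centred on gamma. *)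

(** * Matrix limits and norms *)

(** The open set has to be fixed before the inner products are. The boxes are therefore controlled
    by sup norms of [omega] and [theta] only, and a natural metric enters afterwards through a
    single constant [K]: each box has diameter at most [2 * K], whatever its coordinate size, so
    that infinitely many shrinking boxes along the curve cause no harm. A straight coordinate
    segment leaves the orthonormal frames, which is why it is orthonormalised; frames already
    orthonormal are fixed by this, so two points of a box are really joined. For incompleteness, the
    distance is compared with the topology in one direction only: convergence in distance forces
    convergence of base points. The Cauchy sequence lies on the lift itself, and a limit anywhere in
    [O^+M] would already give an endpoint. The obstacle is that a short path might leave the chart;
    a backward induction on time, with compactness of closed coordinate balls in a Hausdorff space,
    excludes this. Speeds are computed in the chart picked by [chart_at], which may jump along a
    curve. Their continuity thus needs the change-of-chart law of the connection, obtained from the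
    uniqueness of the Levi-Civita connection. *)

Section MatrixLimits.
Context {R : realType} {T : Type} (F : set_system T) {FF : Filter F}.

Lemma cvg_sum (V : normedModType R) (I : Type) (r : seq I) (P : pred I)
    (f : I -> T -> V) (l : I -> V) : (forall i, P i -> f i @ F --> l i) ->
  (\sum_(i <- r | P i) f i x) @[x --> F] --> \sum_(i <- r | P i) l i.
Proof. exact: cvg_big add_continuous _ _ _ _ _ _. Qed.

Lemma cvg_mxP m n (f : T -> 'M[R]_(m, n)) (l : 'M[R]_(m, n)) :
  f @ F --> l <-> forall i j, f x i j @[x --> F] --> l i j.
Proof.
split=> [fl i j|fl].
  exact: (cvg_comp _ _ fl (@coord_continuous _ m n i j l)).
apply/cvgrPdist_lt => e e0.
have H : \forall x \near F, forall ij : 'I_m * 'I_n,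
    `|l ij.1 ij.2 - f x ij.1 ij.2| < e.
  by apply: filter_forall => -[i j]; have /cvgrPdist_lt := fl i j; apply.
apply: filterS H => x H; rewrite /Num.Def.normr/= mx_normrE.
by apply/bigmax_ltP; split=> // -[i j] _; rewrite !mxE; exact: (H (i, j)).
Qed.

Lemma cvg_mulmx m n p (f : T -> 'M[R]_(m, n)) (g : T -> 'M[R]_(n, p))
    (k : 'M[R]_(m, n)) (l : 'M[R]_(n, p)) :
  f @ F --> k -> g @ F --> l -> (f x *m g x) @[x --> F] --> k *m l.
Proof.
move=> /cvg_mxP fk /cvg_mxP gl; apply/cvg_mxP => i j.
under eq_cvg do rewrite mxE.
rewrite mxE; apply: cvg_sum => a _; exact: cvgM.
Qed.

Lemma cvg_trmx m n (f : T -> 'M[R]_(m, n)) (k : 'M[R]_(m, n)) :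
  f @ F --> k -> (f x)^T @[x --> F] --> k^T.
Proof.
move=> /cvg_mxP fk; apply/cvg_mxP => i j.
under eq_cvg do rewrite mxE.
by rewrite mxE; exact: fk.
Qed.

Lemma cvg_det n (f : T -> 'M[R]_n) (k : 'M[R]_n) :
  f @ F --> k -> \det (f x) @[x --> F] --> \det k.
Proof.
move=> /cvg_mxP fk; rewrite /determinant; apply: cvg_sum => s _.
apply: cvgM; first exact: cvg_cst.
elim: (index_enum _) => [|i r ih].
  by under eq_cvg do rewrite big_nil; rewrite big_nil; exact: cvg_cst.
by under eq_cvg do rewrite big_cons; rewrite big_cons; apply: cvgM.
Qed.

(** Cramer's formula holds only where the determinant is non-zero, hence the passage to a
    neighbourhood: on singular matrices [invmx] is the identity map. *)
Lemma cvg_invmx n (f : T -> 'M[R]_n) (k : 'M[R]_n) : k \in unitmx ->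
  f @ F --> k -> invmx (f x) @[x --> F] --> invmx k.
Proof.
move=> ku fk.
have d0 : \det k != 0 by move: ku; rewrite unitmxE unitfE.
have dk := cvg_det fk.
have -> : invmx k = (\det k)^-1 *: \adj k by rewrite /invmx ku.
have E : \forall x \near F, (\det (f x))^-1 *: \adj (f x) = invmx (f x).
  have : \forall x \near F, \det (f x) != 0.
    exact: cvgr_neq0 dk d0.
  by apply: filterS => x dx; rewrite /invmx unitmxE unitfE dx.
apply: cvg_trans (near_eq_cvg E) _.
apply: cvgZ; first exact: cvgV.
apply/cvg_mxP => i j; under eq_cvg do rewrite mxE.
rewrite mxE /cofactor; apply: cvgM; first exact: cvg_cst.
apply: cvg_det; apply/cvg_mxP => a b; under eq_cvg do rewrite !mxE.
by rewrite !mxE; move/cvg_mxP : fk; apply.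
Qed.

End MatrixLimits.

Section MatrixNorm.
Context {R : realType}.

Lemma mx_norm_le m n (A : 'M[R]_(m, n)) (e : R) : 0 <= e ->
  (forall i j, `|A i j| <= e) -> `|A| <= e.
Proof.
move=> e0 H; rewrite /Num.Def.normr/= mx_normrE.
by apply/bigmax_leP; split => // -[i j] _; exact: H.
Qed.

Lemma mx_norm_coord m n (A : 'M[R]_(m, n)) i j : `|A i j| <= `|A|.
Proof.
rewrite [leRHS]/Num.Def.normr/= mx_normrE.
exact: (le_bigmax _ (fun ij : 'I_m * 'I_n => `|A ij.1 ij.2|) (i, j)).
Qed.

Lemma mx_norm_mulmx m n p (A : 'M[R]_(m, n)) (B : 'M[R]_(n, p)) :
  `|A *m B| <= n%:R * `|A| * `|B|.
Proof.
apply: mx_norm_le => [|i j]; first by rewrite !mulr_ge0.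
rewrite mxE; apply: le_trans (ler_norm_sum _ _ _) _.
rewrite -mulrA mulr_natl -[X in _ *+ X]card_ord -sumr_const.
by apply: ler_sum => k _; rewrite normrM ler_pM // mx_norm_coord.
Qed.

Lemma mx_norm_tr m n (A : 'M[R]_(m, n)) : `|A^T| = `|A|.
Proof.
suff H k l (B : 'M[R]_(k, l)) : `|B^T| <= `|B|.
  by apply/eqP; rewrite eq_le H/= -{1}[A]trmxK H.
by apply: mx_norm_le => // i j; rewrite mxE mx_norm_coord.
Qed.

End MatrixNorm.

(** * One-sided derivatives of curves *)

Section Derivatives.
Context {R : realType}.

(* On such intervals, one-sided derivatives are unique. *)
Definition fat (D : set R) :=
  is_interval D /\ forall t, exists2 s, D s & s != t.

Lemma fat_limit_point (D : set R) (t e : R) : fat D -> D t -> 0 < e ->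
  exists s, [/\ D s, s != t & `|t - s| < e].
Proof.
move=> [Di Dn] Dt e0; have [s Ds st] := Dn t.
(* The point sought is [t + k * (s - t)]: [k <= 1] keeps it between [t] and [s], hence in the
   interval, and the other bound brings it within [e] of [t]. *)
pose k := Num.min 1 (e / 2 / `|s - t|).
have n0 : 0 < `|s - t| by rewrite normr_gt0 subr_eq0.
have k0 : 0 < k by rewrite lt_min ltr01/= !divr_gt0.
have k1 : k <= 1 by rewrite ge_min lexx.
have ke : k * `|s - t| < e.
  apply: (@le_lt_trans _ _ (e / 2 / `|s - t| * `|s - t|)).
    by rewrite ler_wpM2r // ge_min lexx orbT.
  by rewrite mulfVK ?gt_eqF//; lra.
exists (t + k * (s - t)); split.
- have [ts|ts] := ltP t s.
    by apply: (Di t s) => //; apply/andP; split; nra.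
  by apply: (Di s t) => //; apply/andP; split; nra.
- by rewrite addrC -subr_eq0 addrK mulf_neq0 ?subr_eq0// gt_eqF.
- by rewrite opprD addNKr normrN normrM gtr0_norm.
Qed.

Lemma fat_proper (D : set R) (t : R) : fat D -> D t ->
  ProperFilter (within D t^').
Proof.
move=> fD Dt; split; last exact: within_filter.
rewrite /within => /= /nbhs_ballP[e /= e0 H].
have [s [Ds st se]] := fat_limit_point fD Dt e0.
exact: (H s).
Qed.

Lemma within_dnbhs (D : set R) (t : R) : within D t^' --> within D (nbhs t).
Proof. by move=> P; rewrite /within /=; exact: nbhs_dnbhs. Qed.

Lemma within_neq (D : set R) (t : R) :
  \forall s \near within D t^', D s /\ s != t.
Proof. by rewrite near_withinE; apply: filterS (nbhs_dnbhs_neq t) => s. Qed.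

Lemma within_sub (T : Type) (F : set_system T) (D D' : set T) : Filter F ->
  D' `<=` D -> within D' F --> within D F.
Proof. by move=> FF DD P; apply: (@filterS _ F) => s H /DD. Qed.

Section Values.
Context {V : normedModType R}.
Implicit Types (D : set R) (f g : R -> V) (t : R) (v : V).

(** A relation rather than a value: [deriv_in] is a [lim] and carries no information when the
    quotient diverges. *)
Definition has_deriv D f t v := diff_quotient f t @ within D t^' --> v.

Lemma has_deriv_lim D f t v : fat D -> D t -> has_deriv D f t v ->
  deriv_in D f t = v.
Proof. by move=> fD Dt; have := fat_proper fD Dt => ? ?; apply: cvg_lim. Qed.

Lemma C1_has_deriv D f t : C1_at D f t -> has_deriv D f t (deriv_in D f t).
Proof. by case. Qed.

Lemma has_deriv_unique D f t v w : fat D -> D t -> has_deriv D f t v ->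
  has_deriv D f t w -> v = w.
Proof.
move=> fD Dt hv hw.
by rewrite -(has_deriv_lim fD Dt hv) -(has_deriv_lim fD Dt hw).
Qed.

Lemma has_deriv_cont D f t v : has_deriv D f t v ->
  f @ within D (nbhs t) --> f t.
Proof.
move=> H.
have H1 : f s @[s --> within D t^'] --> f t.
  have : (f t + (s - t) *: diff_quotient f t s) @[s --> within D t^']
      --> f t + 0 *: v.
    apply: cvgD; first exact: cvg_cst.
    apply: cvgZ H; rewrite -[X in _ --> X](subrr t).
    apply: cvgB; last exact: cvg_cst.
    by apply: cvg_trans (cvg_within _) _; exact: nbhs_dnbhs.
  rewrite scale0r addr0; apply: cvg_trans; apply: near_eq_cvg.
  apply: filterS (within_neq D t) => s [_ st].
  by rewrite /diff_quotient scalerA divff ?subr_eq0// scale1r addrC subrK.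
move=> P fP; have := H1 P fP; rewrite !near_simpl /= near_withinE near_withinE.
rewrite near_withinE.
apply: filterS => s; have [->|st] := eqVneq s t; last by apply.
by move=> _ _; exact: nbhs_singleton.
Qed.

Lemma C1_cont D f t : C1_at D f t -> f @ within D (nbhs t) --> f t.
Proof. by move=> /C1_has_deriv/has_deriv_cont. Qed.

Lemma has_deriv_sub D D' f t v : D' `<=` D -> has_deriv D f t v ->
  has_deriv D' f t v.
Proof.
by move=> DD; apply: cvg_trans; apply: cvg_app; exact: within_sub.
Qed.

Lemma has_deriv_near D f g t v : f t = g t ->
  (\forall s \near t, D s -> f s = g s) -> has_deriv D f t v ->
  has_deriv D g t v.
Proof.
move=> ft fg; apply: cvg_trans; apply: near_eq_cvg.
rewrite near_withinE; apply: nbhs_dnbhs.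
by apply: filterS fg => s fg Ds; rewrite /diff_quotient ft fg.
Qed.

(** Convergence is not assumed: both quotients generate the same filter, so the two [lim] agree even
    as default values. *)
Lemma deriv_in_near D f g t : f t = g t ->
  (\forall s \near t, D s -> f s = g s) -> deriv_in D f t = deriv_in D g t.
Proof.
move=> ft fg; rewrite /deriv_in; congr lim.
have H : \forall s \near within D t^', diff_quotient f t s = diff_quotient g t s.
  rewrite near_withinE; apply: nbhs_dnbhs.
  by apply: filterS fg => s fg Ds; rewrite /diff_quotient ft fg.
have FF : Filter (within D t^') by exact: within_filter.
rewrite eqEsubset; split; apply: near_eq_cvg => //.
by apply: filterS H => s ->.
Qed.

Lemma C1_at_intro D f (f' : R -> V) t : fat D -> D t ->
  (\forall s \near t, D s -> has_deriv D f s (f' s)) ->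
  f' @ within D (nbhs t) --> f' t -> C1_at D f t /\ deriv_in D f t = f' t.
Proof.
move=> fD Dt H fc.
have Ht : has_deriv D f t (f' t) by exact: nbhs_singleton H Dt.
have E := has_deriv_lim fD Dt Ht.
split => //; split; first by apply/cvg_ex; exists (f' t).
rewrite E; apply: cvg_trans fc; apply: near_eq_cvg; rewrite near_withinE.
by apply: filterS H => s H Ds; rewrite (has_deriv_lim fD Ds (H Ds)).
Qed.

Lemma C1_at_near D f g t : fat D -> D t ->
  (\forall s \near t, D s -> f s = g s) ->
  (\forall s \near t, D s -> C1_at D f s) -> C1_at D g t.
Proof.
move=> fD Dt fg cf.
have fg' : \forall s \near t, \forall r \near s, D r -> f r = g r.
  exact: near_join fg.
apply: (proj1 (C1_at_intro (f' := deriv_in D f) fD Dt _ _)).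
  apply: filterS3 fg fg' cf => s fg fg' cf Ds.
  by apply: has_deriv_near fg' (C1_has_deriv (cf Ds)); exact: fg.
by have [] := nbhs_singleton cf Dt.
Qed.

Lemma has_deriv_cst D t v : has_deriv D (fun=> v) t 0.
Proof.
rewrite /has_deriv /diff_quotient.
by under eq_fun do rewrite subrr scaler0; exact: cvg_cst.
Qed.

(** The bridge to two-sided derivatives, through which the mean value theorem and the fundamental
    theorem of calculus apply at interior times. *)
Lemma has_deriv_is_derive D f t v : nbhs t D -> has_deriv D f t v ->
  is_derive t 1 f v.
Proof.
move=> nD H.
have {}H : diff_quotient f t @ t^' --> v.
  apply: cvg_trans H; apply: cvg_app => P H.
  have {}H : \forall s \near t^', D s -> P s by [].
  by apply: filterS2 (nbhs_dnbhs nD) H => s Ds; exact.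
have addt : (fun h => h + t) @ 0^' --> t^'.
  move=> P /nbhs_ballP[e /= e0 H1]; apply/nbhs_ballP; exists e => //= h h0 hn.
  apply: H1; last by rewrite -subr_eq0 addrK.
  by move: h0; rewrite /ball/= sub0r opprD addrCA subrr addr0 normrN.
have K : h^-1 *: (f (h *: 1 + t) - f t) @[h --> 0^'] --> v.
  have := cvg_comp _ _ addt H; apply: cvg_trans; apply: near_eq_cvg.
  by apply: nearW => h /=; rewrite /diff_quotient addrK [h%:A]mulr1.
by apply: DeriveDef; [apply/cvg_ex; exists v|exact: cvg_lim K].
Qed.

Lemma has_deriv_opp D f t v : has_deriv D f (- t) v ->
  has_deriv (-%R @^-1` D) (fun s => f (- s)) t (- v).
Proof.
move=> H.
have FF : Filter (within (-%R @^-1` D) t^') by exact: within_filter.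
have oppt : -%R @ within (-%R @^-1` D) t^' --> within D (- t)^'.
  move=> P; rewrite /within /= => /nbhs_ballP[e /= e0 H1].
  apply/nbhs_ballP; exists e => //= s ts st Ds.
  apply: H1 => //; last by rewrite eqr_opp.
  by move: ts; rewrite /ball/= -opprD normrN.
rewrite /has_deriv (_ : diff_quotient _ _ =
    fun s => - diff_quotient f (- t) (- s)).
  by apply: cvgN; exact: cvg_comp oppt H.
apply/funext => s.
by rewrite /diff_quotient -scaleNr -invrN opprD !opprK.
Qed.

End Values.

(** Near [t] the quotient of [f] is bounded by some [k], which turns the remainder of [G], small
    compared with [f s - f t], into one small compared with [s - t]. *)
Lemma has_deriv_chain (V W : normedModType R) D (f : R -> V) (G : V -> W) t v :
  differentiable G (f t) -> has_deriv D f t v ->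
  has_deriv D (fun s => G (f s)) t ('d G (f t) v).
Proof.
move=> dG hf.
have FF : Filter (within D t^') by exact: within_filter.
have fc : f @ within D t^' --> f t.
  exact: cvg_trans (cvg_app _ (@within_dnbhs D t)) (has_deriv_cont hf).
have dc : continuous ('d G (f t)) by exact: diff_continuous.
have [k k0 bk] : exists2 k, 0 < k & \forall s \near within D t^',
    `|diff_quotient f t s| <= k.
  exists (`|v| + 1); first by rewrite ltr_pwDr.
  have /cvgrPdist_lt/(_ _ ltr01) := hf; apply: filterS => s.
  move=> H; rewrite -[diff_quotient f t s](subrK v) addrC.
  by rewrite (le_trans (ler_normD _ _))// lerD2l distrC ltW.
have Ho := diff_locallyx dG.
set o := 'o in Ho.
apply/cvgrPdist_lt => e e0.
have H1 : \forall s \near within D t^',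
    `|'d G (f t) v - 'd G (f t) (diff_quotient f t s)| < e / 2.
  have /cvgrPdist_lt := cvg_comp _ _ hf (dc v); apply; lra.
have H2 : \forall h \near (0 : V), `|o id h| <= e / 2 / k * `|h|.
  by apply: (littleoP [littleo of o id]); rewrite !divr_gt0.
have f0 : (f s - f t) @[s --> within D t^'] --> (0 : V).
  by rewrite -(subrr (f t)); apply: cvgB => //; exact: cvg_cst.
have H3 := f0 _ H2.
near=> s.
have st : s != t by have [] : D s /\ s != t by near: s; exact: within_neq.
have h1 : `|'d G (f t) v - 'd G (f t) (diff_quotient f t s)| < e / 2.
  by near: s; exact: H1.
have h3 : `|o id (f s - f t)| <= e / 2 / k * `|f s - f t| by near: s; exact: H3.
have hk : `|diff_quotient f t s| <= k by near: s; exact: bk.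
rewrite /diff_quotient -{1}[f s](subrK (f t)) Ho.
rewrite addrAC [_ + _ - _]addrAC subrr add0r scalerDr -linearZ opprD addrA.
apply: le_lt_trans (ler_normB _ _) _.
rewrite [ltRHS](splitr e) ltr_leD//.
rewrite normrZ; apply: (@le_trans _ _ (e / 2 / k * k)); last first.
  by rewrite mulfVK ?gt_eqF.
apply: (@le_trans _ _ (`|(s - t)^-1| * (e / 2 / k * `|f s - f t|))).
  by rewrite ler_wpM2l.
rewrite mulrCA; apply: ler_wpM2l; first by rewrite !divr_ge0 ?ltW.
by rewrite -normrZ.
Unshelve. all: by end_near. Qed.

Lemma has_deriv_mulmx m n p D (f : R -> 'M[R]_(m, n)) (g : R -> 'M[R]_(n, p))
    t v w : has_deriv D f t v -> has_deriv D g t w ->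
  has_deriv D (fun s => f s *m g s) t (v *m g t + f t *m w).
Proof.
move=> hf hg.
have FF : Filter (within D t^') by exact: within_filter.
have gc : g @ within D t^' --> g t.
  exact: cvg_trans (cvg_app _ (@within_dnbhs D t)) (has_deriv_cont hg).
rewrite /has_deriv (_ : diff_quotient _ _ = fun s =>
    diff_quotient f t s *m g s + f t *m diff_quotient g t s); last first.
  apply/funext => s.
  rewrite /diff_quotient -scalemxAl -scalemxAr -scalerDr; congr (_ *: _).
  by rewrite mulmxBl mulmxBr addrA subrK.
apply: cvgD; apply: cvg_mulmx => //; exact: cvg_cst.
Qed.

Lemma has_deriv_trmx m n D (f : R -> 'M[R]_(m, n)) t v :
  has_deriv D f t v -> has_deriv D (fun s => (f s)^T) t v^T.
Proof.
move=> hf.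
have FF : Filter (within D t^') by exact: within_filter.
rewrite /has_deriv (_ : diff_quotient _ _ = fun s => (diff_quotient f t s)^T).
  exact: cvg_trmx.
by apply/funext => s; rewrite /diff_quotient -linearB -linearZ.
Qed.

Lemma has_deriv_mx m n D (f : R -> 'M[R]_(m, n)) t v :
  has_deriv D f t v <-> forall i j, has_deriv D (fun s => f s i j : R) t (v i j).
Proof.
have FF : Filter (within D t^') by exact: within_filter.
have E i j : (fun s => diff_quotient f t s i j) =
             diff_quotient (fun s => f s i j : R) t.
  by apply/funext => s; rewrite /diff_quotient !mxE.
split=> [/cvg_mxP H i j|H]; first by rewrite /has_deriv -E; exact: H.
by apply/cvg_mxP => i j; rewrite E; exact: H.
Qed.

Lemma has_deriv_affine (V : normedModType R) D (u c : V) t :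
  has_deriv D (fun s => s *: u + c) t u.
Proof.
have FF : Filter (within D t^') by exact: within_filter.
have : (fun=> u) @ within D t^' --> u by exact: cvg_cst.
apply: cvg_trans; apply: near_eq_cvg; apply: filterS (within_neq D t) => s [_ st].
rewrite /diff_quotient opprD addrACA subrr addr0 -scalerBl scalerA mulVf.
  by rewrite scale1r.
by rewrite subr_eq0.
Qed.

End Derivatives.

Lemma within_continuousP {S T : topologicalType} (D : set S) (f : S -> T) :
  {within D, continuous f} <->
  forall t, D t -> f @ within D (nbhs t) --> f t.
Proof. exact: subspace_continuousP. Qed.

Lemma ler_dist_half (R : realFieldType) (a b c e : R) :
  `|a - c| < e / 2 -> `|b - c| < e / 2 -> `|a - b| <= e.
Proof.
rewrite !ltr_norml ler_norml => /andP[? ?] /andP[? ?].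
by apply/andP; split; lra.
Qed.

(** * Smooth functions and coordinate changes *)

Section MixedDerivatives.
Context {R : realType} {V : normedModType R}.
Implicit Types (f : V -> R) (u v x : V).

Lemma is_derive_line f u x (t : R) : differentiable f (t *: u + x) ->
  is_derive t 1 (fun s : R => f (s *: u + x)) ('D_u f (t *: u + x)).
Proof.
move=> df; have hd : has_deriv setT (fun s : R => f (s *: u + x)) t
    ('d f (t *: u + x) u).
  apply: (@has_deriv_chain _ _ _ setT (fun s : R => s *: u + x)) => //.
  exact: has_deriv_affine.
by rewrite deriveE//; apply: has_deriv_is_derive hd; exact: filterT.
Qed.

Lemma MVT_line f u x (d : R) : 0 < d ->
  (forall s : R, 0 <= s <= d -> differentiable f (s *: u + x)) ->
  exists2 s, 0 <= s <= d & f (d *: u + x) - f x = d * 'D_u f (s *: u + x).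
Proof.
move=> d0 df.
have H (s : R) : 0 <= s <= d ->
    is_derive s 1 (fun s : R => f (s *: u + x)) ('D_u f (s *: u + x)).
  by move=> /df; exact: is_derive_line.
have [|s|s sd] := @MVT R (fun s => f (s *: u + x)) (fun s => 'D_u f (s *: u + x)) 0 d d0.
- by move=> s; rewrite in_itv/= => /andP[s0 sd]; apply: H; rewrite !ltW.
- apply: derivable_within_continuous => r; rewrite in_itv/= => /H hr.
  exact: ex_derive.
- rewrite scale0r add0r subr0 => ->; exists s; last by rewrite mulrC.
  by move: sd; rewrite in_itv/= => /andP[? ?]; rewrite !ltW.
Qed.

(** Two uses of the mean value theorem: along [u] for the increment [g] of [f] in the direction [v],
    then along [v] for ['D_u f]. *)
Lemma second_difference f u v x (d : R) : 0 < d ->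
  (forall s t : R, 0 <= s <= d -> 0 <= t <= d ->
     differentiable f (t *: v + (s *: u + x)) /\
     differentiable ('D_u f) (t *: v + (s *: u + x))) ->
  exists s t, [/\ 0 <= s <= d, 0 <= t <= d &
    f (d *: v + (d *: u + x)) - f (d *: u + x) - f (d *: v + x) + f x =
    d ^+ 2 * 'D_v ('D_u f) (t *: v + (s *: u + x))].
Proof.
move=> d0 H.
have dd : 0 <= d <= d by rewrite lexx ltW.
have z0 : 0 <= (0 : R) <= d by rewrite lexx ltW.
pose g y := f (d *: v + y) - f y.
have dsh y : differentiable (fun z => d *: v + z) y.
  exact: differentiableD.
have sh y : differentiable f (d *: v + y) ->
    differentiable (fun z => f (d *: v + z)) y /\
    'D_u (fun z => f (d *: v + z)) y = 'D_u f (d *: v + y).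
  move=> df; have dc : differentiable (f \o (fun z => d *: v + z)) y.
    exact: differentiable_comp.
  split => //; rewrite /derive; under eq_fun do rewrite /= addrCA.
  by [].
have dg (s : R) : 0 <= s <= d -> differentiable g (s *: u + x).
  move=> sd; apply: differentiableB; first exact: (sh _ (H s d sd dd).1).1.
  by have := (H s 0 sd z0).1; rewrite scale0r add0r.
have [s sd E] := MVT_line d0 dg.
have [t td E'] := MVT_line d0 (fun t td => (H s t sd td).2).
exists s, t; split => //.
rewrite expr2 -mulrA -E' /g in E *.
transitivity (g (d *: u + x) - g x); first by rewrite /g; ring.
rewrite [LHS]E; congr (_ * _).
have d1 := (H s d sd dd).1.
have d2 : differentiable f (s *: u + x).
  by have := (H s 0 sd z0).1; rewrite scale0r add0r.
by rewrite deriveB ?(sh _ d1).2//; apply: diff_derivable => //; exact: (sh _ d1).1.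
Qed.

(** The second difference is symmetric in [u] and [v]. So the two mixed derivatives take a common
    value, at two points as close to [x] as desired, and continuity at [x] concludes. *)
Lemma mixed_derivatives f u v x :
  (\forall y \near x, differentiable f y) ->
  (\forall y \near x, differentiable ('D_u f) y) ->
  (\forall y \near x, differentiable ('D_v f) y) ->
  {for x, continuous ('D_v ('D_u f))} -> {for x, continuous ('D_u ('D_v f))} ->
  'D_v ('D_u f) x = 'D_u ('D_v f) x.
Proof.
move=> df du dv cvu cuv; apply/eqP; rewrite -subr_eq0 -normr_le0.
apply/ler_addgt0Pl => e e0; rewrite addr0.
have e2 : 0 < e / 2 by rewrite divr_gt0.
have H : \forall y \near x, [/\ differentiable f y, differentiable ('D_u f) y,
    differentiable ('D_v f) y,
    `|'D_v ('D_u f) x - 'D_v ('D_u f) y| < e / 2 &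
    `|'D_u ('D_v f) x - 'D_u ('D_v f) y| < e / 2].
  move/cvgrPdist_lt : cvu => /(_ _ e2) cvu.
  move/cvgrPdist_lt : cuv => /(_ _ e2) cuv.
  apply: filterS (filterI df (filterI du (filterI dv (filterI cvu cuv)))).
  by move=> y [d1 [d2 [d3 [c1 c2]]]]; exact: And5 d1 d2 d3 c1 c2.
move/nbhs_ballP : H => [r /= r0 H].
pose k := `|u| + `|v| + 1.
have k0 : 0 < k by rewrite ltr_wpDl// addr_ge0.
(* With this side the parallelogram at [x] stays within [d * k = r / 2] of [x]. *)
pose d := r / k / 2.
have d0 : 0 < d by rewrite !divr_gt0.
have inb (s t : R) : 0 <= s <= d -> 0 <= t <= d ->
    ball x r (t *: v + (s *: u + x)).
  move=> /andP[s0 sd] /andP[t0 td]; rewrite -ball_normE/= addrA opprD addrCA subrr.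
  rewrite addr0 normrN; apply: le_lt_trans (ler_normD _ _) _.
  rewrite !normrZ !ger0_norm//.
  have : t * `|v| + s * `|u| <= d * k.
    rewrite /k; have := normr_ge0 u; have := normr_ge0 v; nra.
  move/le_lt_trans; apply; rewrite /d mulrAC divfK ?gt_eqF//; lra.
have [s [t [sd td E]]] : exists s t, [/\ 0 <= s <= d, 0 <= t <= d &
    f (d *: v + (d *: u + x)) - f (d *: u + x) - f (d *: v + x) + f x =
    d ^+ 2 * 'D_v ('D_u f) (t *: v + (s *: u + x))].
  by apply: second_difference => // s t sd td; have [] := H _ (inb s t sd td).
have [s' [t' [sd' td' E']]] : exists s t, [/\ 0 <= s <= d, 0 <= t <= d &
    f (d *: u + (d *: v + x)) - f (d *: v + x) - f (d *: u + x) + f x =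
    d ^+ 2 * 'D_u ('D_v f) (t *: u + (s *: v + x))].
  apply: second_difference => // s' t' sd' td'.
  by rewrite addrCA; have [] := H _ (inb t' s' td' sd').
have EE : 'D_v ('D_u f) (t *: v + (s *: u + x)) =
          'D_u ('D_v f) (t' *: u + (s' *: v + x)).
  apply: (@mulfI _ (d ^+ 2)); first by rewrite expf_neq0// gt_eqF.
  refine (etrans (esym E) (etrans _ E')); congr (_ + f x).
  rewrite addrAC; congr (f _ - _ - _); exact: addrCA.
have [_ _ _ h1 _] := H _ (inb s t sd td).
have := H _ (inb t' s' td' sd'); rewrite addrCA => -[_ _ _ _ h2].
rewrite EE in h1; exact: ler_dist_half h1 h2.
Qed.

End MixedDerivatives.

Section Smooth.
Context {R : realType} {n : nat} (D : set 'rV[R]_n) (f : 'rV[R]_n -> R).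
Hypothesis sf : smooth D f.

Lemma smooth_differentiable x : D x -> differentiable f x.
Proof. by have [+ _] := sf 1; apply. Qed.

Lemma smooth_derive i : smooth D ('D_(delta_mx 0 i) f).
Proof. by move=> k; have [_] := sf k.+1; apply. Qed.

Lemma smooth_continuous x : D x -> {for x, continuous f}.
Proof. by move=> Dx; have := sf 0; apply. Qed.

End Smooth.

Lemma smooth_schwarz {R : realType} n (D : set 'rV[R]_n) (f : 'rV[R]_n -> R) x i j :
  open D -> smooth D f -> D x ->
  'D_(delta_mx 0 j) ('D_(delta_mx 0 i) f) x =
  'D_(delta_mx 0 i) ('D_(delta_mx 0 j) f) x.
Proof.
move=> oD sf Dx.
have nD : nbhs x D by exact: open_nbhs_nbhs.
apply: mixed_derivatives.
- by apply: filterS nD => y Dy; exact: smooth_differentiable sf _ Dy.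
- by apply: filterS nD => y; apply: smooth_differentiable; exact: smooth_derive.
- by apply: filterS nD => y; apply: smooth_differentiable; exact: smooth_derive.
- by apply: (smooth_continuous _ Dx); do 2 apply: smooth_derive.
- by apply: (smooth_continuous _ Dx); do 2 apply: smooth_derive.
Qed.

Section DirectionalDerivatives.
Context {R : realType} {n : nat}.
Implicit Types (D : set 'rV[R]_n) (f : 'rV[R]_n -> R) (x v : 'rV[R]_n).

(** The differential written with partial derivatives: its joint continuity in [x] and [v] then
    reduces to that of smooth functions. *)
Definition dderiv f x v : R := \sum_i v 0 i * 'D_(delta_mx 0 i) f x.

Lemma dderivE f x v : differentiable f x -> 'd f x v = dderiv f x v.
Proof.
move=> df; rewrite {1}(row_sum_delta v) linear_sum; apply: eq_bigr => i _.
by rewrite linearZ deriveE.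
Qed.

Lemma has_deriv_dderiv D f (E : set R) (y : R -> 'rV[R]_n) t v :
  smooth D f -> D (y t) -> has_deriv E y t v ->
  has_deriv E (fun s => f (y s) : R) t (dderiv f (y t) v).
Proof.
move=> sf Dy hy; have df := smooth_differentiable sf Dy.
by rewrite -dderivE//; exact: has_deriv_chain.
Qed.

Lemma differentiable_rV m (F : 'rV[R]_n -> 'rV[R]_m) x :
  (forall j, differentiable (fun y => F y 0 j : R) x) -> differentiable F x.
Proof.
move=> H.
have -> : F = \sum_(j < m) (fun y => F y 0 j *: (delta_mx 0 j : 'rV[R]_m)).
  by apply/funext => y; rewrite {1}(row_sum_delta (F y)) fct_sumE.
by apply: differentiable_sum => j; exact: differentiableZl.
Qed.

Lemma jacobianE m (F : 'rV[R]_n -> 'rV[R]_m) x i j : differentiable F x ->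
  ('J F x) i j = 'D_(delta_mx 0 i) (fun y => F y 0 j) x.
Proof.
move=> dF; have := deriveEjacobian (delta_mx 0 i) dF.
rewrite -rowE => /rowP/(_ j); rewrite mxE => <-.
by rewrite derive_mx ?mxE//; exact: diff_derivable.
Qed.

Lemma has_deriv_jacobian m (F : 'rV[R]_n -> 'rV[R]_m) (E : set R)
    (y : R -> 'rV[R]_n) t v : differentiable F (y t) -> has_deriv E y t v ->
  has_deriv E (fun s => F (y s)) t (v *m 'J F (y t)).
Proof.
move=> dF hy; rewrite -deriveEjacobian// deriveE//.
exact: has_deriv_chain.
Qed.

End DirectionalDerivatives.

Lemma has_deriv_near_val {R : realType} (V : normedModType R) (E : set R)
    (y : R -> V) t v (P : set V) : has_deriv E y t v -> nbhs (y t) P ->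
  \forall s \near t, E s -> P (y s).
Proof. by move=> /has_deriv_cont hy nP; have := hy _ nP. Qed.

Lemma fat_setT {R : realType} : fat [set: R].
Proof.
split=> [|t]; first by [].
by exists (t + 1) => //; rewrite -subr_eq0 addrAC subrr add0r oner_neq0.
Qed.

Section Charts.
Context {R : realType} {M : manifold R}.
Implicit Types (c : ix M) (p : M) (v w : 'rV[R]_4).

Definition overlap c c' : set 'rV[R]_4 := phi M c @` (dom M c `&` dom M c').

Definition trans c c' (x : 'rV[R]_4) := phi M c' (psi M c x).

Lemma near_psi c p (A : set M) : dom M c p -> nbhs p A ->
  \forall x \near phi M c p, A (psi M c x).
Proof. by move=> Dp nA; apply: psi_cont => //; rewrite phiK. Qed.

Lemma near_codom c p : dom M c p ->
  \forall x \near phi M c p, (phi M c @` dom M c) x.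
Proof.
by move=> Dp; apply: open_nbhs_nbhs; split; [exact: codom_open|exists p].
Qed.

Lemma near_dom c p : dom M c p -> \forall q \near p, dom M c q.
Proof. by move=> Dp; apply: open_nbhs_nbhs; split; [exact: dom_open|]. Qed.

Lemma near_phi c p (A : set 'rV[R]_4) : dom M c p -> nbhs (phi M c p) A ->
  \forall q \near p, A (phi M c q).
Proof. by move=> Dp nA; apply: (phi_cont Dp). Qed.

Lemma overlap_open c c' : open (overlap c c').
Proof.
rewrite openE => _ [p [Dp D'p] <-]; rewrite /interior.
apply: filterS2 (near_codom Dp) (near_psi Dp (near_dom D'p)).
by move=> _ [q Dq <-]; rewrite phiK// => D'q; exists q.
Qed.

Lemma overlap_phi c c' p : dom M c p -> dom M c' p ->
  overlap c c' (phi M c p).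
Proof. by move=> Dp D'p; exists p. Qed.

Lemma trans_smooth c c' j : smooth (overlap c c') (fun x => trans c c' x 0 j).
Proof. exact: transition_smooth. Qed.

Lemma trans_phi c c' p : dom M c p -> trans c c' (phi M c p) = phi M c' p.
Proof. by move=> Dp; rewrite /trans phiK. Qed.

Lemma trans_differentiable c c' x : overlap c c' x ->
  differentiable (trans c c') x.
Proof.
by move=> ox; apply: differentiable_rV => j;
  exact: (smooth_differentiable (@trans_smooth c c' j) ox).
Qed.

Definition jac c c' (x : 'rV[R]_4) : 'M[R]_4 := 'J (trans c c') x.

Lemma transitionE c c' p : transition c c' p = jac c c' (phi M c p).
Proof. by []. Qed.

(** The Hessian of the coordinate change contracted with [v], that is, the derivative of [jac] in
    the direction [v]. *)
Definition djac c c' (x v : 'rV[R]_4) : 'M[R]_4 :=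
  \matrix_(i, j) dderiv ('D_(delta_mx 0 i) (fun y => trans c c' y 0 j)) x v.

Lemma jac_smooth c c' i j : smooth (overlap c c')
  ('D_(delta_mx 0 i) (fun y => trans c c' y 0 j)).
Proof. by apply: smooth_derive; exact: trans_smooth. Qed.

Lemma jacE c c' x : overlap c c' x -> jac c c' x =
  \matrix_(i, j) 'D_(delta_mx 0 i) (fun y => trans c c' y 0 j) x.
Proof.
move=> ox; apply/matrixP => i j; rewrite [RHS]mxE /jac jacobianE//.
exact: trans_differentiable.
Qed.

Lemma has_deriv_trans c c' (E : set R) (y : R -> 'rV[R]_4) t v :
  overlap c c' (y t) -> has_deriv E y t v ->
  has_deriv E (fun s => trans c c' (y s)) t (v *m jac c c' (y t)).
Proof.
by move=> oy; apply: has_deriv_jacobian; exact: trans_differentiable.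
Qed.

Lemma near_overlap c c' x : overlap c c' x -> \forall y \near x, overlap c c' y.
Proof. by move=> ox; apply: open_nbhs_nbhs; split; [exact: overlap_open|]. Qed.

Lemma has_deriv_jac c c' (E : set R) (y : R -> 'rV[R]_4) t v :
  E t -> overlap c c' (y t) -> has_deriv E y t v ->
  has_deriv E (fun s => jac c c' (y s)) t (djac c c' (y t) v).
Proof.
move=> Et oy hy.
apply: (@has_deriv_near _ _ _ (fun s => \matrix_(i, j)
    'D_(delta_mx 0 i) (fun y => trans c c' y 0 j) (y s))).
- by rewrite jacE.
- apply: filterS (has_deriv_near_val hy (near_overlap oy)) => s H /H {}H.
  by rewrite jacE.
- apply/has_deriv_mx => i j; rewrite mxE.
  have -> : (fun s => (\matrix_(i, j)
      'D_(delta_mx 0 i) (fun y => trans c c' y 0 j) (y s)) i j) =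
    (fun s => 'D_(delta_mx 0 i) (fun y => trans c c' y 0 j) (y s)).
    by apply/funext => s; rewrite mxE.
  exact: (has_deriv_dderiv (@jac_smooth c c' i j)).
Qed.

(** Schwarz's theorem for the Hessian; it is what makes a connection transported from another chart
    torsion-free. *)
Lemma djac_sym c c' x v w : overlap c c' x ->
  w *m djac c c' x v = v *m djac c c' x w.
Proof.
move=> ox; apply/rowP => j; rewrite !mxE.
under eq_bigr do rewrite mxE /dderiv mulr_sumr.
under [RHS]eq_bigr do rewrite mxE /dderiv mulr_sumr.
rewrite exchange_big; apply: eq_bigr => i _; apply: eq_bigr => k _.
by rewrite (smooth_schwarz k i (@overlap_open c c') (@trans_smooth c c' j) ox) mulrCA.
Qed.

(** Both sides give the velocity, in the chart [c''], of the same coordinate line of [c]: one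
    directly, the other by way of [c']. *)
Lemma jac_cocycle c c' c'' p : dom M c p -> dom M c' p -> dom M c'' p ->
  jac c c'' (phi M c p) = jac c c' (phi M c p) *m jac c' c'' (phi M c' p).
Proof.
move=> Dp D'p D''p; apply/row_matrixP => i; rewrite !rowE mulmxA.
set v := delta_mx _ _.
pose y (s : R) := s *: v + phi M c p.
have y0 : y 0 = phi M c p by rewrite /y scale0r add0r.
have hy : has_deriv setT y 0 v by exact: has_deriv_affine.
have o1 : overlap c c'' (y 0) by rewrite y0; exact: overlap_phi.
have o2 : overlap c c' (y 0) by rewrite y0; exact: overlap_phi.
have h1 := has_deriv_trans o1 hy.
have h2 := has_deriv_trans o2 hy.
have o3 : overlap c' c'' (trans c c' (y 0)).
  by rewrite y0 trans_phi//; exact: overlap_phi.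
have h3 := has_deriv_trans o3 h2.
rewrite -y0 -(trans_phi c' Dp) -y0.
apply: (has_deriv_unique fat_setT _ h1); first by [].
apply: has_deriv_near h3.
  by rewrite y0 (trans_phi c' Dp) (trans_phi c'' D'p) (trans_phi c'' Dp).
have := has_deriv_near_val hy (near_overlap o2).
by apply: filterS => s /(_ Logic.I) [q [Dq D'q] <-] _;
  rewrite (trans_phi c' Dq) (trans_phi c'' D'q) (trans_phi c'' Dq).
Qed.

Lemma jac_id c p : dom M c p -> jac c c (phi M c p) = 1%:M.
Proof.
move=> Dp; apply/row_matrixP => i; rewrite !rowE mulmx1.
set v := delta_mx _ _.
pose y (s : R) := s *: v + phi M c p.
have y0 : y 0 = phi M c p by rewrite /y scale0r add0r.
have hy : has_deriv setT y 0 v by exact: has_deriv_affine.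
have o1 : overlap c c (y 0) by rewrite y0; exact: overlap_phi.
have h1 := has_deriv_trans o1 hy.
rewrite -y0; apply: (has_deriv_unique fat_setT _ h1); first by [].
apply: (has_deriv_near _ _ hy); first by rewrite y0 (trans_phi c Dp).
have := has_deriv_near_val hy (near_overlap o1).
by apply: filterS => s /(_ Logic.I) [q [Dq D'q] <-] _; rewrite (trans_phi c Dq).
Qed.

Lemma jac_unit c c' p : dom M c p -> dom M c' p ->
  jac c c' (phi M c p) \in unitmx.
Proof.
move=> Dp D'p; have := jac_cocycle Dp D'p Dp; rewrite (jac_id Dp) => /esym E.
by case: (mulmx1_unit E) => h _; exact: h.
Qed.

End Charts.

(** * The Levi-Civita connection in charts *)

(* The Levi-Civita connection is the only torsion-free metric one: the trilinear
   form [u K(v) G w^T] is symmetric in [u, v] and antisymmetric in [u, w]. *)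
Lemma koszul_unique {R : realFieldType} n (G : 'M[R]_n) (K : 'rV[R]_n -> 'M[R]_n) :
  G \in unitmx -> (forall v, (K v *m G)^T = - (K v *m G)) ->
  (forall v w, w *m K v = v *m K w) -> forall v, K v = 0.
Proof.
move=> Gu Ka Ks v.
pose b (u v w : 'rV[R]_n) := (u *m (K v *m G) *m w^T) 0 0.
have oppE (Y : 'M[R]_1) : (- Y) 0 0 = - Y 0 0 by rewrite mxE.
have ba u0 v0 w0 : b u0 v0 w0 = - b w0 v0 u0.
  rewrite /b; set X := K v0 *m G.
  have -> : (w0 *m X *m u0^T) 0 0 = (w0 *m X *m u0^T)^T 0 0
    by rewrite [RHS]mxE.
  by rewrite trmx_mul trmxK (trmx_mul w0) /X Ka mulNmx mulmxN
    oppE opprK !mulmxA.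
have bs u0 v0 w0 : b u0 v0 w0 = b v0 u0 w0 by rewrite /b !mulmxA Ks.
have b0 u0 v0 w0 : b u0 v0 w0 = 0.
  (* Alternating the two symmetries three times comes back to the same arguments with the opposite
     sign. *)
  have E : b u0 v0 w0 = - b u0 v0 w0.
    by rewrite {1}ba bs ba opprK bs ba bs.
  lra.
suff E : K v *m G = 0 by rewrite -[K v](mulmxK Gu) E mul0mx.
apply/matrixP => i j; have := b0 (delta_mx 0 i) v (delta_mx 0 j).
by rewrite /b -rowE trmx_delta -colE !mxE.
Qed.

Section Connection.
Context {R : realType} (M : spacetime R).
Implicit Types (c : ix M) (p : M) (v w x : 'rV[R]_4).

Definition gmat c x : 'M[R]_4 := gmx (metric M) c (psi M c x).

Definition dgmat c x v : 'M[R]_4 := \matrix_(i, j) dderiv (gcomp (M := M) c i j) x v.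

(** In indices, the sum over [i] of [v^i] times the [j]-th partial derivative of [g_il]. With its
    transpose it supplies the two terms of the Christoffel symbols that [dgmat] does not. *)
Definition dgmat' c x v : 'M[R]_4 :=
  \matrix_(j, l) \sum_i v 0 i * dgcomp (M := M) c j i l x.

Lemma gmat_phi c p : dom M c p -> gmat c (phi M c p) = gmx (metric M) c p.
Proof. by move=> Dp; rewrite /gmat phiK. Qed.

Lemma codom_dom c x : (phi M c @` dom M c) x -> dom M c (psi M c x).
Proof. by move=> [p Dp <-]; rewrite phiK. Qed.

Lemma gmx_unit c p : dom M c p -> gmx (metric M) c p \in unitmx.
Proof.
move=> Dp; have [P Pu E] := gmx_signature (metric M) Dp.
suff : P *m gmx (metric M) c p *m P^T \in unitmx.
  by rewrite !unitmx_mul => /andP[/andP[]].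
rewrite E unitmxE det_diag unitfE; apply/prodf_neq0 => i _.
by rewrite mxE; case: ifP; rewrite ?oppr_eq0 oner_neq0.
Qed.

Lemma gcomp_smooth c i j : smooth (phi M c @` dom M c) (gcomp (M := M) c i j).
Proof. exact: gmx_smooth. Qed.

Lemma dgcomp_sym c x l i j : (phi M c @` dom M c) x ->
  dgcomp (M := M) c l i j x = dgcomp (M := M) c l j i x.
Proof.
move=> cx; apply: near_eq_derive.
have : nbhs x (phi M c @` dom M c).
  by apply: open_nbhs_nbhs; split; [exact: codom_open|].
apply: filterS => y /codom_dom Dy.
by rewrite /gcomp -[in LHS](gmx_sym (metric M) Dy) mxE.
Qed.

Lemma dgmat_sym c x v : (phi M c @` dom M c) x -> (dgmat c x v)^T = dgmat c x v.
Proof.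
move=> cx; apply/matrixP => i j; rewrite !mxE; apply: eq_bigr => l _.
by congr (_ * _); exact: dgcomp_sym.
Qed.

Lemma has_deriv_gmat c (E : set R) (y : R -> 'rV[R]_4) t v :
  (phi M c @` dom M c) (y t) -> has_deriv E y t v ->
  has_deriv E (fun s => gmat c (y s)) t (dgmat c (y t) v).
Proof.
move=> cy hy; apply/has_deriv_mx => i j; rewrite mxE.
exact: (has_deriv_dderiv (@gcomp_smooth c i j)).
Qed.

(** Lowering the index cancels the inverse metric and leaves the Christoffel symbols of the first
    kind, contracted with [v]. *)
Lemma conn_gmat c x v : (phi M c @` dom M c) x ->
  conn c x v *m gmat c x =
  2^-1 *: (dgmat c x v + dgmat' c x v - (dgmat' c x v)^T).
Proof.
move=> cx; have Dx := codom_dom cx.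
set S := dgmat c x v + dgmat' c x v - (dgmat' c x v)^T.
have -> : conn c x v = 2^-1 *: (S *m (invmx (gmat c x))^T).
  apply/matrixP => j k; rewrite !mxE.
  under eq_bigr do rewrite /christoffel mulrCA.
  rewrite -mulr_sumr; congr (_ * _).
  under eq_bigr do rewrite mulr_sumr.
  rewrite exchange_big; apply: eq_bigr => l _; rewrite !mxE.
  rewrite /dderiv -big_split/= -sumrB mulr_suml; apply: eq_bigr => i _.
  by rewrite /dgcomp /gmat -!mulrDr -mulrBr mulrCA mulrC.
rewrite -scalemxAl -mulmxA trmx_inv (gmx_sym (metric M) Dx) mulVmx ?mulmx1//.
exact: gmx_unit.
Qed.

(** Metric compatibility: the part [dgmat' - dgmat'^T] is antisymmetric and disappears when the
    transpose is added. *)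
Lemma conn_metric c x v : (phi M c @` dom M c) x ->
  conn c x v *m gmat c x + (conn c x v *m gmat c x)^T = dgmat c x v.
Proof.
move=> cx; rewrite (conn_gmat v cx).
have half (A B : 'M[R]_4) : A^T = A ->
    2^-1 *: (A + B - B^T) + (2^-1 *: (A + B - B^T))^T = A.
  move=> As; apply/matrixP => i j; have : A^T i j = A i j by rewrite As.
  rewrite !mxE; lra.
by apply: half; exact: dgmat_sym.
Qed.

(** Torsion-freeness: once the index is lowered, exchanging [v] and [w] swaps the first two
    derivative terms and, the metric being symmetric, preserves the third. *)
Lemma conn_sym c x v w : (phi M c @` dom M c) x ->
  w *m conn c x v = v *m conn c x w.
Proof.
move=> cx; have Dx := codom_dom cx.
have Gu : gmat c x \in unitmx by exact: gmx_unit.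
rewrite -[LHS](mulmxK Gu) -[RHS](mulmxK Gu); congr (_ *m _).
rewrite -!mulmxA !conn_gmat// -!scalemxAr; congr (_ *: _).
apply/rowP => l; rewrite !mxE.
under eq_bigr do rewrite !mxE /dderiv -big_split/= -sumrB mulr_sumr.
under [RHS]eq_bigr do rewrite !mxE /dderiv -big_split/= -sumrB mulr_sumr.
rewrite exchange_big; apply: eq_bigr => i _; apply: eq_bigr => j _.
rewrite -!/(dgcomp _ _ _ _ _) (dgcomp_sym l i j cx); ring.
Qed.

End Connection.

Section ChangeOfChart.
Context {R : realType} (M : spacetime R).
Implicit Types (c : ix M) (p : M) (v w x : 'rV[R]_4).

Lemma overlap_codom c c' x : overlap (M := M) c c' x -> (phi M c @` dom M c) x.
Proof. by move=> [p [Dp _] <-]; exists p. Qed.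

Lemma gmat_change c c' x : overlap (M := M) c c' x ->
  gmat c x = jac c c' x *m gmat c' (trans c c' x) *m (jac c c' x)^T.
Proof.
move=> [p [Dp D'p] <-]; rewrite (trans_phi c' Dp) !gmat_phi//.
exact: gmx_change.
Qed.

(** The product rule for [gmat_change] along the line through [x] in the direction [v]. *)
Lemma dgmat_change c c' x v : overlap (M := M) c c' x ->
  let J := jac c c' x in let G' := gmat c' (trans c c' x) in
  dgmat c x v =
    djac c c' x v *m G' *m J^T + J *m dgmat c' (trans c c' x) (v *m J) *m J^T
    + J *m G' *m (djac c c' x v)^T.
Proof.
move=> ox J G'.
pose y (s : R) := s *: v + x.
have y0 : y 0 = x by rewrite /y scale0r add0r.
have hy : has_deriv setT y 0 v by exact: has_deriv_affine.
have oy : overlap (M := M) c c' (y 0) by rewrite y0.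
have hg := has_deriv_gmat (overlap_codom oy) hy.
have hJ := has_deriv_jac (I : setT (0 : R)) oy hy.
have oy' : (phi M c' @` dom M c') (trans c c' (y 0)).
  by rewrite y0; case: ox => p [Dp D'p] <-; rewrite (trans_phi c' Dp); exists p.
have hg' := has_deriv_gmat oy' (has_deriv_trans oy hy).
have h := has_deriv_mulmx (has_deriv_mulmx hJ hg') (has_deriv_trmx hJ).
rewrite y0 in hg; rewrite y0 mulmxDl in h.
apply: (has_deriv_unique fat_setT _ hg); first by [].
apply: (has_deriv_near _ _ h); first by rewrite y0 -gmat_change.
have := has_deriv_near_val hy (near_overlap oy).
by apply: filterS => s /(_ Logic.I) os _; rewrite -(gmat_change os).
Qed.

Lemma jac_overlap_unit c c' x : overlap (M := M) c c' x -> jac c c' x \in unitmx.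
Proof. by move=> [p [Dp D'p] <-]; exact: jac_unit. Qed.

Lemma metric_cancel n (D C G J : 'M[R]_n) : G^T = G ->
  D *m G *m J^T + J *m (C + C^T) *m J^T + J *m G *m D^T -
  (D *m G *m J^T + J *m C *m J^T + (D *m G *m J^T + J *m C *m J^T)^T) = 0.
Proof.
move=> Gs.
have trD (A B : 'M[R]_n) : (A + B)^T = A^T + B^T.
  by apply/matrixP => i j; rewrite !mxE.
have comb (X Y Y' Z : 'M[R]_n) : X + (Y + Y') + Z - (X + Y + (Z + Y')) = 0.
  by apply/matrixP => i j; rewrite !mxE; lra.
rewrite trD !trmx_mul !trmxK Gs !mulmxA mulmxDr mulmxDl; exact: comb.
Qed.

(** The transformation law of the Christoffel symbols without index computations. The connection [L]
    transported from [c'] is metric and torsion-free like that of [c], so their difference [K]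
    satisfies the hypotheses of [koszul_unique]. *)
Lemma conn_change c c' x v : overlap (M := M) c c' x ->
  djac c c' x v + jac c c' x *m conn c' (trans c c' x) (v *m jac c c' x) =
  conn c x v *m jac c c' x.
Proof.
move=> ox; set J := jac c c' x; set x' := trans c c' x.
have Ju : J \in unitmx by exact: jac_overlap_unit.
have cx := overlap_codom ox.
have cx' : (phi M c' @` dom M c') x'.
  by rewrite /x'; case: ox => p [Dp D'p] <-; rewrite (trans_phi c' Dp); exists p.
pose L w := (djac c c' x w + J *m conn c' x' (w *m J)) *m invmx J.
suff E : conn c x v - L v = 0.
  by move/eqP: E; rewrite subr_eq0 => /eqP ->; rewrite mulmxKV.
have Gu : gmat c x \in unitmx by exact/gmx_unit/codom_dom.
pose K w := conn c x w - L w.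
rewrite -/(K v); apply: (koszul_unique Gu) => {v}.
- move=> w; apply/eqP; rewrite -subr_eq0 opprK addrC; apply/eqP.
  rewrite /K mulmxBl linearB/= addrACA (conn_metric w cx) -opprD.
  have LG : L w *m gmat c x = djac c c' x w *m gmat c' x' *m J^T +
      J *m (conn c' x' (w *m J) *m gmat c' x') *m J^T.
    by rewrite (gmat_change ox) -/J -/x' /L !mulmxA mulmxKV// !mulmxDl.
  have G's : (gmat c' x')^T = gmat c' x' by exact/(gmx_sym (metric M))/codom_dom.
  rewrite LG (dgmat_change w ox) -/J -/x' -(conn_metric (w *m J) cx').
  exact: metric_cancel.
- move=> u w; rewrite /K !mulmxBr (conn_sym _ _ cx); congr (_ - _).
  rewrite /L !mulmxA; congr (_ *m _); rewrite !mulmxDr.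
  by rewrite (djac_sym _ _ ox) !mulmxA (conn_sym _ _ cx').
Qed.

Lemma covd_change k c c' x v (A Ad : 'M[R]_(k, 4)) : overlap (M := M) c c' x ->
  let J := jac c c' x in
  covd c' (trans c c' x) (A *m J) (v *m J) (Ad *m J + A *m djac c c' x v) =
  covd c x A v Ad *m J.
Proof.
move=> ox J; rewrite /covd mulmxDl -addrA -!mulmxA -mulmxDr.
by rewrite (conn_change v ox).
Qed.

Lemma theta_mulmx (A : 'M[R]_4) v : A \in unitmx -> theta A v *m A = v.
Proof. by move=> Au; rewrite /theta mulmxKV. Qed.

Lemma theta_change (A J : 'M[R]_4) v : A \in unitmx -> J \in unitmx ->
  theta (A *m J) (v *m J) = theta A v.
Proof.
move=> Au Ju; rewrite -{1}(theta_mulmx v Au) -mulmxA /theta mulmxK//.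
by rewrite unitmx_mul Au.
Qed.

(** The covariant derivative and the frame both acquire the factor [J] on the right, and it cancels
    because [omega] is taken relatively to the frame. *)
Lemma omega_change c c' x v (A Ad : 'M[R]_4) :
  A \in unitmx -> overlap (M := M) c c' x ->
  let J := jac c c' x in
  omega c' (trans c c' x) (A *m J) (v *m J) (Ad *m J + A *m djac c c' x v) =
  omega c x A v Ad.
Proof.
move=> Au ox J; have Ju : J \in unitmx by exact: jac_overlap_unit.
rewrite /omega (covd_change v A Ad ox) -/J; congr trmx.
set C := covd c x A v Ad; rewrite -{1}(mulmxKV Au C) -(mulmxA _ A J) mulmxK//.
by rewrite unitmx_mul Au.
Qed.

End ChangeOfChart.

(** * Curves of frames *)

Section TangTopology.
Context {R : realType} {M : manifold R} {k : nat}.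
Implicit Types (u : tang M k) (c : ix M).

Lemma tang_basic_open (W : set (tang M k)) : tang_basic W -> open W.
Proof.
move=> bW; exists [set W]; last by rewrite bigcup_set1.
by move=> _ ->; exact: (@finI_from1 _ _ _ id).
Qed.

Lemma cvg_tang_basic (T : Type) (F : set_system T) {FF : Filter F} (f : T -> tang M k) u :
  (forall W, tang_basic W -> W u -> \forall x \near F, W (f x)) ->
  f @ F --> u.
Proof.
move=> H A; rewrite nbhsE => -[B [oB Bu] BA].
case: oB => D' D'f DB; move: Bu; rewrite -DB => -[C D'C Cu].
have [I Ib IC] := D'f _ D'C.
have : \forall x \near F, C (f x).
  rewrite -IC; apply: filter_bigI => W IW.
  apply: H; first by have := Ib _ IW; rewrite inE.
  by move: Cu; rewrite -IC; apply.
by apply: filterS => x Cx; apply: BA; rewrite -DB; exists C.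
Qed.

(** All charts around the point have to be checked, since each of them contributes sets to the
    subbase. *)
Lemma cvg_tang (T : Type) (F : set_system T) {FF : Filter F} (f : T -> tang M k) u :
  (forall c, dom M c (pt u) -> [/\ \forall x \near F, dom M c (pt (f x)),
     phi M c (pt (f x)) @[x --> F] --> phi M c (pt u) &
     tcoord (f x) c @[x --> F] --> tcoord u c]) -> f @ F --> u.
Proof.
move=> H; apply: cvg_tang_basic => W [c [Q oQ ->]] [Du Qu].
have [dF xF aF] := H c Du.
apply: filterI => //.
have nQ : nbhs (phi M c (pt u), tcoord u c) Q by exact: open_nbhs_nbhs.
exact: (cvg_pair xF aF) nQ.
Qed.

Lemma near_tang_coord u c (P : 'rV[R]_4 -> Prop) (Q : 'M[R]_(k, 4) -> Prop) :
  dom M c (pt u) -> (\forall x \near phi M c (pt u), P x) ->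
  (\forall A \near tcoord u c, Q A) ->
  \forall v \near u, [/\ dom M c (pt v), P (phi M c (pt v)) & Q (tcoord v c)].
Proof.
move=> Du nP nQ.
pose O : set ('rV[R]_4 * 'M[R]_(k, 4)) := (P `*` Q)°.
have oO : open O by exact: open_interior.
have bW : tang_basic [set v | dom M c (pt v) /\ O (phi M c (pt v), tcoord v c)].
  by exists c, O.
have : nbhs u [set v | dom M c (pt v) /\ O (phi M c (pt v), tcoord v c)].
  apply: open_nbhs_nbhs; split; first exact: tang_basic_open.
  by split => //; exists (P, Q).
by apply: filterS => v [Dv /interior_subset[]].
Qed.

Lemma near_tang_dom u c : dom M c (pt u) -> \forall v \near u, dom M c (pt v).
Proof.
move=> Du; have := @near_tang_coord u c (fun=> True) (fun=> True) Du.
move=> /(_ filterT filterT).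
by apply: filterS => v [].
Qed.

Lemma phi_pt_cont u c : dom M c (pt u) ->
  phi M c (pt v) @[v --> u] --> phi M c (pt u).
Proof.
move=> Du P nP.
by apply: filterS (@near_tang_coord u c P (fun=> True) Du nP filterT) => v [].
Qed.

Lemma tcoord_cont u c : dom M c (pt u) -> tcoord v c @[v --> u] --> tcoord u c.
Proof.
move=> Du P nP.
by apply: filterS (@near_tang_coord u c (fun=> True) P Du filterT nP) => v [].
Qed.

Lemma pt_cont u : pt v @[v --> u] --> pt u.
Proof.
move=> P nP; set c := chart_at M (pt u).
have Du : dom M c (pt u) by exact: dom_chart_at.
apply: filterS (@near_tang_coord u c _ (fun=> True) Du (near_psi Du nP) filterT).
by move=> v [Dv + _]; rewrite phiK.
Qed.

Lemma tang_ext u v : pt u = pt v ->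
  (forall c, dom M c (pt u) -> tcoord u c = tcoord v c) -> u = v.
Proof.
case: u v => [p a a0 ac] [q b b0 bc] /= pq; subst q => ab.
have E : a = b.
  apply/funext => c; have [Dp|Dp] := pselect (dom M c p); first exact: ab.
  by rewrite a0// b0.
subst b; congr Tang; exact: Prop_irrelevance.
Qed.

End TangTopology.

Section TmulTopology.
Context {R : realType} {M : manifold R}.

Lemma tmul_continuous (k l : nat) (B : 'M[R]_(l, k)) :
  continuous (tmul B : tang M k -> tang M l).
Proof.
move=> u; apply: (@cvg_tang _ _ _ _ _ (nbhs_filter u)) => c Du; split => /=.
- exact: near_tang_dom.
- exact: phi_pt_cont.
- by apply: cvg_mulmx; [exact: cvg_cst|exact: tcoord_cont].
Qed.

Lemma tmul_comp (k l m : nat) (A : 'M[R]_(m, l)) (B : 'M[R]_(l, k)) (u : tang M k) :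
  tmul A (tmul B u) = tmul (A *m B) u.
Proof. by apply: tang_ext => // c _; rewrite /= mulmxA. Qed.

End TmulTopology.

Section FrameCurves.
Context {R : realType} (M : spacetime R).
Implicit Types (c : ix M) (D : set R).

Lemma tcoord_jac (k : nat) (u : tang M k) c c' : dom M c (pt u) -> dom M c' (pt u) ->
  tcoord u c' = tcoord u c *m jac c c' (phi M c (pt u)).
Proof. by move=> Dc Dc'; rewrite (tcoord_change Dc Dc') transitionE. Qed.

Lemma FMI (u : tang M 4) c : dom M c (pt u) -> tcoord u c \in unitmx -> FM M u.
Proof.
by move=> Dc Au c' Dc'; rewrite (tcoord_jac Dc Dc') unitmx_mul Au jac_unit.
Qed.

Section OneTime.
Variables (k : nat) (D : set R) (u : R -> tang M k) (t : R) (c : ix M).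
Variables (v : 'rV[R]_4) (B : 'M[R]_(k, 4)).
Hypotheses (fD : fat D) (Dt : D t) (Dc : dom M c (pt (u t))).
Hypothesis uc : \forall s \near t, D s -> dom M c (pt (u s)).
Hypothesis hx : has_deriv D (xpos c u) t v.
Hypothesis ha : has_deriv D (apos c u) t B.

Let ox c' : dom M c' (pt (u t)) -> overlap (M := M) c c' (xpos c u t).
Proof. by move=> Dc'; exists (pt (u t)). Qed.

Lemma curve_near_overlap c' : dom M c' (pt (u t)) -> \forall s \near t, D s ->
  dom M c (pt (u s)) /\ dom M c' (pt (u s)).
Proof.
move=> Dc'.
have := has_deriv_near_val hx (near_psi Dc (near_dom Dc')).
apply: filterS2 uc => s Ds Ds' sD; split; first exact: Ds.
by have := Ds' sD; rewrite /xpos phiK//; exact: Ds.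
Qed.

Lemma xpos_change c' : dom M c' (pt (u t)) ->
  has_deriv D (xpos c' u) t (v *m jac c c' (xpos c u t)).
Proof.
move=> Dc'; apply: (has_deriv_near _ _ (has_deriv_trans (ox Dc') hx)).
  by rewrite /xpos (trans_phi c' Dc).
apply: filterS (curve_near_overlap Dc') => s H /H [Ds _].
by rewrite /xpos (trans_phi c' Ds).
Qed.

Lemma apos_change c' : dom M c' (pt (u t)) ->
  has_deriv D (apos c' u) t
    (B *m jac c c' (xpos c u t) + apos c u t *m djac c c' (xpos c u t) v).
Proof.
move=> Dc'.
apply: (has_deriv_near _ _ (has_deriv_mulmx ha (has_deriv_jac Dt (ox Dc') hx))).
  by rewrite /apos /xpos -tcoord_jac.
by apply: filterS (curve_near_overlap Dc') => s H /H [Ds Ds']; rewrite /apos -tcoord_jac.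
Qed.

End OneTime.

Section Speed.
Variables (D : set R) (u : R -> tang M 4) (t : R) (c : ix M).
Variables (v : 'rV[R]_4) (B : 'M[R]_4).
Hypotheses (fD : fat D) (Dt : D t) (Dc : dom M c (pt (u t))).
Hypothesis uc : \forall s \near t, D s -> dom M c (pt (u s)).
Hypothesis hx : has_deriv D (xpos c u) t v.
Hypothesis ha : has_deriv D (apos c u) t B.
Hypothesis FMu : FM M (u t).

(** The arbitrary chart [c'] is replaced by a fixed [c]. Applied with [c'] chosen by [chart_at],
    this allows one chart to be kept near a given time although the choice may change from point to
    point. *)
Lemma frame_thetaE c' : dom M c' (pt (u t)) ->
  frame_theta D c' u t = theta (apos c u t) v.
Proof.
move=> Dc'; rewrite /frame_theta /xvel.
have hx' := xpos_change Dc uc hx Dc'.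
rewrite (has_deriv_lim fD Dt hx') {1}/apos (tcoord_jac Dc Dc').
by apply: theta_change; [exact: FMu|exact: jac_unit].
Qed.

Lemma frame_omegaE c' : dom M c' (pt (u t)) ->
  frame_omega D c' u t = omega c (xpos c u t) (apos c u t) v B.
Proof.
move=> Dc'; rewrite /frame_omega /xvel.
have hx' := xpos_change Dc uc hx Dc'.
have ha' := apos_change Dt Dc uc hx ha Dc'.
rewrite (has_deriv_lim fD Dt hx') (has_deriv_lim fD Dt ha').
have -> : xpos c' u t = trans c c' (xpos c u t) by rewrite /xpos (trans_phi c' Dc).
have -> : apos c' u t = apos c u t *m jac c c' (xpos c u t).
  by rewrite /apos (tcoord_jac Dc Dc').
by apply: omega_change; [exact: FMu|exists (pt (u t))].
Qed.

End Speed.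

End FrameCurves.

(** * Natural speed *)

Section InnerProducts.
Context {R : realType} {m n : nat} (b : 'M[R]_(m, n) -> 'M[R]_(m, n) -> R).
Hypothesis bP : inner_product b.

Let coef (p q : 'I_m * 'I_n) := b (delta_mx p.1 p.2) (delta_mx q.1 q.2).

Lemma inner_productE x :
  b x x = \sum_p \sum_q x p.1 p.2 * x q.1 q.2 * coef p q.
Proof.
have [bl bs _] := bP.
have b0 y : b 0 y = 0.
  by have := bl (-1) 0 0 y; rewrite scaler0 addr0 mulN1r addNr.
have bD x' y z : b (x' + y) z = b x' z + b y z.
  by have := bl 1 x' y z; rewrite scale1r mul1r.
have bZ a x' z : b (a *: x') z = a * b x' z.
  by have := bl a x' 0 z; rewrite addr0 b0 addr0.
have bsum y z : b y z = \sum_p y p.1 p.2 * b (delta_mx p.1 p.2) z.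
  rewrite -(pair_bigA _ (fun i j => y i j * b (delta_mx i j) z))/=.
  rewrite {1}(matrix_sum_delta y) (big_morph (b^~ z) (fun x y => bD x y z) (b0 z)).
  apply: eq_bigr => i _.
  rewrite (big_morph (b^~ z) (fun x y => bD x y z) (b0 z)).
  by apply: eq_bigr => j _; rewrite bZ.
rewrite bsum; apply: eq_bigr => p _; rewrite bs bsum mulr_sumr.
by apply: eq_bigr => q _; rewrite bs mulrA.
Qed.

Lemma cvg_inner_product (T : Type) (F : set_system T) {FF : Filter F}
    (f : T -> 'M[R]_(m, n)) (l : 'M[R]_(m, n)) :
  f @ F --> l -> b (f x) (f x) @[x --> F] --> b l l.
Proof.
move=> /cvg_mxP fl; under eq_cvg do rewrite inner_productE.
rewrite inner_productE; apply: cvg_sum => p _; apply: cvg_sum => q _.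
by apply: cvgM; [apply: cvgM; exact: fl|exact: cvg_cst].
Qed.

Lemma inner_product_ge0 x : 0 <= b x x.
Proof.
have [bl _ bpos] := bP; have [->|x0] := eqVneq x 0; last exact/ltW/bpos.
by have := bl (-1) 0 0 0; rewrite scaler0 addr0 mulN1r addNr => ->.
Qed.

Lemma inner_product_upper :
  exists2 K, 0 < K & forall x, Num.sqrt (b x x) <= K * `|x|.
Proof.
pose C := \sum_p \sum_q `|coef p q|.
have C0 : 0 <= C by apply: sumr_ge0 => p _; apply: sumr_ge0.
exists (C + 1) => [|x]; first by rewrite ltr_pwDr.
rewrite -(ger0_norm (normr_ge0 x)) -ler_sqr ?nnegrE ?sqrtr_ge0//; last first.
  by rewrite mulr_ge0// addr_ge0.
rewrite sqr_sqrtr ?inner_product_ge0// normr_id exprMn.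
apply: (@le_trans _ _ (C * `|x| ^+ 2)); last first.
  by rewrite ler_wpM2r ?exprn_ge0//; nra.
rewrite inner_productE /C mulr_suml; apply: ler_sum => p _.
rewrite mulr_suml; apply: ler_sum => q _.
rewrite (le_trans (ler_norm _))// normrM mulrC ler_wpM2l// normrM expr2.
by rewrite ler_pM// mx_norm_coord.
Qed.

(** The constant comes from the minimum of the quadratic form on the unit sphere, which is compact;
    [mxvec] turns matrices into row vectors without changing the sup norm. Homogeneity does the
    rest. *)
Lemma inner_product_lower :
  exists2 k, 0 < k & forall x, k * `|x| <= Num.sqrt (b x x).
Proof.
pose A := [set y : 'rV[R]_(m * n) | `|y| = 1].
have vecn x : `|mxvec x| = `|x| :> R.
  apply/eqP; rewrite eq_le; apply/andP; split; apply: mx_norm_le => // i j.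
    by case/mxvec_indexP: j => k l; rewrite ord1 mxvecE mx_norm_coord.
  by rewrite -mxvecE mx_norm_coord.
(* The sphere is empty when [m * n = 0]; zero is then the only matrix and any constant will do. *)
have [A0|A0] := pselect (A !=set0); last first.
  exists 1 => // x; have [->|x0] := eqVneq x 0; first by rewrite normr0 mulr0.
  exfalso; apply: A0; exists (mxvec (`|x|^-1 *: x)); rewrite /A /= vecn normrZ.
  by rewrite normfV normr_id mulVf// normr_eq0.
have cA : compact A.
  apply: bounded_closed_compact.
    exists 1; split; first exact: num_real.
    by move=> r r1 y /= ->; exact: ltW.
  rewrite (_ : A = (fun y : 'rV[R]_(m * n) => `|y|) @^-1` [set 1])//.
  apply: closed_comp; last exact: closed_eq.
  by move=> y _; exact: norm_continuous.
pose f (y : 'rV[R]_(m * n)) := b (vec_mx y) (vec_mx y).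
have [|y0 Ay0 Hy] := @EVT_min_rV R _ f A A0 cA.
  apply: continuous_subspaceT => y; have Fy : Filter (nbhs y) by exact: nbhs_filter.
  have cv : (vec_mx z : 'M[R]_(m, n)) @[z --> (y : 'rV[R]_(m * n))] --> vec_mx y.
    apply/cvg_mxP => i j; under eq_cvg do rewrite mxE.
    by rewrite mxE; exact: coord_continuous.
  exact: cvg_inner_product cv.
have fy0 : 0 < f y0.
  have [_ _ bpos] := bP; apply: bpos.
  move: Ay0; rewrite inE /A /= => y1; apply/eqP => y00.
  move: y1; rewrite -[y0]vec_mxK y00 linear0 normr0 => /esym/eqP.
  by rewrite oner_eq0.
exists (Num.sqrt (f y0)) => [|x]; first by rewrite sqrtr_gt0.
have [->|x0] := eqVneq x 0; first by rewrite normr0 mulr0 sqrtr_ge0.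
have nx : 0 < `|x| by rewrite normr_gt0.
pose y := mxvec (`|x|^-1 *: x).
have Ay : y \in A.
  by rewrite inE /A /= vecn normrZ normfV normr_id mulVf// gt_eqF.
have := Hy _ Ay; rewrite /f /y mxvecK => H.
have bZ : b x x = `|x| ^+ 2 * b (`|x|^-1 *: x) (`|x|^-1 *: x).
  rewrite !inner_productE mulr_sumr; apply: eq_bigr => p _.
  rewrite mulr_sumr; apply: eq_bigr => q _; rewrite !mxE.
  by field; rewrite gt_eqF.
rewrite bZ sqrtrM ?exprn_ge0// sqrtr_sqr normr_id mulrC.
by rewrite ler_wpM2l// ler_wsqrtr.
Qed.

End InnerProducts.

Section SpeedContinuity.
Context {R : realType} (M : spacetime R).
Implicit Types (c : ix M) (D : set R).

Lemma cvg_conn (T : Type) (F : set_system T) {FF : Filter F} c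
    (x : T -> 'rV[R]_4) (v : T -> 'rV[R]_4) (x0 v0 : 'rV[R]_4) :
  (phi M c @` dom M c) x0 -> x @ F --> x0 -> v @ F --> v0 ->
  conn c (x s) (v s) @[s --> F] --> conn c x0 v0.
Proof.
move=> cx0 xF vF; apply/cvg_mxP => j k; under eq_cvg do rewrite mxE.
have comp (f : 'rV[R]_4 -> R) : smooth (phi M c @` dom M c) f ->
    f (x s) @[s --> F] --> f x0.
  by move=> sf; apply: cvg_comp xF _; exact: (smooth_continuous sf cx0).
have gF : gmat c (x s) @[s --> F] --> gmat c x0.
  apply/cvg_mxP => a b; exact: (comp _ (gcomp_smooth c a b)).
have iF : invmx (gmat c (x s)) @[s --> F] --> invmx (gmat c x0).
  by apply: cvg_invmx => //; exact/gmx_unit/codom_dom.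
have dF l a b : dgcomp c l a b (x s) @[s --> F] --> dgcomp c l a b x0.
  by apply: comp; apply: smooth_derive; exact: gcomp_smooth.
rewrite mxE; apply: cvg_sum => i _; apply: cvgM.
  by move/cvg_mxP : vF; apply.
rewrite /christoffel; apply: cvgM; first exact: cvg_cst.
apply: cvg_sum => l _; apply: cvgM; first by move/cvg_mxP : iF; apply.
by apply: cvgB => //; exact: cvgD.
Qed.

Definition ptheta D (u : R -> tang M 4) t := frame_theta D (chart_at M (pt (u t))) u t.
Definition pomega D (u : R -> tang M 4) t := frame_omega D (chart_at M (pt (u t))) u t.

Lemma curve_near_dom D (u : R -> tang M 4) c t : {within D, continuous u} -> D t ->
  dom M c (pt (u t)) -> \forall s \near t, D s -> dom M c (pt (u s)).
Proof.
move=> /within_continuousP cu Dt Dc.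
by have := cu _ Dt _ (near_tang_dom Dc).
Qed.

Lemma ptheta_chart D (u : R -> tang M 4) c t : fat D -> C1_frame_curve D u -> D t ->
  dom M c (pt (u t)) -> ptheta D u t = theta (apos c u t) (deriv_in D (xpos c u) t).
Proof.
move=> fD [cu FMu C1u] Dt Dc; have [hx ha] := C1u c t Dt Dc.
apply: (frame_thetaE fD Dt Dc (curve_near_dom cu Dt Dc)).
- exact: C1_has_deriv.
- exact: FMu.
- exact: dom_chart_at.
Qed.

Lemma pomega_chart D (u : R -> tang M 4) c t : fat D -> C1_frame_curve D u -> D t ->
  dom M c (pt (u t)) -> pomega D u t =
    omega c (xpos c u t) (apos c u t) (deriv_in D (xpos c u) t) (deriv_in D (apos c u) t).
Proof.
move=> fD [cu FMu C1u] Dt Dc; have [hx ha] := C1u c t Dt Dc.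
apply: (frame_omegaE fD Dt Dc (curve_near_dom cu Dt Dc)).
- exact: C1_has_deriv.
- exact: C1_has_deriv.
- exact: FMu.
- exact: dom_chart_at.
Qed.

Lemma cvg_theta (T : Type) (F : set_system T) {FF : Filter F}
    (A : T -> 'M[R]_4) (v : T -> 'rV[R]_4) (A0 : 'M[R]_4) (v0 : 'rV[R]_4) : A0 \in unitmx ->
  A @ F --> A0 -> v @ F --> v0 -> theta (A s) (v s) @[s --> F] --> theta A0 v0.
Proof. by move=> Au AF vF; apply: cvg_mulmx => //; exact: cvg_invmx. Qed.

Lemma cvg_omega (T : Type) (F : set_system T) {FF : Filter F} c
    (x v : T -> 'rV[R]_4) (A B : T -> 'M[R]_4)
    (x0 v0 : 'rV[R]_4) (A0 B0 : 'M[R]_4) :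
  (phi M c @` dom M c) x0 -> A0 \in unitmx -> x @ F --> x0 ->
  A @ F --> A0 -> v @ F --> v0 -> B @ F --> B0 ->
  omega c (x s) (A s) (v s) (B s) @[s --> F] --> omega c x0 A0 v0 B0.
Proof.
move=> cx0 Au xF AF vF BF; apply: cvg_trmx; apply: cvg_mulmx; last exact: cvg_invmx.
by apply: cvgD => //; apply: cvg_mulmx => //; exact: cvg_conn.
Qed.

Lemma ptheta_continuous D (u : R -> tang M 4) : fat D -> C1_frame_curve D u ->
  {within D, continuous (ptheta D u)}.
Proof.
move=> fD C1; have [cu FMu C1u] := C1; apply/within_continuousP => t Dt.
set c := chart_at M (pt (u t)).
have Dc : dom M c (pt (u t)) by exact: dom_chart_at.
have [hx ha] := C1u c t Dt Dc.
have FF : Filter (within D (nbhs t)) by exact: within_filter.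
rewrite (ptheta_chart fD C1 Dt Dc).
have : theta (apos c u s) (deriv_in D (xpos c u) s) @[s --> within D (nbhs t)] -->
    theta (apos c u t) (deriv_in D (xpos c u) t).
  apply: cvg_theta; [exact: FMu|exact: C1_cont ha|exact: hx.2].
apply: cvg_trans; apply: near_eq_cvg; rewrite near_withinE.
apply: filterS (curve_near_dom cu Dt Dc) => s H Ds.
by rewrite (ptheta_chart fD C1 Ds (H Ds)).
Qed.

Lemma pomega_continuous D (u : R -> tang M 4) : fat D -> C1_frame_curve D u ->
  {within D, continuous (pomega D u)}.
Proof.
move=> fD C1; have [cu FMu C1u] := C1; apply/within_continuousP => t Dt.
set c := chart_at M (pt (u t)).
have Dc : dom M c (pt (u t)) by exact: dom_chart_at.
have [hx ha] := C1u c t Dt Dc.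
have FF : Filter (within D (nbhs t)) by exact: within_filter.
rewrite (pomega_chart fD C1 Dt Dc).
have : omega c (xpos c u s) (apos c u s) (deriv_in D (xpos c u) s)
    (deriv_in D (apos c u) s) @[s --> within D (nbhs t)] -->
    omega c (xpos c u t) (apos c u t) (deriv_in D (xpos c u) t) (deriv_in D (apos c u) t).
  apply: cvg_omega.
  - by exists (pt (u t)).
  - exact: FMu.
  - exact: C1_cont hx.
  - exact: C1_cont ha.
  - exact: hx.2.
  - exact: ha.2.
apply: cvg_trans; apply: near_eq_cvg; rewrite near_withinE.
apply: filterS (curve_near_dom cu Dt Dc) => s H Ds.
by rewrite (pomega_chart fD C1 Ds (H Ds)).
Qed.

Section NaturalSpeed.
Variables (b1 : 'M[R]_4 -> 'M[R]_4 -> R) (b2 : 'rV[R]_4 -> 'rV[R]_4 -> R).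
Hypotheses (ip1 : inner_product b1) (ip2 : inner_product b2).

Lemma natural_speedE D u t : natural_speed b1 b2 (M := M) D u t =
  Num.sqrt (b1 (pomega D u t) (pomega D u t) + b2 (ptheta D u t) (ptheta D u t)).
Proof. by []. Qed.

Lemma natural_speed_continuous D u : fat D -> C1_frame_curve D u ->
  {within D, continuous (natural_speed b1 b2 (M := M) D u)}.
Proof.
move=> fD C1; apply/within_continuousP => t Dt.
have FF : Filter (within D (nbhs t)) by exact: within_filter.
rewrite natural_speedE; under eq_cvg do rewrite natural_speedE.
apply: continuous_cvg; first exact: sqrt_continuous.
apply: cvgD; apply: cvg_inner_product => //.
  by move/within_continuousP : (pomega_continuous fD C1); apply.
by move/within_continuousP : (ptheta_continuous fD C1); apply.
Qed.

Lemma natural_speed_ge0 D u t : 0 <= natural_speed b1 b2 (M := M) D u t.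
Proof. exact: sqrtr_ge0. Qed.

(** Upper bounds on natural distances depend on the inner products through this [K] alone, which is
    uniform over all curves: a sup norm bound on [omega] and [theta] serves every natural distance
    at once. *)
Lemma natural_speed_upper : exists2 K, 0 < K & forall D u t,
  natural_speed b1 b2 (M := M) D u t <= K * (`|pomega D u t| + `|ptheta D u t|).
Proof.
have [K1 K10 H1] := inner_product_upper ip1.
have [K2 K20 H2] := inner_product_upper ip2.
exists (K1 + K2) => [|D u t]; first exact: addr_gt0.
rewrite natural_speedE.
set a := b1 _ _; set b := b2 _ _.
have a0 : 0 <= a by exact: inner_product_ge0.
have b0 : 0 <= b by exact: inner_product_ge0.
apply: (@le_trans _ _ (Num.sqrt a + Num.sqrt b)).
  rewrite -ler_sqr ?nnegrE ?sqrtr_ge0 ?addr_ge0 ?sqrtr_ge0//.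
  rewrite sqr_sqrtr ?addr_ge0// sqrrD !sqr_sqrtr// lerD2r lerDl.
  by rewrite mulrn_wge0// mulr_ge0 ?sqrtr_ge0.
rewrite mulrDr lerD//.
  by rewrite (le_trans (H1 _))// ler_wpM2r// lerDl ltW.
by rewrite (le_trans (H2 _))// ler_wpM2r// lerDr ltW.
Qed.

Lemma natural_speed_lower : exists2 k, 0 < k & forall D u t,
  k * `|pomega D u t| <= natural_speed b1 b2 (M := M) D u t /\
  k * `|ptheta D u t| <= natural_speed b1 b2 (M := M) D u t.
Proof.
have [k1 k10 H1] := inner_product_lower ip1.
have [k2 k20 H2] := inner_product_lower ip2.
exists (Num.min k1 k2) => [|D u t]; first by rewrite lt_min k10.
rewrite natural_speedE.
set a := b1 _ _; set b := b2 _ _.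
have a0 : 0 <= a by exact: inner_product_ge0.
have b0 : 0 <= b by exact: inner_product_ge0.
split.
- apply: (@le_trans _ _ (k1 * `|pomega D u t|)).
    by rewrite ler_wpM2r// ge_min lexx.
  by rewrite (le_trans (H1 _))// ler_wsqrtr// lerDl.
- apply: (@le_trans _ _ (k2 * `|ptheta D u t|)).
    by rewrite ler_wpM2r// ge_min lexx orbT.
  by rewrite (le_trans (H2 _))// ler_wsqrtr// lerDr.
Qed.

End NaturalSpeed.
End SpeedContinuity.

(** * Short paths stay over small neighbourhoods *)

(** Real induction from [s] downwards. Let [m] be the infimum of the times from which [P] holds up
    to [s]; the limit hypothesis gives [P m], and the extension hypothesis would go below [m] if
    [r < m]. *)
Lemma segment_induction {R : realType} (r s : R) (P : R -> Prop) : r <= s -> P s ->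
  (forall t, r < t <= s -> (forall t', t <= t' <= s -> P t') ->
     exists2 t0, t0 < t & forall t', r <= t' <= s -> t0 < t' <= t -> P t') ->
  (forall t, r <= t < s -> (forall t', t < t' <= s -> P t') -> P t) ->
  forall t, r <= t <= s -> P t.
Proof.
move=> rs Ps Pleft Plim.
pose S := [set t | r <= t <= s /\ forall t', t <= t' <= s -> P t'].
have Ss : S s.
  by split=> [|t' /andP[? ?]]; rewrite ?rs ?lexx// (_ : t' = s)//; apply/le_anti/andP.
have hS : has_inf S by split; [exists s|exists r => t [/andP[]]].
set m := inf S.
have rm : r <= m by apply: lb_le_inf; [exists s|move=> t [/andP[]]].
have ms : m <= s by apply: ge_inf; [exact: hS.2|].
have Pm t' : m < t' <= s -> P t'.
  move=> /andP[mt ts]; have [|t [_ St] tt] := @inf_adherent R S (t' - m) _ hS.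
    by rewrite subr_gt0.
  by apply: St; rewrite ts andbT ltW//; move: tt; rewrite addrCA subrr addr0.
have Pm' t' : m <= t' <= s -> P t'.
  rewrite le_eqVlt => /andP[/predU1P[<-{t'} _|mt ts]]; last by apply: Pm; rewrite mt.
  have [ms'|sm] := ltP m s; last by rewrite (_ : m = s)//; apply/le_anti/andP.
  by apply: Plim Pm; rewrite rm.
have [rm'|mr] := ltP r m; last first.
  by move=> t /andP[rt ts]; apply: Pm'; rewrite ts andbT (le_trans mr).
exfalso; have [|t0 t0m Pt0] := Pleft m _ Pm'; first by rewrite rm'.
(* A time of the segment strictly between [t0] and [m], from which [P] holds up to [s]: this
   contradicts the infimum. *)
pose t := (Num.max t0 r + m) / 2.
have mx : Num.max t0 r < m by rewrite gt_max t0m.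
have t0x : t0 <= Num.max t0 r by rewrite le_max lexx.
have rx : r <= Num.max t0 r by rewrite le_max lexx orbT.
have : S t.
  split; first by rewrite /t; apply/andP; split; lra.
  move=> t' /andP[tt' t's]; have [mt'|t'm] := leP m t'.
    by apply: Pm'; rewrite mt'.
  apply: Pt0; apply/andP; split => //; last exact: ltW.
    by apply: le_trans tt'; rewrite /t; lra.
  by apply: lt_le_trans tt'; rewrite /t; lra.
move=> /(ge_inf hS.2); rewrite -/m /t; lra.
Qed.

Lemma fat_itv {R : realType} (r s : R) : r < s -> fat `[r, s].
Proof.
move=> rs; split; first exact: interval_is_interval.
move=> t; have [tr|tr] := eqVneq t r.
  by exists s; rewrite /= ?in_itv/= ?lexx ?ltW// tr gt_eqF.
by exists r; rewrite /= ?in_itv/= ?lexx ?ltW// eq_sym.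
Qed.

Lemma C1_mx {R : realType} m n (D : set R) (f : R -> 'M[R]_(m, n)) t i j : fat D ->
  (forall s, D s -> C1_at D f s) -> D t ->
  C1_at D (fun s => f s i j : R) t /\ deriv_in D (fun s => f s i j : R) t = deriv_in D f t i j.
Proof.
move=> fD C1 Dt.
apply: (C1_at_intro (f' := fun s => deriv_in D f s i j) fD Dt).
  exists 1 => //= s _ Ds; exact: ((has_deriv_mx _ _ _ _).1 (C1_has_deriv (C1 s Ds))).
have FF : Filter (within D (nbhs t)) by exact: within_filter.
by have /cvg_mxP := (C1 t Dt).2; apply.
Qed.

(** * Displacements bounded by integrals of speeds *)

Section LengthBound.
Context {R : realType}.
Local Notation mu := lebesgue_measure.

Lemma measurable_seg (r s : R) (h : R -> R) : {within `[r, s], continuous h} ->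
  measurable_fun `[r, s] (EFin \o h).
Proof.
move=> ch; apply/measurable_EFinP.
by apply: subspace_continuous_measurable_fun => //; exact: measurable_itv.
Qed.

Lemma real_displacement_le (r s : R) (y h : R -> R) : r < s ->
  (forall t, [set` `[r, s]] t -> C1_at `[r, s] y t) ->
  {within `[r, s], continuous h} ->
  (forall t, [set` `[r, s]] t -> `|deriv_in `[r, s] y t| <= h t) ->
  (`|y s - y r|%:E <= \int[mu]_(t in `[r, s]) (h t)%:E)%E.
Proof.
move=> rs C1 ch yh; have fD := fat_itv rs.
pose f : R -> R := deriv_in `[r, s] y.
have cf : {within `[r, s], continuous f}.
  by apply/within_continuousP => t Dt; exact: (C1 t Dt).2.
have cy : {within `[r, s], continuous y}.
  by apply/within_continuousP => t Dt; exact: C1_cont (C1 t Dt).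
have dy t : t \in `]r, s[ -> is_derive t 1 y (f t).
  move=> tr; apply: (@has_deriv_is_derive _ _ `[r, s]).
    apply: (@filterS _ _ _ `]r, s[); first exact: subset_itv_oo_cc.
    by apply: open_nbhs_nbhs; split => //; exact: interval_open.
  by apply/C1_has_deriv/C1; exact: subset_itv_oo_cc.
have E : (\int[mu]_(t in `[r, s]) (f t)%:E = (y s)%:E - (y r)%:E)%E.
  apply: continuous_FTC2 => //.
    have [_ ? ?] := (continuous_within_itvP _ rs).1 cy.
    by split => // t /dy [].
  by move=> t /dy [_]; rewrite derive1E.
rewrite -abse_EFin EFinB -E.
have mf := measurable_seg cf.
apply: (@le_trans _ _ (\int[mu]_(t in `[r, s]) `|(f t)%:E|)%E).
  exact: le_abse_integral.
apply: ge0_le_integral => //=.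
- apply: (@measurable_seg r s (fun t => `|f t|)).
  apply/within_continuousP => t Dt; apply: cvg_norm.
  by move/within_continuousP : cf; apply.
- exact: measurable_seg.
Qed.

(** The norm is the largest entry in absolute value, so the scalar case suffices. The integral may
    be infinite, in which case the bound is trivial. *)
Lemma displacement_le m n (r s : R) (y : R -> 'M[R]_(m, n)) (h : R -> R) : r < s ->
  (forall t, [set` `[r, s]] t -> C1_at `[r, s] y t) ->
  {within `[r, s], continuous h} ->
  (forall t, [set` `[r, s]] t -> `|deriv_in `[r, s] y t| <= h t) ->
  (`|y s - y r|%:E <= \int[mu]_(t in `[r, s]) (h t)%:E)%E.
Proof.
move=> rs C1 ch yh; have fD := fat_itv rs.
have H i j : (`|y s i j - y r i j|%:E <= \int[mu]_(t in `[r, s]) (h t)%:E)%E.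
  apply: (@real_displacement_le r s (fun t => y t i j)) => // t Dt.
    exact: (C1_mx i j fD C1 Dt).1.
  rewrite (C1_mx i j fD C1 Dt).2; apply: le_trans (yh t Dt).
  exact: mx_norm_coord.
have I0 : (0 <= \int[mu]_(t in `[r, s]) (h t)%:E)%E.
  by apply: integral_ge0 => t /yh; rewrite lee_fin; exact: le_trans.
case: (\int[mu]_(_ in _) _)%E H I0 => [I| |] H I0; rewrite ?leey//.
rewrite lee_fin; apply: mx_norm_le => // i j.
by rewrite !mxE -lee_fin.
Qed.

End LengthBound.

Section CoordinateBounds.
Context {R : realType} (M : spacetime R).
Implicit Types (c : ix M).

Lemma conn_sum c (x v : 'rV[R]_4) :
  conn c x v = \sum_i v 0 i *: conn c x (delta_mx 0 i).
Proof.
apply/matrixP => j k; rewrite summxE mxE; apply: eq_bigr => i _.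
rewrite !mxE (bigD1 i)//= big1 => [|l li]; first by rewrite !mxE !eqxx mul1r addr0.
by rewrite !mxE eqxx (negbTE li) mul0r.
Qed.

(** By linearity in [v] only the four basis vectors have to be bounded; the added 1 leaves room for
    [x] to move away from [x0]. *)
Lemma conn_bound c (x0 : 'rV[R]_4) : (phi M c @` dom M c) x0 ->
  exists2 K, 0 < K & \forall x \near x0, forall v, `|conn c x v| <= K * `|v|.
Proof.
move=> cx0; pose e i : 'rV[R]_4 := delta_mx 0 i.
exists (\sum_i (`|conn c x0 (e i)| + 1)).
  rewrite big_ord_recl; apply: ltr_pwDl; first by rewrite ltr_pwDr.
  by apply: sumr_ge0 => i _; rewrite addr_ge0.
have H : \forall x \near x0, forall i : 'I_4, `|conn c x (e i)| < `|conn c x0 (e i)| + 1.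
  have Fx : Filter (nbhs x0) by exact: nbhs_filter.
  apply: (@filter_forall _ _ _ _ Fx) => i.
  have ci : conn c x (e i) @[x --> x0] --> conn c x0 (e i).
    by apply: cvg_conn => //; exact: cvg_cst.
  by apply: (cvgr_lt _ (cvg_norm ci)); rewrite ltrDl ltr01.
apply: filterS H => x H v; rewrite conn_sum mulr_suml.
rewrite (le_trans (ler_norm_sum _ _ _))//; apply: ler_sum => i _.
by rewrite normrZ mulrC ler_pM// ?mx_norm_coord// ltW.
Qed.

(** The definitions of the two forms are solved for the velocities: [v = theta *m A] and
    [B = omega^T *m A - A *m conn c x v]. Near [z] the factors [A] and [conn] are bounded. *)
Lemma coordinate_bounds (z : tang M 4) c (N : set M) :
  dom M c (pt z) -> nbhs (pt z) N ->
  exists2 d, 0 < d & exists2 C, 0 < C & forall x (A : 'M[R]_4),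
    `|x - phi M c (pt z)| < d -> `|A - tcoord z c| < d ->
    [/\ (phi M c @` dom M c) x, N (psi M c x) & A \in unitmx ->
      forall v B,
        `|v| <= C * (`|omega c x A v B| + `|theta A v|) /\
        `|B| <= C * (`|omega c x A v B| + `|theta A v|)].
Proof.
move=> Dc nN; set x0 := phi M c (pt z); set A0 := tcoord z c.
have cx0 : (phi M c @` dom M c) x0 by exists (pt z).
have [K K0 HK] := conn_bound cx0.
have [e /= e0 He] : nbhs_ball x0 [set x | [/\ (phi M c @` dom M c) x, N (psi M c x) &
    forall v, `|conn c x v| <= K * `|v|]].
  apply/nbhs_ballP.
  by apply: filterS3 (near_codom Dc) (near_psi Dc nN) HK => x ? ? ?; split.
pose a := `|A0| + 1.
have a1 : 1 <= a by rewrite lerDr.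
(* Here [a] bounds [|A|], thanks to the 1 in [Num.min e 1], and each 4 is the dimension factor of
   [mx_norm_mulmx]. The bound on [|B|] needs [4 * a] in front of [|omega|] and [4 * a * (4 * a * K)]
   in front of [|theta|]. *)
pose C := 4 * a + 4 * a * (1 + 4 * a * K).
have C1 : 4 * a <= C by rewrite lerDl !mulr_ge0//; nra.
exists (Num.min e 1); first by rewrite lt_min e0 ltr01.
exists C; first by apply: lt_le_trans C1; nra.
move=> x A; rewrite lt_min => /andP[xe _]; rewrite lt_min => /andP[_ A1].
have [cx Nx kx] : [/\ (phi M c @` dom M c) x, N (psi M c x) &
    forall v, `|conn c x v| <= K * `|v|].
  by apply: He; rewrite -ball_normE/= distrC.
split=> // Au v B; set om := omega c x A v B; set th := theta A v.
have Aa : `|A| <= a.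
  rewrite -[A](subrK A0) (le_trans (ler_normD _ _))// addrC lerD2l.
  exact: ltW.
have vE : v = th *m A by rewrite theta_mulmx.
have BE : B = om^T *m A - A *m conn c x v.
  by rewrite /om /omega trmxK mulmxKV// /covd addrK.
have nth : 0 <= `|th| by [].
have nom : 0 <= `|om| by [].
have va : `|v| <= 4 * a * `|th|.
  rewrite vE (le_trans (mx_norm_mulmx _ _))//.
  have := ler_wpM2l nth Aa; nra.
split.
  apply: le_trans va _; apply: ler_pM => //; first by nra.
  by rewrite lerDr.
rewrite BE (le_trans (ler_normB _ _))//.
have h1 : `|om^T *m A| <= 4 * a * `|om|.
  rewrite (le_trans (mx_norm_mulmx _ _))// mx_norm_tr.
  have := ler_wpM2l nom Aa; nra.
have h2 : `|A *m conn c x v| <= 4 * a * (K * (4 * a * `|th|)).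
  rewrite (le_trans (mx_norm_mulmx _ _))//.
  apply: ler_pM => //; first by rewrite ler_wpM2l.
  by rewrite (le_trans (kx v))// ler_wpM2l// ltW.
apply: le_trans (lerD h1 h2) _; rewrite (mulrDr C); apply: lerD; first by rewrite ler_wpM2r.
rewrite -subr_ge0 (_ : _ - _ = 8 * (a * `|th|)); last by rewrite /C; ring.
by rewrite !mulr_ge0// (le_trans _ a1).
Qed.

End CoordinateBounds.

Section ShortPaths.
Context {R : realType} (M : spacetime R).
Variables (b1 : 'M[R]_4 -> 'M[R]_4 -> R) (b2 : 'rV[R]_4 -> 'rV[R]_4 -> R).
Hypotheses (ip1 : inner_product b1) (ip2 : inner_product b2).
Local Notation mu := lebesgue_measure.

(** The inequalities are not strict, so that membership can pass to the limit along a curve. *)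
Definition coord_ball (z : tang M 4) (c : ix M) (e : R) (u : tang M 4) :=
  [/\ dom M c (pt u), `|phi M c (pt u) - phi M c (pt z)| <= e &
      `|tcoord u c - tcoord z c| <= e].

Lemma path_length_ge0 (u v : OplusM M) l : path_length b1 b2 u v l -> (0 <= l)%E.
Proof.
elim=> [r s w _ _|? ? ? ? ? _ ? _ ?]; last exact: adde_ge0.
by apply: integral_ge0 => t _; rewrite lee_fin natural_speed_ge0.
Qed.

Lemma fat_sub_itv (r s t : R) : r <= t -> t < s -> `[t, s] `<=` `[r, s].
Proof. by move=> rt ts; apply: subset_itv => //; rewrite bnd_simp. Qed.

Lemma C1_at_sub (V : normedModType R) (D D' : set R) (f : R -> V) :
  fat D' -> D' `<=` D -> (forall s, D' s -> C1_at D f s) ->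
  forall s, D' s -> C1_at D' f s /\ deriv_in D' f s = deriv_in D f s.
Proof.
move=> fD' DD C1 s Ds; apply: (C1_at_intro (f' := deriv_in D f) fD' Ds).
  exists 1 => //= t _ Dt; apply: (has_deriv_sub DD).
  exact/C1_has_deriv/C1.
have [_ h] := C1 s Ds; apply: cvg_trans h; apply: cvg_app.
exact: within_sub.
Qed.

Section Arc.
Variables (z : tang M 4) (c : ix M) (d C : R).
Hypothesis dC : forall x (A : 'M[R]_4),
  `|x - phi M c (pt z)| < d -> `|A - tcoord z c| < d ->
  (phi M c @` dom M c) x /\ (A \in unitmx -> forall v B,
     `|v| <= C * (`|omega c x A v B| + `|theta A v|) /\
     `|B| <= C * (`|omega c x A v B| + `|theta A v|)).
Hypothesis C0 : 0 < C.

(** The coordinate estimates hold as long as the curve is strictly within radius [d]. The radius [e]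
    may vary with time, because in the induction the newly reached times are only known to lie in a
    larger ball. *)
Lemma coord_ball_step (r s : R) (w : R -> tang M 4) t :
  r < s -> C1_frame_curve (M := M) `[r, s] w -> r <= t < s ->
  (forall t', t <= t' <= s -> exists2 e, e < d & coord_ball z c e (w t')) ->
  (`|xpos c w s - xpos c w t|%:E <= \int[mu]_(t' in `[t, s])
     (C * (`|pomega `[r, s] w t'| + `|ptheta `[r, s] w t'|))%:E)%E /\
  (`|apos c w s - apos c w t|%:E <= \int[mu]_(t' in `[t, s])
     (C * (`|pomega `[r, s] w t'| + `|ptheta `[r, s] w t'|))%:E)%E.
Proof.
move=> rs C1w /andP[rt ts] H; have fD := fat_itv rs; have fD' := fat_itv ts.
have DD := fat_sub_itv rt ts.
have [cw FMw C1c] := C1w.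
set h := fun t' => C * (`|pomega `[r, s] w t'| + `|ptheta `[r, s] w t'|).
have Dw t' : [set` `[t, s]] t' -> dom M c (pt (w t')).
  by rewrite /= in_itv/= => /H [e _ []].
have ch : {within `[t, s], continuous h}.
  apply: (continuous_subspaceW DD); apply/within_continuousP => t' Dt'.
  apply: cvgM; first exact: cvg_cst.
  apply: cvgD; apply: cvg_norm.
    by move/within_continuousP : (pomega_continuous fD C1w); apply.
  by move/within_continuousP : (ptheta_continuous fD C1w); apply.
have C1x := C1_at_sub fD' DD (fun q Dq => (C1c c q (DD _ Dq) (Dw _ Dq)).1).
have C1a := C1_at_sub fD' DD (fun q Dq => (C1c c q (DD _ Dq) (Dw _ Dq)).2).
have bd t' : [set` `[t, s]] t' ->
    `|deriv_in `[r, s] (xpos c w) t'| <= h t' /\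
    `|deriv_in `[r, s] (apos c w) t'| <= h t'.
  move=> Dt'; have Dc := Dw _ Dt'; have D't' := DD _ Dt'.
  rewrite /h (pomega_chart fD C1w D't' Dc) (ptheta_chart fD C1w D't' Dc).
  have : t <= t' <= s by move: Dt'; rewrite /= in_itv.
  move=> /H [e ed [_ xe ae]].
  have [_] := dC (le_lt_trans xe ed) (le_lt_trans ae ed).
  by apply; exact: FMw.
split; apply: displacement_le => // t' Dt'.
- exact: (C1x t' Dt').1.
- by rewrite (C1x t' Dt').2; exact: (bd t' Dt').1.
- exact: (C1a t' Dt').1.
- by rewrite (C1a t' Dt').2; exact: (bd t' Dt').2.
Qed.

Hypothesis hM : hausdorff_space M.

(** Coordinates could converge while the point leaves the chart domain. The image under [psi] of a
    closed coordinate ball is compact, hence closed as [M] is Hausdorff, and so contains the limit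
    point; only then do the coordinates at time [t] make sense. *)
Lemma coord_ball_limit (r s e : R) (w : R -> tang M 4) t :
  e < d -> r < s -> C1_frame_curve (M := M) `[r, s] w -> r <= t < s ->
  (forall t', t < t' <= s -> coord_ball z c e (w t')) -> coord_ball z c e (w t).
Proof.
move=> ed rs [cw _ _] /andP[rt ts] H.
have wt : w q @[q --> t^'+] --> w t.
  have Dt : [set` `[r, s]] t by rewrite /= in_itv/= rt ltW.
  move/within_continuousP : cw => /(_ t Dt); apply: cvg_trans; apply: cvg_app => P.
  move=> nP; have {}nP : \forall q \near t, [set` `[r, s]] q -> P q by [].
  have Ft : Filter (nbhs t) by exact: nbhs_filter.
  have lts : \forall q \near t, q < s by exact: cvgr_lt (@cvg_id _ (nbhs t)) _ ts.
  suff : \forall q \near t, t < q -> P q by [].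
  apply: filterS2 nP lts => q nP qs tq; apply: nP.
  by rewrite /= in_itv/= (le_trans rt (ltW tq)) ltW.
have Hn : \forall q \near t^'+, coord_ball z c e (w q).
  near=> q; apply: H; apply/andP; split; first by near: q; exact: nbhs_right_gt.
  by near: q; exact: nbhs_right_ltW.
have e0 : 0 <= e.
  have [_ xs _] : coord_ball z c e (w s) by apply: H; rewrite ts lexx.
  exact: le_trans xs.
pose B := [set x : 'rV[R]_4 | `|x - phi M c (pt z)| <= e].
have Bc x : B x -> (phi M c @` dom M c) x.
  move=> Bx; have [] // := dC (le_lt_trans Bx ed) (A := tcoord z c).
  by rewrite subrr normr0 (le_lt_trans e0).
have cB : compact B.
  apply: bounded_closed_compact.
    exists (e + `|phi M c (pt z)|); split; first exact: num_real.
    move=> b eb x Bx; rewrite -[x](subrK (phi M c (pt z))).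
    rewrite /= (le_trans (ler_normD _ _))// (le_trans _ (ltW eb))//.
    by rewrite lerD2r; exact: Bx.
  rewrite (_ : B = (fun x : 'rV[R]_4 => `|x - phi M c (pt z)|) @^-1` [set y | y <= e])//.
  apply: closed_comp; last exact: closed_le.
  move=> x _; have Fx : Filter (nbhs x) by exact: nbhs_filter.
  apply: cvg_norm; apply: cvgB; first exact: cvg_id.
  exact: cvg_cst.
have cK : closed (psi M c @` B).
  apply: (compact_closed hM); apply: continuous_compact cB.
  apply/within_continuousP => x Bx; have [p Dp <-] := Bc x Bx.
  apply: cvg_trans (cvg_app _ (cvg_within _)) _; exact: psi_cont.
have pwt : pt (w q) @[q --> t^'+] --> pt (w t) by exact: cvg_comp wt (@pt_cont _ _ _ _).
have [x Bx xE] : (psi M c @` B) (pt (w t)).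
  apply: (closed_cvg _ cK _ _ pwt).
  by apply: filterS Hn => q [Dq xq _]; exists (phi M c (pt (w q))); rewrite ?phiK.
have Dt : dom M c (pt (w t)).
  by have [p Dp px] := Bc x Bx; rewrite -xE -px phiK.
split=> //.
- have xt := cvg_comp _ _ wt (phi_pt_cont Dt).
  apply: (ler_cvg_to (cvg_norm (cvgB xt (cvg_cst _))) (cvg_cst e)).
  by apply: filterS Hn => q [_ + _].
- have at_ := cvg_comp _ _ wt (tcoord_cont Dt).
  apply: (ler_cvg_to (cvg_norm (cvgB at_ (cvg_cst _))) (cvg_cst e)).
  by apply: filterS Hn => q [_ _].
Unshelve. all: by end_near. Qed.

Lemma coord_ball_near (e e' : R) (u : tang M 4) : e < e' -> coord_ball z c e u ->
  \forall v \near u, coord_ball z c e' v.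
Proof.
move=> ee [Du xu au].
have nx : \forall x \near phi M c (pt u), `|x - phi M c (pt z)| <= e'.
  have Fx : Filter (nbhs (phi M c (pt u))) by exact: nbhs_filter.
  have h : `|x - phi M c (pt z)| @[x --> phi M c (pt u)] -->
      `|phi M c (pt u) - phi M c (pt z)|.
    by apply: cvg_norm; apply: cvgB; [exact: cvg_id|exact: cvg_cst].
  by apply: filterS (cvgr_lt _ h _ (le_lt_trans xu ee)) => x /ltW.
have na : \forall A \near tcoord u c, `|A - tcoord z c| <= e'.
  have Fx : Filter (nbhs (tcoord u c)) by exact: nbhs_filter.
  have h : `|A - tcoord z c| @[A --> tcoord u c] --> `|tcoord u c - tcoord z c|.
    by apply: cvg_norm; apply: cvgB; [exact: cvg_id|exact: cvg_cst].
  by apply: filterS (cvgr_lt _ h _ (le_lt_trans au ee)) => x /ltW.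
by apply: filterS (near_tang_coord Du nx na) => v [].
Qed.

Variable K : R.
Hypothesis K0 : 0 < K.
Hypothesis hK : forall D u t, `|pomega D u t| + `|ptheta D u t| <=
  K * natural_speed b1 b2 (M := M) D u t.

(* Going backwards from [s], the curve cannot leave the ball of radius [d] as long
   as the estimate of [coord_ball_step] keeps it within the smaller radius [e]. *)
Lemma coord_ball_arc (r s e rho : R) (w : R -> tang M 4) :
  e < d -> r < s -> C1_frame_curve (M := M) `[r, s] w ->
  coord_ball z c rho (w s) ->
  (rho%:E + (C * K)%:E * \int[mu]_(t in `[r, s])
     (natural_speed b1 b2 (M := M) `[r, s] w t)%:E <= e%:E)%E ->
  forall t, r <= t <= s -> coord_ball z c e (w t).
Proof.
move=> ed rs C1w ws He; have [cw FMw C1c] := C1w.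
have fD := fat_itv rs.
set I := (\int[mu]_(t in _) _)%E in He.
have I0 : (0 <= I)%E by apply: integral_ge0 => t _; rewrite lee_fin natural_speed_ge0.
have CK0 : 0 < C * K by rewrite mulr_gt0.
have rhoe : rho <= e.
  rewrite -lee_fin; apply: le_trans He; rewrite leeDl// mule_ge0//.
  by rewrite lee_fin ltW.
have mono e1 e2 u : e1 <= e2 -> coord_ball z c e1 u -> coord_ball z c e2 u.
  by move=> e12 [? h1 h2]; split => //; [exact: le_trans h1 e12|exact: le_trans h2 e12].
have ms : measurable_fun `[r, s] (EFin \o natural_speed b1 b2 (M := M) `[r, s] w).
  by apply: measurable_seg; exact: natural_speed_continuous.
have est t : r <= t < s ->
    (\int[mu]_(t' in `[t, s]) (C * (`|pomega `[r, s] w t'| + `|ptheta `[r, s] w t'|))%:E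
      <= (C * K)%:E * I)%E.
  move=> /andP[rt ts]; have DD := fat_sub_itv rt ts.
  apply: (@le_trans _ _ (\int[mu]_(t' in `[t, s])
      ((C * K)%:E * (natural_speed b1 b2 (M := M) `[r, s] w t')%:E))%E).
    apply: ge0_le_integral => //=.
    - by move=> q _; rewrite lee_fin mulr_ge0 ?addr_ge0// ltW.
    - apply: (@measurable_seg R t s (fun q => C * (`|pomega `[r, s] w q| + `|ptheta `[r, s] w q|))).
      apply: (continuous_subspaceW DD); apply/within_continuousP => q Dq.
      apply: cvgM; first exact: cvg_cst.
      apply: cvgD; apply: cvg_norm.
        by move/within_continuousP : (pomega_continuous fD C1w); apply.
      by move/within_continuousP : (ptheta_continuous fD C1w); apply.
    - apply: (@measurable_seg R t s (fun q => C * K * natural_speed b1 b2 (M := M) `[r, s] w q)).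
      apply: (continuous_subspaceW DD); apply/within_continuousP => q Dq.
      apply: cvgM; first exact: cvg_cst.
      by move/within_continuousP : (natural_speed_continuous ip1 ip2 fD C1w); apply.
    - by move=> q _; rewrite -EFinM lee_fin -mulrA ler_wpM2l ?hK// ltW.
  rewrite ge0_integralZl_EFin//=.
  - apply: lee_wpmul2l; first by rewrite lee_fin ltW.
    apply: ge0_subset_integral => //=.
    by move=> q _; rewrite lee_fin natural_speed_ge0.
  - by move=> q _; rewrite lee_fin natural_speed_ge0.
  - exact: measurable_funS ms.
  - exact: ltW.
apply: segment_induction; first exact: ltW.
- exact: mono ws.
- move=> t /andP[rt ts] Pt.
  (* By continuity the curve stays in the ball of radius [e'] for a while before [t]. As [e' < d],
     the integral estimate applies there and improves the radius back to [e]. *)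
  pose e' := (e + d) / 2.
  have ee' : e < e' by rewrite /e'; lra.
  have e'd : e' < d by rewrite /e'; lra.
  have Dt : [set` `[r, s]] t by rewrite /= in_itv/= ts ltW.
  have Pt' : coord_ball z c e (w t) by apply: Pt; rewrite lexx.
  have : \forall q \near t, [set` `[r, s]] q -> coord_ball z c e' (w q).
    move/within_continuousP : cw => /(_ t Dt) => cwt.
    by have := cwt _ (coord_ball_near ee' Pt').
  move=> /nbhs_ballP[g /= g0 Hg].
  exists (t - g); first by rewrite ltrBlDr ltrDl.
  move=> q /andP[rq qs] /andP[gq qt].
  have [sq|sq] := leP s q.
    by rewrite (_ : q = s); [exact: mono ws|apply/le_anti/andP].
  have ball' q' : q <= q' <= s -> exists2 e1, e1 < d & coord_ball z c e1 (w q').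
    move=> /andP[qq q's]; have [tq'|q't] := leP t q'.
      by exists e => //; apply: Pt; rewrite tq'.
    exists e' => //; apply: Hg; last by rewrite /= in_itv/= (le_trans rq qq).
    by rewrite /ball/= ger0_norm ?subr_ge0 1?ltW//; lra.
  have rqs : r <= q < s by rewrite rq.
  have [hx ha] := coord_ball_step rs C1w rqs ball'.
  have eq_ : exists2 e1, e1 < d & coord_ball z c e1 (w q) by apply: ball'; rewrite lexx.
  have [e1 _ [Dq _ _]] := eq_.
  have [_ xs as_] := ws.
  have Ie n1 n2 : n1 <= rho ->
      (n2%:E <= \int[mu]_(t' in `[q, s]) (C * (`|pomega `[r, s] w t'| + `|ptheta `[r, s] w t'|))%:E)%E ->
      n1 + n2 <= e.
    move=> h1 h2; rewrite -lee_fin EFinD; apply: le_trans He.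
    by apply: leeD; [rewrite lee_fin|exact: le_trans (est q rqs)].
  split => //.
  - have := Ie _ _ xs hx; apply: le_trans.
    rewrite -(subrKA (phi M c (pt (w s)))) addrC.
    by rewrite (le_trans (ler_normD _ _))// lerD2l distrC.
  - have := Ie _ _ as_ ha; apply: le_trans.
    rewrite -(subrKA (tcoord (w s) c)) addrC.
    by rewrite (le_trans (ler_normD _ _))// lerD2l distrC.
- by move=> t rts; exact: (coord_ball_limit ed rs C1w rts).
Qed.

(** The radius is propagated backwards from [v], so for a concatenation the second piece is treated
    first and its final radius becomes the [rho] of the first piece. Hence the quantification over
    [rho] and [e]. *)
Lemma coord_ball_path (u v : OplusM M) l : path_length b1 b2 u v l ->
  forall rho e, e < d -> coord_ball z c rho (set_val v) ->
  (rho%:E + (C * K)%:E * l <= e%:E)%E -> coord_ball z c e (set_val u).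
Proof.
have CK0 : (0 <= (C * K)%:E)%E by rewrite lee_fin mulr_ge0 ?ltW.
elim=> [r s w rs C1w rho e ed ws He|u1 v1 w1 l1 l2 p1 IH1 p2 IH2 rho e ed ws He].
  apply: (coord_ball_arc ed rs C1w ws He).
  by rewrite lexx ltW.
have l10 := path_length_ge0 p1; have l20 := path_length_ge0 p2.
have e1E : ((C * K)%:E * l1 + (rho%:E + (C * K)%:E * l2) <= e%:E)%E.
  by apply: le_trans He; rewrite ge0_muleDr// addeCA [(_ * l1 + _)%E]addeC.
have m1 : (0 <= (C * K)%:E * l1)%E by exact: mule_ge0.
have m2 : (0 <= (C * K)%:E * l2)%E by exact: mule_ge0.
(* The intermediate radius must be a real number: an infinite length [l2] is excluded by the finite
   total bound. *)
have [a2 a2E] : exists a2 : R, (rho%:E + (C * K)%:E * l2 = a2%:E)%E.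
  case E2 : ((C * K)%:E * l2)%E => [a2| |]; first by exists (rho + a2).
  - by move: e1E; rewrite E2 /= addeC; case: ((C * K)%:E * l1)%E m1.
  - by move: m2; rewrite E2.
apply: (IH1 a2 e ed).
  apply: (IH2 rho a2); rewrite ?a2E//.
  apply: le_lt_trans ed; rewrite -lee_fin -a2E.
  by apply: le_trans e1E; rewrite leeDr.
by rewrite -a2E addeC.
Qed.

End Arc.

(** Convergence for a natural distance implies convergence of the projections in [M]; applied to a
    limit of the lifted curve, this produces an endpoint. *)
Lemma natural_dist_near (x : OplusM M) (N : set M) : hausdorff_space M ->
  nbhs (frame_proj x) N ->
  exists2 e, 0 < e & forall y, (natural_dist b1 b2 y x < e%:E)%E -> N (frame_proj y).
Proof.
move=> hM nN; set z := set_val x; set c := chart_at M (pt z).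
have Dz : dom M c (pt z) by exact: dom_chart_at.
have [d d0 [C C0 HC]] := coordinate_bounds Dz nN.
have [k k0 Hk] := natural_speed_lower M ip1 ip2.
pose K := 2 / k.
have K0 : 0 < K by rewrite divr_gt0.
have hK D u t : `|pomega D u t| + `|ptheta D u t| <=
    K * natural_speed b1 b2 (M := M) D u t.
  have [h1 h2] := Hk D u t.
  rewrite /K mulrAC ler_pdivlMr// mulrC mulrDr mulr2n mulrDl mul1r.
  exact: lerD.
(* A path shorter than [e] moves the coordinates by at most [C * K * e = d / 2], a radius strictly
   below [d] as required. *)
pose e := d / 2 / (C * K).
have CK0 : 0 < C * K by exact: mulr_gt0.
exists e => [|y /ereal_inf_lt[l pl le]]; first by rewrite !divr_gt0.
have : coord_ball z c (d / 2) (set_val y).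
  have dC x' A : `|x' - phi M c (pt z)| < d -> `|A - tcoord z c| < d ->
      (phi M c @` dom M c) x' /\ (A \in unitmx -> forall v B,
        `|v| <= C * (`|omega c x' A v B| + `|theta A v|) /\
        `|B| <= C * (`|omega c x' A v B| + `|theta A v|)).
    by move=> xd Ad; have [] := HC _ _ xd Ad.
  have pl' : path_length b1 b2 y x l by [].
  apply: (coord_ball_path dC C0 hM K0 hK pl' (rho := 0)).
  - by rewrite ltr_pdivrMr// mulr_natr mulr2n ltrDl.
  - by split; rewrite ?subrr ?normr0.
  - have E : ((d / 2)%:E = (C * K)%:E * e%:E)%E.
      rewrite -EFinM; congr EFin; rewrite /e [RHS]mulrC divfK//.
      by rewrite gt_eqF.
    by rewrite add0e E; apply: lee_wpmul2l; [rewrite lee_fin ltW|exact: ltW].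
move=> [Dy xy ay].
have hd : d / 2 < d by rewrite ltr_pdivrMr// mulr_natr mulr2n ltrDl.
have [_ + _] := HC _ _ (le_lt_trans xy hd) (le_lt_trans ay hd).
by rewrite phiK.
Qed.

End ShortPaths.

(** * Orthonormalisation *)

Section C1Maps.
Context {R : realType}.

(* Differentiability is expressed along curves so as to apply to the one-sided
   derivatives [deriv_in]. *)
Definition C1map_at (V W : normedModType R) (F : V -> W) (DF : V -> V -> W) x :=
  [/\ F @ x --> F x,
      forall D (y : R -> V) t h, y t = x -> has_deriv D y t h ->
        has_deriv D (fun s => F (y s)) t (DF x h) &
      forall h, DF p.1 p.2 @[p --> (x, h)] --> DF x h].

Definition C1map (V W : normedModType R) (F : V -> W) (x0 : V) :=
  exists DF, \forall x \near x0, C1map_at F DF x.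

Section Basic.
Variable V : normedModType R.

Lemma C1map_cst (W : normedModType R) (w : W) (x0 : V) : C1map (fun _ : V => w) x0.
Proof.
exists (fun _ _ => 0); apply: filterE => x; split.
- exact: cvg_cst.
- by move=> *; exact: has_deriv_cst.
- by move=> h; exact: cvg_cst.
Qed.

Lemma C1map_cont (W : normedModType R) (F : V -> W) (x0 : V) : C1map F x0 -> F @ x0 --> F x0.
Proof. by move=> [DF /nbhs_singleton[]]. Qed.

Lemma C1map_comp (W X : normedModType R) (F : V -> W) (G : W -> X) (x0 : V) :
  C1map F x0 -> C1map G (F x0) -> C1map (fun x => G (F x)) x0.
Proof.
move=> CF [DG HG]; have Fc := C1map_cont CF; have [DF HF] := CF.
exists (fun x h => DG (F x) (DF x h)).
have HG' : \forall x \near x0, C1map_at G DG (F x) := Fc _ HG.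
apply: filterS2 HF HG' => x [Fx dF cDF] [Gx dG cDG]; split.
- exact: cvg_comp Fx Gx.
- by move=> D y t h yt hy; apply: dG; [rewrite yt|exact: dF].
- move=> h; have h1 : F p.1 @[p --> (x, h)] --> F x by apply: cvg_comp Fx; exact: cvg_fst.
  exact: cvg_comp (cvg_pair h1 (cDF h)) (cDG _).
Qed.

Lemma C1map_mulmx m n p (F : V -> 'M[R]_(m, n)) (G : V -> 'M[R]_(n, p)) (x0 : V) :
  C1map F x0 -> C1map G x0 -> C1map (fun x => F x *m G x) x0.
Proof.
move=> [DF HF] [DG HG]; exists (fun x h => DF x h *m G x + F x *m DG x h).
apply: filterS2 HF HG => x [Fx dF cDF] [Gx dG cDG]; split.
- exact: cvg_mulmx.
- move=> D y t h yt hy; have := has_deriv_mulmx (dF _ _ _ _ yt hy) (dG _ _ _ _ yt hy).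
  by rewrite yt.
- move=> h; have fs : p.1 @[p --> (x, h)] --> x by exact: cvg_fst.
  have Gp : G p.1 @[p --> (x, h)] --> G x by exact: (cvg_comp _ _ fs Gx).
  have Fp : F p.1 @[p --> (x, h)] --> F x by exact: (cvg_comp _ _ fs Fx).
  by apply: cvgD; apply: cvg_mulmx => //; exact: cDF || exact: cDG.
Qed.

Lemma C1map_trmx m n (F : V -> 'M[R]_(m, n)) (x0 : V) :
  C1map F x0 -> C1map (fun x => (F x)^T) x0.
Proof.
move=> [DF HF]; exists (fun x h => (DF x h)^T); apply: filterS HF => x [Fx dF cDF].
split; [exact: cvg_trmx| |by move=> h; apply: cvg_trmx; exact: cDF].
by move=> D y t h yt hy; apply: has_deriv_trmx; exact: dF.
Qed.

Lemma C1map_mx m n (F : V -> 'M[R]_(m, n)) (x0 : V) :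
  (forall i j, C1map (fun x => F x i j : R) x0) -> C1map F x0.
Proof.
move=> H; have [DF HF] := choice (fun ij : 'I_m * 'I_n => H ij.1 ij.2).
exists (fun x h => \matrix_(i, j) DF (i, j) x h).
have Fx : Filter (nbhs x0) by exact: nbhs_filter.
apply: filterS (@filter_forall _ _ _ _ Fx HF) => x {}HF; split.
- by apply/cvg_mxP => i j; have [] := HF (i, j).
- move=> D y t h yt hy; apply/has_deriv_mx => i j; rewrite mxE.
  by have [_ + _] := HF (i, j); apply.
- move=> h; apply/cvg_mxP => i j; under eq_cvg do rewrite mxE.
  by rewrite mxE; have [_ _] := HF (i, j); apply.
Qed.

Lemma has_deriv_mul D (f g : R -> R) (t a b : R) : has_deriv D f t a -> has_deriv D g t b ->
  has_deriv D (fun s => f s * g s : R) t (a * g t + f t * b).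
Proof.
move=> hf hg.
have FF : Filter (within D t^') by exact: within_filter.
have gc : g @ within D t^' --> g t.
  exact: cvg_trans (cvg_app _ (@within_dnbhs _ D t)) (has_deriv_cont hg).
rewrite /has_deriv (_ : diff_quotient _ _ = fun s =>
    diff_quotient f t s * g s + f t * diff_quotient g t s); last first.
  apply/funext => s; rewrite /diff_quotient /GRing.scale/=; ring.
by apply: cvgD; apply: cvgM => //; exact: cvg_cst.
Qed.

Lemma C1map_mul (f g : V -> R) (x0 : V) : C1map f x0 -> C1map g x0 ->
  C1map (fun x => f x * g x : R) x0.
Proof.
move=> [DF HF] [DG HG]; exists (fun x h => DF x h * g x + f x * DG x h).
apply: filterS2 HF HG => x [Fx dF cDF] [Gx dG cDG]; split.
- exact: cvgM.
- move=> D y t h yt hy; have := has_deriv_mul (dF _ _ _ _ yt hy) (dG _ _ _ _ yt hy).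
  by rewrite yt.
- move=> h; have fs : p.1 @[p --> (x, h)] --> x by exact: cvg_fst.
  have Gp : g p.1 @[p --> (x, h)] --> g x by exact: (cvg_comp _ _ fs Gx).
  have Fp : f p.1 @[p --> (x, h)] --> f x by exact: (cvg_comp _ _ fs Fx).
  by apply: cvgD; apply: cvgM => //; exact: cDF || exact: cDG.
Qed.

Lemma C1map_real (phi phi' : R -> R) (x0 : R) :
  (\forall x \near x0, is_derive x (1 : R) phi (phi' x) /\ {for x, continuous phi'}) ->
  C1map phi x0.
Proof.
move=> H; exists (fun x h => h * phi' x); apply: filterS H => x [dp cp].
have dfp : differentiable phi x by apply/derivable1_diffP; exact: ex_derive.
split.
- exact: differentiable_continuous.
- move=> D y t h yt hy; have dy : differentiable phi (y t) by rewrite yt.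
  have := has_deriv_chain dy hy; rewrite yt diff1E//.
  by rewrite derive1E (@derive_val _ _ _ _ _ _ _ dp).
- move=> h; apply: cvgM; first exact: cvg_snd.
  by apply: (@cvg_comp _ _ _ fst phi' _ (nbhs x)); [exact: cvg_fst|exact: cp].
Qed.

Lemma C1map_inv (x0 : R) : x0 != 0 -> C1map (fun x : R => x^-1) x0.
Proof.
move=> x00; apply: (@C1map_real _ (fun x => - x ^- 2)).
have : \forall x \near x0, x != 0 by exact: (cvgr_neq0 x0 (@cvg_id _ (nbhs x0))).
apply: filterS => x xn0; split.
  have := @is_deriveV R id x 1 1; rewrite /= => h.
  by have := h xn0 (is_derive_id _ _); rewrite scaler1.
apply: cvgN; apply: cvgV; first by rewrite expf_neq0.
exact: exprn_continuous.
Qed.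

Lemma C1map_sqrt (x0 : R) : 0 < x0 -> C1map (@Num.sqrt R) x0.
Proof.
move=> x00; apply: (@C1map_real _ (fun x => (2 * Num.sqrt x)^-1)).
have : \forall x \near x0, 0 < x by exact: lt_nbhsr.
apply: filterS => x xn0; split; first exact: is_derive1_sqrt.
apply: cvgV; first by rewrite mulf_neq0// gt_eqF// sqrtr_gt0.
apply: cvgM; [exact: cvg_cst|exact: sqrt_continuous].
Qed.

End Basic.

Lemma C1map_coord m n (i : 'I_m) (j : 'I_n) (A0 : 'M[R]_(m, n)) :
  C1map (fun A : 'M[R]_(m, n) => A i j : R) A0.
Proof.
exists (fun _ (h : 'M[R]_(m, n)) => h i j : R); apply: filterE => A; split.
- exact: coord_continuous.
- by move=> D y t h yt /has_deriv_mx; apply.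
- move=> h; have sn : p.2 @[p --> (A, h)] --> h by exact: cvg_snd.
  exact: (cvg_comp _ _ sn (@coord_continuous R m n i j h)).
Qed.

Lemma C1map_id (V : normedModType R) (x0 : V) : C1map (fun x : V => x) x0.
Proof.
exists (fun _ h => h); apply: filterE => x; split => //.
by move=> h; exact: cvg_snd.
Qed.

End C1Maps.

Section Normaliser.
Context {R : realType} {n : nat}.
Variable eps : 'I_n -> R.
Hypothesis eps1 : forall i, eps i ^+ 2 = 1.

Let eta : 'M[R]_n := diag_mx (\row_i eps i).

(* If a frame has Gram matrix [G], multiplying it on the left by [gs_step k G]
   normalises its [k]-th vector and makes the other ones orthogonal to it. *)
Definition gs_step (k : 'I_n) (G : 'M[R]_n) : 'M[R]_n :=
  \matrix_(i, j) if j == k then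
      (if i == k then (Num.sqrt (eps k * G k k))^-1 else - G i k * (G k k)^-1)
    else (i == j)%:R.

(** Gram-Schmidt carried out on the Gram matrix alone: each step acts on the matrix left by the
    previous ones, and the changes of frame accumulate as a product. At [eta] the result is the
    identity, so orthonormal frames are unchanged. *)
Fixpoint gs_frame (l : seq 'I_n) (G : 'M[R]_n) : 'M[R]_n :=
  if l is k :: l' then
    gs_frame l' (gs_step k G *m G *m (gs_step k G)^T) *m gs_step k G
  else 1%:M.

Lemma etaE i j : eta i j = eps i *+ (i == j).
Proof. by rewrite /eta !mxE. Qed.

Lemma gs_stepEk k (G : 'M[R]_n) i : gs_step k G i k =
  if i == k then (Num.sqrt (eps k * G k k))^-1 else - G i k * (G k k)^-1.
Proof. by rewrite mxE eqxx. Qed.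

Lemma gs_stepE0 k (G : 'M[R]_n) i j : j != k -> gs_step k G i j = (i == j)%:R.
Proof. by move=> jk; rewrite mxE (negbTE jk). Qed.

Lemma gs_step_eta k : gs_step k eta = 1%:M.
Proof.
apply/matrixP => i j; rewrite [RHS]mxE.
have [->|jk] := eqVneq j k; last exact: gs_stepE0.
rewrite gs_stepEk !etaE eqxx mulr1n -expr2 eps1 sqrtr1 invr1.
by case: (i == k); rewrite // mulr0n oppr0 mul0r.
Qed.

Lemma gs_frame_eta l : gs_frame l eta = 1%:M.
Proof. by elim: l => //= k l ih; rewrite gs_step_eta trmx1 !mulmx1 mul1mx. Qed.

Lemma C1map_gs_step k (G : 'M[R]_n) : 0 < eps k * G k k -> C1map (gs_step k) G.
Proof.
move=> Gk; apply: C1map_mx => i j.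
rewrite (_ : (fun x => _) = fun G : 'M[R]_n => if j == k then
      (if i == k then (Num.sqrt (eps k * G k k))^-1 else - G i k * (G k k)^-1)
    else (i == j)%:R); last by apply/funext => x; rewrite mxE.
case: (j == k); last exact: C1map_cst.
have Gk0 : G k k != 0 by apply: contraTneq Gk => ->; rewrite mulr0 ltxx.
have C1k : C1map (fun G : 'M[R]_n => eps k * G k k : R) G.
  by apply: C1map_mul; [exact: C1map_cst|exact: C1map_coord].
case: (i == k).
  have C1s := C1map_comp C1k (C1map_sqrt Gk).
  by apply: (C1map_comp C1s); apply: C1map_inv; rewrite gt_eqF// sqrtr_gt0.
apply: C1map_mul; last exact: (C1map_comp (C1map_coord k k G) (C1map_inv Gk0)).
rewrite (_ : (fun x => _) = fun x : 'M[R]_n => (-1) * x i k); last first.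
  by apply/funext => x; rewrite mulN1r.
by apply: C1map_mul; [exact: C1map_cst|exact: C1map_coord].
Qed.

Lemma eps_eta k : 0 < eps k * eta k k.
Proof. by rewrite etaE eqxx mulr1n -expr2 eps1. Qed.

Lemma C1map_gs_conj k : C1map (fun G => gs_step k G *m G *m (gs_step k G)^T) eta.
Proof.
have h := C1map_gs_step (eps_eta k).
by apply: C1map_mulmx; [apply: C1map_mulmx => //; exact: C1map_id|exact: C1map_trmx].
Qed.

Lemma gs_conj_eta k : gs_step k eta *m eta *m (gs_step k eta)^T = eta.
Proof. by rewrite gs_step_eta mul1mx trmx1 mulmx1. Qed.

Lemma C1map_gs_frame l : C1map (gs_frame l) eta.
Proof.
elim: l => [|k l ih] /=; first exact: C1map_cst.
apply: C1map_mulmx; last exact: C1map_gs_step (eps_eta k).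
apply: (C1map_comp (F := fun G => gs_step k G *m G *m (gs_step k G)^T)).
  exact: C1map_gs_conj.
by rewrite gs_conj_eta.
Qed.

Lemma gs_stepM k G i j :
  (gs_step k G *m G) i j =
    if i == k then (Num.sqrt (eps k * G k k))^-1 * G k j
    else G i j - G i k * (G k k)^-1 * G k j.
Proof.
rewrite mxE (bigD1 k)//= gs_stepEk; have [->|ik] := eqVneq i k.
  rewrite big1 ?addr0// => l lk.
  by rewrite gs_stepE0// eq_sym (negbTE lk) mul0r.
rewrite (bigD1 i)//= big1 => [|l /andP[lk li]].
  by rewrite gs_stepE0// eqxx mul1r addr0 !mulNr addrC.
by rewrite gs_stepE0// eq_sym (negbTE li) mul0r.
Qed.

Lemma gs_conj_sym k G : G^T = G ->
  (gs_step k G *m G *m (gs_step k G)^T)^T = gs_step k G *m G *m (gs_step k G)^T.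
Proof. by move=> Gs; rewrite !trmx_mul trmxK Gs mulmxA. Qed.

Lemma gs_conjE k G i j : G^T = G ->
  (gs_step k G *m G *m (gs_step k G)^T) i j =
    if j == k then (Num.sqrt (eps k * G k k))^-1 * (gs_step k G *m G) i k
    else (gs_step k G *m G) i j - (gs_step k G *m G) i k * ((G k k)^-1 * G k j).
Proof.
move=> Gs; have Gsym a b : G a b = G b a by rewrite -{1}Gs mxE.
set X := gs_step k G *m G; rewrite mxE (bigD1 k)//= [_^T k j]mxE gs_stepEk.
have [->|jk] := eqVneq j k.
  rewrite big1 ?addr0; first by rewrite mulrC.
  by move=> l lk; rewrite [_^T l k]mxE gs_stepE0// eq_sym (negbTE lk) mulr0.
rewrite (bigD1 j)//= big1 => [|l /andP[lk lj]].
  rewrite [_^T j j]mxE gs_stepE0// eqxx mulr1 addr0 (Gsym j k) addrC mulNr mulrN.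
  by rewrite [G k j * _]mulrC.
by rewrite [_^T l j]mxE gs_stepE0// eq_sym (negbTE lj) mulr0.
Qed.

(** The step for [k] does not spoil the columns already done: if [j] is among them and [j != k],
    then [G k j = 0] and every correction to column [j] is a multiple of it. *)
Lemma gs_conj_col k G (K : pred 'I_n) : G^T = G -> 0 < eps k * G k k ->
  (forall i j, K j -> G i j = eta i j) ->
  forall i j, K j || (j == k) ->
    (gs_step k G *m G *m (gs_step k G)^T) i j = eta i j.
Proof.
move=> Gs Gk KG i j Kj; have Gk0 : G k k != 0.
  by apply: contraTneq Gk => ->; rewrite mulr0 ltxx.
have s2 : Num.sqrt (eps k * G k k) ^+ 2 = eps k * G k k by rewrite sqr_sqrtr// ltW.
have s0 : Num.sqrt (eps k * G k k) != 0 by rewrite gt_eqF// sqrtr_gt0.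
have ek0 : eps k != 0 by apply: contra_eq_neq (eps1 k) => ->; rewrite expr0n eq_sym oner_eq0.
have kk : (Num.sqrt (eps k * G k k))^-1 * ((Num.sqrt (eps k * G k k))^-1 * G k k) = eps k.
  rewrite mulrA -invfM -expr2 s2 invfM -mulrA mulVf// mulr1.
  by rewrite -[RHS]mul1r -[1](mulVf ek0) -mulrA -expr2 eps1 mulr1.
rewrite gs_conjE// !gs_stepM; have [jk|jk] := eqVneq j k.
  rewrite jk etaE; have [->|ik] := eqVneq i k; first by rewrite kk mulr1n.
  by rewrite mulfVK// subrr mulr0 mulr0n.
move: Kj; rewrite (negbTE jk) orbF => Kj.
rewrite (KG k j Kj) (KG i j Kj) !etaE [k == j]eq_sym (negbTE jk) mulr0n !mulr0.
have [->|ik] := eqVneq i k; last by rewrite !subr0.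
by rewrite subrr [k == j]eq_sym (negbTE jk) mulr0n.
Qed.

(** [K] marks the columns already equal to those of [eta]. One conjugation step fixes [eta] and is
    continuous there, so the neighbourhood found for the rest of the list can be pulled back along
    it. *)
Lemma gs_frameP l (K : pred 'I_n) : (forall i, K i || (i \in l)) ->
  \forall G \near eta, G^T = G -> (forall i j, K j -> G i j = eta i j) ->
    gs_frame l G *m G *m (gs_frame l G)^T = eta.
Proof.
elim: l K => [|k l ih] K Kl /=.
  apply: filterE => G _ KG; rewrite mul1mx trmx1 mulmx1; apply/matrixP => i j.
  by apply: KG; have := Kl j; rewrite in_nil orbF.
have Kl' i : (K i || (i == k)) || (i \in l) by rewrite -orbA -in_cons.
have := ih (fun i => K i || (i == k)) Kl'.
set S := fun G => gs_step k G *m G *m (gs_step k G)^T => H.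
have Sc : S @ eta --> eta by rewrite -{2}(gs_conj_eta k); exact/C1map_cont/C1map_gs_conj.
have Fe : Filter (nbhs eta) by exact: nbhs_filter.
have ke : \forall G \near eta, 0 < eps k * (G : 'M[R]_n) k k.
  have h : (eps k * (G : 'M[R]_n) k k) @[G --> eta] --> eps k * eta k k.
    by apply: cvgM; [exact: cvg_cst|exact: coord_continuous].
  exact: cvgr_gt h _ (eps_eta k).
apply: filterS2 ke (Sc _ H) => G Gk HG Gs KG.
have := HG (gs_conj_sym k Gs) (gs_conj_col Gs Gk KG).
by rewrite trmx_mul !mulmxA.
Qed.

Definition gs : 'M[R]_n -> 'M[R]_n := gs_frame (enum 'I_n).

Lemma gs_near : \forall G \near eta, G^T = G -> gs G *m G *m (gs G)^T = eta.
Proof.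
have := @gs_frameP (enum 'I_n) xpred0 (fun i => mem_enum 'I_n i).
by apply: filterS => G H Gs; exact: H.
Qed.

End Normaliser.

(** * Local paths of orthonormal frames *)

Section TangAt.
Context {R : realType} {M : manifold R} {k : nat}.

(** The components in the other charts are forced by those in [c], and the cocycle identity makes
    them compatible. *)
Lemma tang_at c p (A : 'M[R]_(k, 4)) : dom M c p ->
  exists u : tang M k, pt u = p /\ tcoord u c = A.
Proof.
move=> Dp.
pose B c' := if pselect (dom M c' p) then A *m jac c c' (phi M c p) else 0.
have Bout c' : ~ dom M c' p -> B c' = 0 by rewrite /B; case: pselect.
have BE c' : dom M c' p -> B c' = A *m jac c c' (phi M c p) by rewrite /B; case: pselect.
have Bch c1 c2 : dom M c1 p -> dom M c2 p -> B c2 = B c1 *m transition c1 c2 p.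
  move=> D1 D2; rewrite (BE _ D1) (BE _ D2) transitionE (jac_cocycle Dp D1 D2).
  exact: mulmxA.
exists (Tang Bout Bch); split; first by [].
by rewrite /tcoord (BE c Dp) (jac_id Dp) mulmx1.
Qed.

End TangAt.

Section OneChart.
Context {R : realType} (M : spacetime R).
Implicit Types (c : ix M) (D : set R).

Lemma cvg_dderiv (T : Type) (F : set_system T) {FF : Filter F} (O : set 'rV[R]_4)
    (f : 'rV[R]_4 -> R) (x v : T -> 'rV[R]_4) (x0 v0 : 'rV[R]_4) :
  smooth O f -> O x0 -> x @ F --> x0 -> v @ F --> v0 ->
  dderiv f (x s) (v s) @[s --> F] --> dderiv f x0 v0.
Proof.
move=> sf Ox xF vF; apply: cvg_sum => i _; apply: cvgM.
  by move/cvg_mxP : vF; apply.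
by have h := smooth_continuous (smooth_derive sf i) Ox; exact: (cvg_comp _ _ xF h).
Qed.

Lemma cvg_djac (T : Type) (F : set_system T) {FF : Filter F} c c'
    (x v : T -> 'rV[R]_4) (x0 v0 : 'rV[R]_4) : overlap (M := M) c c' x0 ->
  x @ F --> x0 -> v @ F --> v0 -> djac c c' (x s) (v s) @[s --> F] --> djac c c' x0 v0.
Proof.
move=> ov xF vF; apply/cvg_mxP => i j.
have E y w : djac (M := M) c c' y w i j =
  dderiv ('D_(delta_mx 0 i) (fun y => trans c c' y 0 j)) y w by exact: mxE.
have h := cvg_dderiv (jac_smooth (M := M) c c' i j) ov xF vF.
have -> : (fun s => djac c c' (x s) (v s) i j) = fun s =>
  dderiv ('D_(delta_mx 0 i) (fun y => trans c c' y 0 j)) (x s) (v s).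
  by apply/funext => s; exact: E.
by rewrite (E x0 v0); exact: h.
Qed.

(** A curve described in one chart has to be shown [C^1] in all of them; the term with [djac] comes
    from differentiating the change of chart applied to the frame. *)
Lemma C1_frame_curve_chart D (u : R -> tang M 4) c (v : R -> 'rV[R]_4) (B : R -> 'M[R]_4) :
  fat D -> (forall t, D t -> dom M c (pt (u t)) /\ tcoord (u t) c \in unitmx) ->
  (forall t, D t -> has_deriv D (xpos c u) t (v t) /\ has_deriv D (apos c u) t (B t)) ->
  (forall t, D t -> v @ within D (nbhs t) --> v t /\ B @ within D (nbhs t) --> B t) ->
  C1_frame_curve D u.
Proof.
move=> fD uD hu cvB.
have nd t : D t -> \forall s \near t, D s -> dom M c (pt (u s)).
  by move=> Dt; exists 1 => //= s _ /uD[].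
split.
- apply/within_continuousP => t Dt; apply: cvg_tang => c' Dc'.
  have [Dc _] := uD t Dt; have [hx ha] := hu t Dt; split.
  + rewrite near_withinE.
    by apply: filterS (curve_near_overlap Dc (nd t Dt) hx Dc') => s H /H[].
  + exact: has_deriv_cont (xpos_change Dc (nd t Dt) hx Dc').
  + exact: has_deriv_cont (apos_change Dt Dc (nd t Dt) hx ha Dc').
- by move=> t /uD[Dc Au]; exact: FMI Dc Au.
- move=> c' t Dt Dc'; have [Dc _] := uD t Dt; have [hx ha] := hu t Dt.
  have FF : Filter (within D (nbhs t)) by exact: within_filter.
  have nb := curve_near_overlap Dc (nd t Dt) hx Dc'.
  have ov : overlap (M := M) c c' (xpos c u t) by exists (pt (u t)).
  have [cv cB] := cvB t Dt.
  have cx := has_deriv_cont hx; have ca := has_deriv_cont ha.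
  have cj := has_deriv_cont (has_deriv_jac Dt ov hx).
  split.
    have [] // := C1_at_intro (f := xpos c' u) (f' := fun s => v s *m jac c c' (xpos c u s)) fD Dt.
      apply: filterS nb => s H Ds; have [Ds1 Ds2] := H Ds.
      exact: (xpos_change Ds1 (nd s Ds) (hu s Ds).1 Ds2).
    exact: cvg_mulmx.
  have [] // := C1_at_intro (f := apos c' u) (f' := fun s =>
      B s *m jac c c' (xpos c u s) + apos c u s *m djac c c' (xpos c u s) (v s)) fD Dt.
    apply: filterS nb => s H Ds; have [Ds1 Ds2] := H Ds.
    exact: (apos_change Ds Ds1 (nd s Ds) (hu s Ds).1 (hu s Ds).2 Ds2).
  apply: cvgD; apply: cvg_mulmx => //.
  exact: cvg_djac.
Qed.

Lemma C1_frame_curve_eq D (u w : R -> tang M 4) : fat D -> (forall t, D t -> u t = w t) ->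
  C1_frame_curve D u -> C1_frame_curve D w.
Proof.
move=> fD uw [cu FMu C1u].
have near_eq (V : normedModType R) (f : tang M 4 -> V) (t : R) :
    \forall s \near t, D s -> f (u s) = f (w s).
  by exists 1 => //= s _ /uw ->.
split.
- apply/within_continuousP => t Dt; rewrite -(uw t Dt).
  have : u @ within D (nbhs t) --> u t by move/within_continuousP : cu; apply.
  apply: cvg_trans; apply: near_eq_cvg; rewrite near_withinE.
  by exists 1 => //= s _ /uw ->.
- by move=> t Dt; rewrite -uw//; exact: FMu.
- move=> c t Dt; rewrite -uw// => Dc.
  have nC : \forall s \near t, D s -> dom M c (pt (u s)) := curve_near_dom cu Dt Dc.
  split.
    apply: (C1_at_near (f := xpos c u) fD Dt (near_eq _ (fun z => phi M c (pt z)) t)).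
    by apply: filterS nC => s H Ds; exact: (C1u c s Ds (H Ds)).1.
  apply: (C1_at_near (f := apos c u) fD Dt (near_eq _ (fun z => tcoord z c) t)).
  by apply: filterS nC => s H Ds; exact: (C1u c s Ds (H Ds)).2.
Qed.

Lemma natural_speed_eq b1 b2 D (u w : R -> tang M 4) t : (forall t, D t -> u t = w t) ->
  D t -> natural_speed b1 b2 (M := M) D u t = natural_speed b1 b2 (M := M) D w t.
Proof.
move=> uw Dt.
have dE (V : normedModType R) (f : tang M 4 -> V) :
    deriv_in D (fun s => f (u s)) t = deriv_in D (fun s => f (w s)) t.
  apply: deriv_in_near; first by rewrite uw.
  by exists 1 => //= s _ /uw ->.
rewrite /natural_speed /frame_omega /frame_theta /xvel uw// /xpos /apos.
by rewrite (dE _ (fun z => phi M _ (pt z))) (dE _ (fun z => tcoord z _)) uw.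
Qed.

(** [path_arc] requires a function on all of [R] with values in [O^+M]. Values of [u] outside
    [[r, s]] are replaced by arbitrary elements, which affects neither the relative derivatives nor
    the speed. *)
Lemma path_length_curve b1 b2 (r s : R) (u : R -> tang M 4) (x y : OplusM M) : r < s ->
  C1_frame_curve `[r, s] u -> (forall t, [set` `[r, s]] t -> OplusM M (u t)) ->
  set_val x = u r -> set_val y = u s ->
  path_length b1 b2 x y
    (\int[lebesgue_measure]_(t in `[r, s]) (natural_speed b1 b2 (M := M) `[r, s] u t)%:E)%E.
Proof.
move=> rs C1u Ou xr ys.
have wP t : exists w : OplusM M, [set` `[r, s]] t -> set_val w = u t.
  have [Dt|Dt] := pselect ([set` `[r, s]] t); last by exists x.
  by exists (SigSub (mem_set (Ou t Dt))).
have [w wE] := choice wP.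
have uw t : [set` `[r, s]] t -> u t = set_val (w t) by move=> /wE.
have fD := fat_itv rs.
have := path_arc b1 b2 rs (C1_frame_curve_eq fD uw C1u).
have Dr : [set` `[r, s]] r by rewrite /= in_itv/= lexx ltW.
have Ds : [set` `[r, s]] s by rewrite /= in_itv/= lexx ltW.
have -> : w r = x by apply: val_inj; rewrite [LHS](wE _ Dr) -xr.
have -> : w s = y by apply: val_inj; rewrite [LHS](wE _ Ds) -ys.
congr path_length; apply: eq_integral => t; rewrite inE => Dt.
by congr EFin; rewrite -(natural_speed_eq b1 b2 uw Dt).
Qed.

End OneChart.

(** Both [F] and its complement in [S] are open, so [F] cuts out of [A] a non-empty, relatively open
    and closed part. *)
Lemma connected_orientation (T : topologicalType) (A S F : set T) :
  connected A -> A `<=` S -> F `<=` S -> open F -> open (S `\` F) -> A `&` F !=set0 ->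
  A `<=` F.
Proof.
move=> cA AS FS oF oSF AF.
have <- : A `&` F = A.
  apply: cA => //; first by exists F.
  exists (~` (S `\` F)); first exact: open_closedC.
  apply/seteqP; split=> x [Ax Fx]; split=> //; first by move=> [].
  by apply: contrapT => nF; apply: Fx; split => //; exact: AS.
by move=> x [].
Qed.

Section Orientation.
Context {R : realType} (M : spacetime R).

Lemma gram_chart (k : nat) (u : tang M k) c : dom M c (pt u) ->
  gram (metric M) u = tcoord u c *m gmx (metric M) c (pt u) *m (tcoord u c)^T.
Proof.
move=> Dc; rewrite /gram; set c0 := chart_at M _.
have D0 : dom M c0 (pt u) by exact: dom_chart_at.
by rewrite (tcoord_change D0 Dc) (gmx_change (metric M) D0 Dc) trmx_mul !mulmxA.
Qed.

Lemma gram_tmul (k l : nat) (B : 'M[R]_(l, k)) (u : tang M k) :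
  gram (metric M) (tmul B u) = B *m gram (metric M) u *m B^T.
Proof. by rewrite /gram /= trmx_mul !mulmxA. Qed.

Lemma minkowski_row_max :
  row ord_max 1%:M *m Defs.minkowski R *m (row ord_max 1%:M)^T = - 1%:M :> 'M[R]_1.
Proof.
rewrite rowE mulmx1 -rowE trmx_delta -colE; apply/matrixP => i j.
by rewrite !ord1 !mxE !eqxx mulr1n.
Qed.

Lemma minkowski_rowsub :
  rowsub (lift ord_max) 1%:M *m Defs.minkowski R *m (rowsub (lift ord_max) 1%:M)^T =
  1%:M :> 'M[R]_3.
Proof.
rewrite mul_rowsub_mx mul1mx trmx_mxsub trmx1 mulmx_colsub mulmx1.
apply/matrixP => i j; rewrite !mxE (inj_eq lift_inj) eq_sym (negbTE (neq_lift _ _)).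
by case: eqVneq.
Qed.

Lemma OM_timelike u : OM M u -> timelike (metric M) (tmul (row ord_max 1%:M) u).
Proof.
move=> OMu; rewrite /timelike /= gram_tmul OMu minkowski_row_max !mxE eqxx.
by rewrite oppr_lt0 ltr01.
Qed.

Lemma OM_spacelike u : OM M u ->
  spacelike_triad (metric M) (tmul (rowsub (lift ord_max) 1%:M) u).
Proof.
move=> OMu x x0; rewrite gram_tmul OMu minkowski_rowsub mulmx1 mxE.
rewrite (_ : \sum_i _ = \sum_i x 0 i ^+ 2); last first.
  by apply: eq_bigr => i _; rewrite mxE expr2.
rewrite lt_def sumr_ge0 ?andbT => [|i _]; last exact: sqr_ge0.
apply: contra_neq x0 => /psumr_eq0P H; apply/rowP => i; rewrite mxE.
by apply/eqP; rewrite -sqrf_eq0 H// => j _; exact: sqr_ge0.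
Qed.

(** Along a curve of orthonormal frames the orientations thus need to be known at one time only. *)
Lemma OplusM_connected (A : set (tang M 4)) :
  connected A -> A `<=` OM M -> A `&` OplusM M !=set0 -> A `<=` OplusM M.
Proof.
move=> cA AO [u [Au [_ fu ru]]].
have cim l (B : 'M[R]_(l, 4)) : connected (tmul B @` A).
  apply: connected_continuous_connected cA _.
  exact/continuous_subspaceT/tmul_continuous.
have [Ft Fo Ft' _] := future_orientation M.
have [Rt Ro Rt' _] := right_handed_orientation M.
have tf : tmul (row ord_max 1%:M) @` A `<=` future (s := M).
  apply: (connected_orientation (cim _ _) _ Ft Fo Ft').
    by move=> _ [v Av <-]; exact/OM_timelike/AO.
  by exists (tmul (row ord_max 1%:M) u); split => //; exists u.
have tr : tmul (rowsub (lift ord_max) 1%:M) @` A `<=` right_handed (s := M).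
  apply: (connected_orientation (cim _ _) _ Rt Ro Rt').
    by move=> _ [v Av <-]; exact/OM_spacelike/AO.
  by exists (tmul (rowsub (lift ord_max) 1%:M) u); split => //; exists u.
by move=> v Av; split; [exact: AO|apply: tf; exists v|apply: tr; exists v].
Qed.

End Orientation.

Lemma near_segment {R : realType} (V : normedModType R) (a x1 h : V) (t d : R) :
  `|x1 - a| < d -> `|h + x1 - a| < d -> 0 <= t <= 1 ->
  `|a - (t *: h + x1)| < 4 * d /\ `|0 - h| < 4 * d.
Proof.
move=> h1 h2 /andP[t0 t1]; have hd : `|h| < d + d.
  rewrite -[h](addrK (x1 - a)) addrA (le_lt_trans (ler_normB _ _))//; exact: ltrD.
have d0 : 0 < d by exact: le_lt_trans h1.
split; last by rewrite sub0r normrN; lra.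
rewrite distrC -addrA (le_lt_trans (ler_normD _ _))// normrZ ger0_norm//.
have : t * `|h| <= `|h| by rewrite ler_piMl.
lra.
Qed.

(** * Orthonormalised coordinate segments *)

Section LocalPaths.
Context {R : realType} (M : spacetime R).
Implicit Types (c : ix M).

Lemma C1map_fst (V W : normedModType R) (x0 : V * W) : C1map (fun x : V * W => x.1) x0.
Proof.
exists (fun _ h => h.1); apply: filterE => x; split.
- exact: cvg_fst.
- move=> D y t h yt hy.
  have fh : fst @ nbhs h --> h.1 by exact: cvg_fst.
  exact: (cvg_comp _ _ hy fh).
- move=> h; have sn : p.2 @[p --> (x, h)] --> h by exact: cvg_snd.
  by apply: (cvg_comp _ _ sn); exact: cvg_fst.
Qed.

Lemma C1map_snd (V W : normedModType R) (x0 : V * W) : C1map (fun x : V * W => x.2) x0.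
Proof.
exists (fun _ h => h.2); apply: filterE => x; split.
- exact: cvg_snd.
- move=> D y t h yt hy.
  have fh : snd @ nbhs h --> h.2 by exact: cvg_snd.
  exact: (cvg_comp _ _ hy fh).
- move=> h; have sn : p.2 @[p --> (x, h)] --> h by exact: cvg_snd.
  by apply: (cvg_comp _ _ sn); exact: cvg_snd.
Qed.

Lemma C1map_at0 (V W : normedModType R) (F : V -> W) DF x : C1map_at F DF x -> DF x 0 = 0.
Proof.
move=> [_ dF _]; apply: (has_deriv_unique (D := setT) (f := fun _ : R => F x) (t := 0)).
- exact: fat_setT.
- by [].
- by apply: (dF _ (fun=> x)); last exact: has_deriv_cst.
- exact: has_deriv_cst.
Qed.

Lemma C1map_gmat c x0 : (phi M c @` dom M c) x0 -> C1map (gmat c) x0.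
Proof.
move=> cx0; exists (dgmat c).
have : nbhs x0 (phi M c @` dom M c) by apply: open_nbhs_nbhs; split => //; exact: codom_open.
apply: filterS => x cx; have Fx : Filter (nbhs x) by exact: nbhs_filter.
split.
- apply/cvg_mxP => i j; exact: (smooth_continuous (gcomp_smooth (M := M) c i j) cx).
- by move=> D y t h yt hy; rewrite -yt; apply: has_deriv_gmat; rewrite // yt.
- move=> h; have fs : p.1 @[p --> (x, h)] --> x by exact: cvg_fst.
  have sn : p.2 @[p --> (x, h)] --> h by exact: cvg_snd.
  apply/cvg_mxP => i j.
  have E y w : dgmat (M := M) c y w i j = dderiv (gcomp (M := M) c i j) y w by exact: mxE.
  have -> : (fun p : 'rV[R]_4 * 'rV[R]_4 => dgmat c p.1 p.2 i j) = fun p =>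
     dderiv (gcomp (M := M) c i j) p.1 p.2 by apply/funext => p; exact: E.
  rewrite (E x h).
  exact: (cvg_dderiv (gcomp_smooth (M := M) c i j) cx fs sn).
Qed.

Definition signature4 (i : 'I_4) : R := if i == ord_max then -1 else 1.

Lemma signature4_sqr i : signature4 i ^+ 2 = 1.
Proof. by rewrite /signature4; case: ifP; rewrite ?sqrrN expr1n. Qed.

(* [y] consists of the coordinates of a point and of a frame at this point. *)
Definition orthonormalised c (y : 'rV[R]_4 * 'M[R]_4) : 'M[R]_4 :=
  gs signature4 (y.2 *m gmat c y.1 *m y.2^T) *m y.2.

Lemma orthonormalised_id c y : y.2 *m gmat c y.1 *m y.2^T = Defs.minkowski R ->
  orthonormalised c y = y.2.
Proof.
by move=> E; rewrite /orthonormalised E /gs (gs_frame_eta signature4_sqr) mul1mx.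
Qed.

(** [p.1] is a position in the bundle chart and [p.2] a coordinate velocity. The velocity of the
    orthonormalised frame is [DF p.1 p.2], so the last two bounds concern the corrected path and not
    the straight one. *)
Definition slow_step c DF (p : ('rV[R]_4 * 'M[R]_4) * ('rV[R]_4 * 'M[R]_4)) :=
  [/\ (phi M c @` dom M c) p.1.1, C1map_at (orthonormalised c) DF p.1,
     orthonormalised c p.1 *m gmat c p.1.1 *m (orthonormalised c p.1)^T = Defs.minkowski R,
     `|omega c p.1.1 (orthonormalised c p.1) p.2.1 (DF p.1 p.2)| <= 1 &
     `|theta (orthonormalised c p.1) p.2.1| <= 1].

Lemma minkowski_unit (A G : 'M[R]_4) : A *m G *m A^T = Defs.minkowski R -> A \in unitmx.
Proof.
move=> E; have : A *m G *m A^T \in unitmx.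
  rewrite E unitmxE det_diag unitfE; apply/prodf_neq0 => i _.
  by rewrite mxE; case: ifP; rewrite ?oppr_eq0 oner_neq0.
by rewrite !unitmx_mul => /andP[/andP[]].
Qed.

Lemma omega0 c x (A : 'M[R]_4) : omega c x A 0 0 = 0.
Proof.
have c0 : conn c x 0 = 0.
  by apply/matrixP => i j; rewrite !mxE big1// => k _; rewrite mxE mul0r.
by rewrite /omega /covd c0 mulmx0 addr0 mul0mx trmx0.
Qed.

(* Both bounds hold near a zero velocity, where [omega] and [theta] vanish. *)
Lemma slow_step_near c (z : tang M 4) : OM M z -> dom M c (pt z) ->
  exists DF, nbhs ((phi M c (pt z), tcoord z c), 0 : 'rV[R]_4 * 'M[R]_4) (slow_step c DF).
Proof.
move=> Oz Dz; set y0 := (phi M c (pt z), tcoord z c).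
have cy0 : (phi M c @` dom M c) y0.1 by exists (pt z).
have Gy0 : y0.2 *m gmat c y0.1 *m y0.2^T = Defs.minkowski R.
  by rewrite gmat_phi//= -gram_chart.
have CG : C1map (fun y : 'rV[R]_4 * 'M[R]_4 => y.2 *m gmat c y.1 *m y.2^T) y0.
  apply: C1map_mulmx; last exact/C1map_trmx/C1map_snd.
  apply: C1map_mulmx; first exact: C1map_snd.
  exact: (C1map_comp (C1map_fst y0) (C1map_gmat cy0)).
have CF : C1map (orthonormalised c) y0.
  apply: C1map_mulmx; last exact: C1map_snd.
  apply: (C1map_comp CG); rewrite Gy0.
  exact: (C1map_gs_frame signature4_sqr).
have Fy := orthonormalised_id Gy0.
have Fc := C1map_cont CF.
have [DF HF] := CF; exists DF.
have Gc := C1map_cont CG; rewrite Gy0 in Gc.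
have g0 : \forall y \near y0, gs signature4 (y.2 *m gmat c y.1 *m y.2^T) *m
    (y.2 *m gmat c y.1 *m y.2^T) *m (gs signature4 (y.2 *m gmat c y.1 *m y.2^T))^T =
    Defs.minkowski R.
  have sy : \forall y \near y0, (phi M c @` dom M c) y.1.
    have fs : fst @ y0 --> y0.1 by exact: cvg_fst.
    by apply: fs; apply: open_nbhs_nbhs; split; [exact: codom_open|].
  apply: filterS2 sy (Gc _ (gs_near signature4_sqr)) => y cy; apply.
  rewrite !trmx_mul trmxK mulmxA; congr (_ *m _ *m _).
  exact: (gmx_sym (metric M) (codom_dom cy)).
have fst0 : fst @ nbhs (y0, 0 : 'rV[R]_4 * 'M[R]_4) --> y0 by exact: cvg_fst.
have snd0 : snd @ nbhs (y0, 0 : 'rV[R]_4 * 'M[R]_4) --> (0 : 'rV[R]_4 * 'M[R]_4).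
  exact: cvg_snd.
have x0 : p.1.1 @[p --> (y0, 0 : 'rV[R]_4 * 'M[R]_4)] --> y0.1.
  by apply: (cvg_comp _ _ fst0); exact: cvg_fst.
have v0 : p.2.1 @[p --> (y0, 0 : 'rV[R]_4 * 'M[R]_4)] --> (0 : 'rV[R]_4).
  by apply: (cvg_comp _ _ snd0); exact: cvg_fst.
have a0 : orthonormalised c p.1 @[p --> (y0, 0 : 'rV[R]_4 * 'M[R]_4)] --> y0.2.
  by rewrite -Fy; exact: (cvg_comp _ _ fst0 Fc).
have Cy0 := nbhs_singleton HF.
have d0 : DF p.1 p.2 @[p --> (y0, 0 : 'rV[R]_4 * 'M[R]_4)] --> (0 : 'M[R]_4).
  by have [_ _ /(_ 0)] := Cy0; rewrite (C1map_at0 Cy0).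
have uy0 : y0.2 \in unitmx by exact: minkowski_unit Gy0.
have F0 : Filter (nbhs (y0, 0 : 'rV[R]_4 * 'M[R]_4)) by exact: nbhs_filter.
have near1 (f : _ -> 'M[R]_4) : f p @[p --> (y0, 0 : 'rV[R]_4 * 'M[R]_4)] --> (0 : 'M[R]_4) ->
  \forall p \near (y0, 0 : 'rV[R]_4 * 'M[R]_4), `|f p| <= 1.
  move=> f0; have : `|f p| @[p --> (y0, 0 : 'rV[R]_4 * 'M[R]_4)] --> `|0 : 'M[R]_4|.
    exact: cvg_norm.
  rewrite normr0 => h; apply: filterS (cvgr_lt _ h _ ltr01) => p; exact: ltW.
have om : \forall p \near (y0, 0 : 'rV[R]_4 * 'M[R]_4),
    `|omega c p.1.1 (orthonormalised c p.1) p.2.1 (DF p.1 p.2)| <= 1.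
  apply: near1; have := cvg_omega cy0 uy0 x0 a0 v0 d0.
  by rewrite omega0 => /(_ F0).
have th : \forall p \near (y0, 0 : 'rV[R]_4 * 'M[R]_4),
    `|theta (orthonormalised c p.1) p.2.1| <= 1.
  have := cvg_theta uy0 a0 v0; rewrite {2}/theta mul0mx => /(_ F0) h.
  have : `|theta (orthonormalised c p.1) p.2.1| @[p --> (y0, 0 : 'rV[R]_4 * 'M[R]_4)]
    --> `|0 : 'rV[R]_4| by exact: cvg_norm.
  by rewrite normr0 => h1; apply: filterS (cvgr_lt _ h1 _ ltr01) => p; exact: ltW.
have cn : \forall p \near (y0, 0 : 'rV[R]_4 * 'M[R]_4), (phi M c @` dom M c) p.1.1.
  by apply: x0; apply: open_nbhs_nbhs; split; [exact: codom_open|].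
have Fy0 : Filter (nbhs y0) by exact: nbhs_filter.
have H1 := fst0 _ (@filterI _ _ Fy0 _ _ HF g0).
apply: (@filterS2 _ _ F0 _ _ _ _ (@filterI _ _ F0 _ _ H1 cn) (@filterI _ _ F0 _ _ om th)).
move=> p [[h1 h2] h3] [h4 h5]; split => //.
by rewrite -[RHS]h2 /orthonormalised trmx_mul !mulmxA.
Qed.

Lemma tang_ext_chart (k : nat) (u v : tang M k) c : dom M c (pt u) -> pt u = pt v ->
  tcoord u c = tcoord v c -> u = v.
Proof.
move=> Dc uv E; apply: tang_ext => // c' Dc'; have Dv : dom M c (pt v) by rewrite -uv.
by rewrite (tcoord_jac Dc Dc') (tcoord_jac (u := v) Dv) -?uv// E.
Qed.

(** The path has base coordinates on a straight segment and frames orthonormalised at each time. Its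
    end [u2] is produced before [b1] and [b2], so the same path bounds all natural distances. *)
Lemma orthonormal_arc c DF (y1 h : 'rV[R]_4 * 'M[R]_4) (u1 : OplusM M) :
  (forall t, 0 <= t <= 1 -> slow_step c DF (t *: h + y1, h)) ->
  pt (set_val u1) = psi M c y1.1 -> tcoord (set_val u1) c = orthonormalised c y1 ->
  exists u2 : OplusM M, [/\ pt (set_val u2) = psi M c (h + y1).1,
    tcoord (set_val u2) c = orthonormalised c (h + y1) &
    forall b1 b2, inner_product b1 -> inner_product b2 -> forall K, 0 < K ->
    (forall D u t, natural_speed b1 b2 (M := M) D u t <=
       K * (`|pomega D u t| + `|ptheta D u t|)) ->
    (natural_dist b1 b2 u1 u2 <= (K * 2)%:E)%E].
Proof.
move=> H p1 t1; pose D : set R := `[0, 1]%classic.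
have DE t : D t = (0 <= t <= 1) :> Prop by rewrite /D/= in_itv.
have fD : fat D by exact: fat_itv.
have uP t : exists u : tang M 4, D t -> pt u = psi M c (t *: h + y1).1 /\
    tcoord u c = orthonormalised c (t *: h + y1).
  have [Dt|Dt] := pselect (D t); last by exists (set_val u1).
  have [cy _ _ _ _] : slow_step c DF (t *: h + y1, h) by apply: H; rewrite -DE.
  have [u Hu] := tang_at (orthonormalised c (t *: h + y1)) (codom_dom cy).
  by exists u.
have [u uE] := choice uP.
have uD t : D t -> dom M c (pt (u t)).
  move=> Dt; have [cy _ _ _ _] : slow_step c DF (t *: h + y1, h) by apply: H; rewrite -DE.
  by have [-> _] := uE t Dt; exact: codom_dom.
have xE t : D t -> xpos c u t = (t *: h + y1).1.
  move=> Dt; have [[p Dp px] _ _ _ _] : slow_step c DF (t *: h + y1, h) by apply: H; rewrite -DE.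
  by have [+ _] := uE t Dt; rewrite /xpos => ->; rewrite -px phiK.
have aE t : D t -> apos c u t = orthonormalised c (t *: h + y1).
  by move=> Dt; have [] := uE t Dt.
have Ou t : D t -> OM M (u t).
  move=> Dt; have [_ _ G _ _] : slow_step c DF (t *: h + y1, h) by apply: H; rewrite -DE.
  rewrite /OM /= (gram_chart (uD t Dt)) -[RHS]G -aE// /apos; congr (_ *m _ *m _).
  by rewrite /gmat -xE// /xpos phiK//; exact: uD.
have hu t : D t -> has_deriv D (xpos c u) t h.1 /\ has_deriv D (apos c u) t (DF (t *: h + y1) h).
  move=> Dt; have [_ [_ dF _] _ _ _] : slow_step c DF (t *: h + y1, h) by apply: H; rewrite -DE.
  have ha : has_deriv D (fun s : R => s *: h + y1) t h by exact: has_deriv_affine.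
  split.
    apply: (has_deriv_near (f := fun s => (s *: h + y1).1)); first by rewrite xE.
      by exists 1 => //= s _ Ds; rewrite xE.
    exact: has_deriv_affine.
  apply: (has_deriv_near (f := fun s => orthonormalised c (s *: h + y1))).
  - by rewrite aE.
  - by exists 1 => //= s _ Ds; rewrite aE.
  - exact: dF.
have C1u : C1_frame_curve D u.
  apply: (C1_frame_curve_chart fD (c := c) _ hu) => t Dt.
    split; first exact: uD.
    have [_ _ G _ _] : slow_step c DF (t *: h + y1, h) by apply: H; rewrite -DE.
    by have [_ ->] := uE t Dt; exact: minkowski_unit G.
  have [_ [_ _ cF] _ _ _] : slow_step c DF (t *: h + y1, h) by apply: H; rewrite -DE.
  have FF : Filter (within D (nbhs t)) by exact: within_filter.
  split; first exact: cvg_cst.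
  have ch : (s *: h + y1) @[s --> within D (nbhs t)] --> t *: h + y1.
    by have := has_deriv_cont (@has_deriv_affine R _ D h y1 t).
  have h1 : (s *: h + y1, h) @[s --> within D (nbhs t)] --> (t *: h + y1, h).
    exact: (cvg_pair ch (cvg_cst h)).
  exact: (cvg_comp _ _ h1 (cF h)).
have D0 : D 0 by rewrite DE lexx ler01.
have D1 : D 1 by rewrite DE lexx ler01.
have u0E : set_val u1 = u 0.
  have [e1 e2] := uE 0 D0; apply: (tang_ext_chart (c := c)).
  - by rewrite p1; move: (uD 0 D0); rewrite e1 scale0r add0r.
  - by rewrite p1 e1 scale0r add0r.
  - by rewrite t1 e2 scale0r add0r.
have OPu t : D t -> OplusM M (u t).
  move=> Dt; apply: (@OplusM_connected _ _ (u @` D)).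
  - apply: connected_continuous_connected; last by have [] := C1u.
    by apply/connected_intervalP; exact: fD.1.
  - by move=> _ [s Ds <-]; exact: Ou.
  - exists (u 0); split; first by exists 0.
    by rewrite -u0E; apply: set_mem; exact: valP.
  - by exists t.
pose u2 : OplusM M := SigSub (mem_set (OPu 1 D1)).
have [e1 e2] := uE 1 D1; exists u2; split.
- by rewrite [set_val u2]/= e1 scale1r.
- by rewrite [set_val u2]/= e2 scale1r.
move=> b1 b2 ip1 ip2 K K0 HK.
apply: (@le_trans _ _ (\int[lebesgue_measure]_(t in D) (natural_speed b1 b2 (M := M) D u t)%:E)%E).
  apply: ereal_inf_lbound.
  exact: (path_length_curve (y := u2) b1 b2 ltr01 C1u OPu u0E (erefl (u 1))).
(* The path lasts one unit of time, with [omega] and [theta] of norm at most 1 each: whence the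
   factor 2. *)
apply: (@le_trans _ _ (\int[lebesgue_measure]_(t in D) (K * 2)%:E)%E); last first.
  rewrite /D integral_cst//= lebesgue_measure_itv /= lte_fin ltr01.
  by rewrite oppr0 adde0 mule1.
apply: ge0_le_integral => //=.
- exact: measurable_itv.
- by move=> t _; rewrite lee_fin natural_speed_ge0.
- by apply: measurable_seg; exact: natural_speed_continuous.
- move=> t Dt; rewrite lee_fin; apply: le_trans (HK D u t) _.
  apply: ler_wpM2l; first exact: ltW.
  have [_ _ _ Hw Ht] : slow_step c DF (t *: h + y1, h) by apply: H; rewrite -DE.
  rewrite (pomega_chart fD C1u Dt (uD t Dt)) (ptheta_chart fD C1u Dt (uD t Dt)).
  have [hx ha] := hu t Dt.
  rewrite (has_deriv_lim fD Dt hx) (has_deriv_lim fD Dt ha) xE// aE//.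
  by rewrite -[leRHS]/(1 + 1 : R); apply: lerD.
Qed.

(** There are two radii because the base radius has to be adapted to the fibre radius: over each
    point of the base ball some orthonormal frame must lie within [e], if the box is to project onto
    the whole ball. *)
Definition frame_box (z : tang M 4) c (r e : R) : set (tang M 4) :=
  [set v | [/\ dom M c (pt v), `|phi M c (pt v) - phi M c (pt z)| < r &
               `|tcoord v c - tcoord z c| < e]].

Lemma frame_box_small c (z : tang M 4) (N : set M) :
  OplusM M z -> dom M c (pt z) -> nbhs (pt z) N ->
  exists r e, [/\ 0 < r, 0 < e,
   forall x, `|x - phi M c (pt z)| < r -> [/\ (phi M c @` dom M c) x, N (psi M c x) &
     exists2 v : OplusM M, frame_proj v = psi M c x & `|tcoord (set_val v) c - tcoord z c| < e] &
   forall u v : OplusM M, frame_box z c r e (set_val u) -> frame_box z c r e (set_val v) ->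
    forall b1 b2, inner_product b1 -> inner_product b2 -> forall K, 0 < K ->
    (forall D u t, natural_speed b1 b2 (M := M) D u t <=
       K * (`|pomega D u t| + `|ptheta D u t|)) ->
    (natural_dist b1 b2 u v <= (K * 2)%:E)%E].
Proof.
move=> Oz Dz nN; have [Oz' _ _] := Oz.
have [DF /nbhs_ballP[e /= e0 He]] := slow_step_near Oz' Dz.
set x0 := phi M c (pt z) in He *; set A0 := tcoord z c in He *.
(* If both ends are within [d] of the centre, the step is shorter than [2 * d] and the segment stays
   within [3 * d], hence inside the radius [4 * d = e] of [near_segment]. *)
pose d := e / 4; have d0 : 0 < d by rewrite divr_gt0.
have ed : e = 4 * d by rewrite /d mulrC divfK.
have Hd (y1 h : 'rV[R]_4 * 'M[R]_4) :
    `|y1.1 - x0| < d -> `|y1.2 - A0| < d -> `|(h + y1).1 - x0| < d -> `|(h + y1).2 - A0| < d ->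
    forall t, 0 <= t <= 1 -> slow_step c DF (t *: h + y1, h).
  move=> h1 h2 h3 h4 t t01; apply: He; rewrite ed.
  have [e1 f1] := near_segment h1 h3 t01; have [e2 f2] := near_segment h2 h4 t01.
  have b1 : ball (x0, A0) (4 * d) (t *: h + y1).
    by split; rewrite -ball_normE.
  have b2 : ball (0 : 'rV[R]_4 * 'M[R]_4) (4 * d) h.
    by split; rewrite -ball_normE.
  exact: (conj b1 b2).
have gz : slow_step c DF ((x0, A0), 0).
  by apply: He; exact: ballxx.
have Gz : (x0, A0).2 *m gmat c (x0, A0).1 *m (x0, A0).2^T = Defs.minkowski R.
  by rewrite gmat_phi//= -gram_chart.
have [r r0 Hr] : nbhs_ball x0 [set x | [/\ (phi M c @` dom M c) x, N (psi M c x) &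
    `|orthonormalised c (x, A0) - A0| < d]].
  apply/nbhs_ballP.
  have cF : orthonormalised c (x, A0) @[x --> x0] --> A0.
    have [_ [Fc _ _] _ _ _] := gz; rewrite -[A0 in _ --> A0](orthonormalised_id Gz).
    have Fx0 : Filter (nbhs x0) by exact: nbhs_filter.
    have h1 : (x, A0) @[x --> x0] --> (x0, A0).
      move=> P [[P1 P2] /= [n1 n2] s]; apply: (@filterS _ _ Fx0 P1) n1 => x P1x.
      by apply: s; split => //; exact: nbhs_singleton n2.
    exact: (cvg_comp _ _ h1 Fc).
  move/cvgrPdist_lt : cF => /(_ d d0).
  apply: filterS3 (near_codom Dz) (near_psi Dz nN) => x h1 h2; rewrite distrC => h3.
  by split.
exists (Num.min r d), d; split=> //; first by rewrite lt_min r0.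
- move=> x; rewrite lt_min => /andP[xr xd].
  have [cx Nx Fx] : [set x | [/\ (phi M c @` dom M c) x, N (psi M c x) &
    `|orthonormalised c (x, A0) - A0| < d]] x by apply: Hr; rewrite -ball_normE /= distrC.
  split=> //; pose uz : OplusM M := SigSub (mem_set Oz).
  (* Only the base point moves while the matrix stays [A0]; orthonormalising [A0] over [x] gives the
     frame of [O^+M] sought there, close to [A0] by the choice of [r]. *)
  pose h : 'rV[R]_4 * 'M[R]_4 := (x - x0, 0).
  have hE : h + (x0, A0) = (x, A0) by congr pair; rewrite ?subrK ?add0r.
  have [|||v [vp vt _]] := @orthonormal_arc c DF (x0, A0) h uz.
  + by apply: Hd; rewrite ?hE /= ?subrr ?normr0.
  + by rewrite /= /x0 phiK.
  + by rewrite (orthonormalised_id Gz).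
  by exists v; [rewrite /frame_proj vp hE|rewrite vt hE].
- move=> u v [Du ux ua] [Dv vx va] b1 b2 ip1 ip2 K K0 HK.
  pose y1 := (phi M c (pt (set_val u)), tcoord (set_val u) c).
  pose y2 := (phi M c (pt (set_val v)), tcoord (set_val v) c).
  (* Since orthonormalisation fixes the coordinates of [u] and [v], the arc with step [y2 - y1]
     starts exactly at [u] and ends exactly at [v]. *)
  have Oid (w : OplusM M) : dom M c (pt (set_val w)) ->
      orthonormalised c (phi M c (pt (set_val w)), tcoord (set_val w) c) = tcoord (set_val w) c.
    move=> Dw; rewrite orthonormalised_id//= gmat_phi// -gram_chart//.
    by have [] := set_mem (valP w).
  have hE : (y2 - y1) + y1 = y2 by rewrite subrK.
  move: ux vx; rewrite !lt_min => /andP[_ ux] /andP[_ vx].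
  have [|||w [wp wt]] := @orthonormal_arc c DF y1 (y2 - y1) u.
  + by apply: Hd; rewrite ?hE.
  + by rewrite /= phiK.
  + by rewrite Oid.
  move: wp wt; rewrite hE /= phiK// Oid// => wp wt.
  have -> : w = v.
    by apply: val_inj; apply: (tang_ext_chart (c := c)); rewrite // wp.
  by apply.
Qed.

End LocalPaths.

(** * Symmetry of the natural distance *)

Section SubCurves.
Context {R : realType} (M : spacetime R).

Lemma within_opp (D : set R) (t : R) :
  -%R @ within (-%R @^-1` D) (nbhs t) --> within D (nbhs (- t)).
Proof.
move=> P HP; have := @oppr_continuous R R t _ HP.
by apply: (@filterS _ (nbhs t)) => s Ps Ds; exact: Ps.
Qed.

Lemma C1_at_opp (V : normedModType R) (D : set R) (f : R -> V) t :
  fat (-%R @^-1` D) -> D (- t) -> (\forall s \near - t, D s -> C1_at D f s) ->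
  C1_at (-%R @^-1` D) (fun s => f (- s)) t /\
  deriv_in (-%R @^-1` D) (fun s => f (- s)) t = - deriv_in D f (- t).
Proof.
move=> fD Dt nC.
apply: (C1_at_intro (f := fun s => f (- s)) (f' := fun s => - deriv_in D f (- s)) fD Dt).
  have := @oppr_continuous R R t _ nC.
  by apply: (@filterS _ (nbhs t)) => s Hs Ds; apply/has_deriv_opp/C1_has_deriv/Hs.
have [_ cd] := nbhs_singleton nC Dt.
have FF : Filter (within (-%R @^-1` D) (nbhs t)) by exact: within_filter.
by apply: cvgN; exact: cvg_comp (@within_opp D t) cd.
Qed.

Lemma C1_at_restrict (V : normedModType R) (D D' : set R) (f : R -> V) t :
  fat D' -> D' `<=` D -> D' t -> (\forall s \near t, D s -> C1_at D f s) ->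
  C1_at D' f t /\ deriv_in D' f t = deriv_in D f t.
Proof.
move=> fD' DD Dt nC; apply: (C1_at_intro (f' := deriv_in D f) fD' Dt).
  by apply: filterS nC => s Hs Ds; apply/(has_deriv_sub DD)/C1_has_deriv/Hs/DD.
have [_ h] := nbhs_singleton nC (DD _ Dt); apply: cvg_trans h; apply: cvg_app.
exact: within_sub.
Qed.

Lemma C1_frame_near (D : set R) (u : R -> tang M 4) c t : C1_frame_curve D u -> D t ->
  dom M c (pt (u t)) -> \forall s \near t, D s -> C1_at D (xpos c u) s /\ C1_at D (apos c u) s.
Proof.
move=> [cu _ C1u] Dt Dc; have := curve_near_dom cu Dt Dc.
by apply: filterS => s Hs Ds; exact: C1u Ds (Hs Ds).
Qed.

Lemma C1_frame_restrict (D D' : set R) (u : R -> tang M 4) : fat D -> fat D' -> D' `<=` D ->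
  C1_frame_curve D u -> C1_frame_curve D' u /\
  forall t, D' t -> pomega D' u t = pomega D u t /\ ptheta D' u t = ptheta D u t.
Proof.
move=> fD fD' DD C1; have [cu FMu _] := C1.
have H c t : D' t -> dom M c (pt (u t)) ->
    (C1_at D' (xpos c u) t /\ deriv_in D' (xpos c u) t = deriv_in D (xpos c u) t) /\
    (C1_at D' (apos c u) t /\ deriv_in D' (apos c u) t = deriv_in D (apos c u) t).
  move=> Dt Dc; have nC := C1_frame_near C1 (DD _ Dt) Dc.
  by split; apply: C1_at_restrict => //; apply: filterS nC => s Hs Ds; have [] := Hs Ds.
split.
  split; first exact: continuous_subspaceW cu.
    by move=> t /DD; exact: FMu.
  by move=> c t Dt Dc; have [[? _] [? _]] := H c t Dt Dc.
move=> t Dt; have [[_ hx] [_ ha]] := H _ t Dt (dom_chart_at (pt (u t))).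
by rewrite /pomega /ptheta /frame_omega /frame_theta /xvel hx ha.
Qed.

(** Reversal changes the sign of the velocities, and both forms are linear in them. *)
Lemma C1_frame_opp (D : set R) (u : R -> tang M 4) : fat (-%R @^-1` D) ->
  C1_frame_curve D u -> C1_frame_curve (-%R @^-1` D) (fun s => u (- s)) /\
  forall t, D (- t) ->
    pomega (-%R @^-1` D) (fun s => u (- s)) t = - pomega D u (- t) /\
    ptheta (-%R @^-1` D) (fun s => u (- s)) t = - ptheta D u (- t).
Proof.
move=> fD' C1; have [cu FMu _] := C1; set w := fun s => u (- s).
have H c t : D (- t) -> dom M c (pt (u (- t))) ->
    (C1_at (-%R @^-1` D) (xpos c w) t /\
       deriv_in (-%R @^-1` D) (xpos c w) t = - deriv_in D (xpos c u) (- t)) /\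
    (C1_at (-%R @^-1` D) (apos c w) t /\
       deriv_in (-%R @^-1` D) (apos c w) t = - deriv_in D (apos c u) (- t)).
  move=> Dt Dc; have nC := C1_frame_near C1 Dt Dc.
  split.
    apply: (C1_at_opp (f := xpos c u) fD' Dt).
    by apply: filterS nC => s Hs Ds; have [] := Hs Ds.
  apply: (C1_at_opp (f := apos c u) fD' Dt).
  by apply: filterS nC => s Hs Ds; have [] := Hs Ds.
split.
  split.
  - apply/within_continuousP => t Dt.
    move/within_continuousP : cu => /(_ _ Dt) cu.
    exact: cvg_comp (@within_opp D t) cu.
  - by move=> t; exact: FMu.
  - by move=> c t Dt Dc; have [[? _] [? _]] := H c t Dt Dc.
move=> t Dt; have [[_ hx] [_ ha]] := H _ t Dt (dom_chart_at (pt (u (- t)))).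
rewrite /pomega /ptheta /frame_omega /frame_theta /xvel hx ha.
rewrite -[xpos _ w t]/(xpos _ u (- t)) -[apos _ w t]/(apos _ u (- t)).
split; last by rewrite /theta mulNmx.
rewrite /omega /covd (_ : conn _ _ (- _) = - conn (chart_at M (pt (u (- t))))
   (xpos (chart_at M (pt (u (- t)))) u (- t))
   (deriv_in D (xpos (chart_at M (pt (u (- t)))) u) (- t))); last first.
  by apply/matrixP => i j; rewrite !mxE -sumrN; apply: eq_bigr => k _; rewrite mxE mulNr.
by rewrite mulmxN -opprD mulNmx linearN.
Qed.

End SubCurves.

Lemma inner_productNN {R : realType} (V : lmodType R) (b : V -> V -> R) (x : V) : inner_product b ->
  b (- x) (- x) = b x x.
Proof.
move=> [bl bs _].
have b0 y : b 0 y = 0.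
  by have := bl (-1) 0 0 y; rewrite scaler0 addr0 mulN1r addNr.
have bN x' y : b (- x') y = - b x' y.
  by have := bl (-1) x' 0 y; rewrite addr0 scaleN1r b0 addr0 mulN1r.
by rewrite bN bs bN opprK.
Qed.

Section DistanceLaws.
Context {R : realType} (M : spacetime R).
Variables (b1 : 'M[R]_4 -> 'M[R]_4 -> R) (b2 : 'rV[R]_4 -> 'rV[R]_4 -> R).
Hypotheses (ip1 : inner_product b1) (ip2 : inner_product b2).
Implicit Types x y z : OplusM M.

Lemma natural_dist_ltD x y z (e e' : R) : (natural_dist b1 b2 x y < e%:E)%E ->
  (natural_dist b1 b2 y z < e'%:E)%E -> (natural_dist b1 b2 x z < (e + e')%:E)%E.
Proof.
move=> /ereal_inf_lt[l pl le] /ereal_inf_lt[l' pl' le'].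
apply: le_lt_trans (lteD le le'); apply: ereal_inf_lbound.
exact: path_cat pl pl'.
Qed.

(** Each arc is run backwards on [[- s, - r]]. The forms change sign, so the speed does not, and the
    substitution of [- t] preserves the integral. *)
Lemma path_length_sym x y l : path_length b1 b2 x y l -> path_length b1 b2 y x l.
Proof.
elim=> [r s w rs C1w|x1 y1 z1 l1 l2 _ p1 _ p2]; last by rewrite addeC; exact: path_cat p2 p1.
have E : -%R @^-1` [set` `[r, s]] = [set` `[- s, - r]].
  by apply/seteqP; split=> t /=; rewrite !in_itv/= lerNl lerNr andbC.
have sr : - s < - r by rewrite ltrN2.
have fD : fat `[r, s] by exact: fat_itv.
have fD' : fat `[- s, - r] by exact: fat_itv.
pose u t := set_val (w t).
have := C1_frame_opp (D := [set` `[r, s]]) (u := u); rewrite E.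
move=> /(_ fD' C1w)[C1' sp].
have Ow t : OplusM M (u (- t)) by exact: set_mem (valP (w (- t))).
have := @path_length_curve _ _ b1 b2 (- s) (- r) (fun t => u (- t)) (w s) (w r)
  sr C1' (fun t _ => Ow t).
rewrite !opprK => /(_ erefl erefl).
rewrite integration_by_substitution_oppr ?(ltW rs)//; last first.
  exact: (natural_speed_continuous ip1 ip2 fD' C1').
congr path_length; apply: eq_integral => t; rewrite inE => Dt /=; congr EFin.
have Dt' : [set` `[r, s]] (- - t) by rewrite opprK.
have [h1 h2] := sp (- t) Dt'.
by rewrite !natural_speedE h1 h2 !inner_productNN// opprK.
Qed.

Lemma natural_dist_sym x y : natural_dist b1 b2 x y = natural_dist b1 b2 y x.
Proof.
by congr ereal_inf; apply/seteqP; split=> l /=; exact: path_length_sym.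
Qed.

End DistanceLaws.

(** * The horizontal lift *)

Section Ray.
Context {R : realType}.
Variable a : \bar R.
Hypothesis a0 : (0 < a)%E.

Lemma ray0 : ray a 0.
Proof. by split. Qed.

Lemma ray_interval : is_interval (ray a).
Proof.
move=> x y [x0 xa] [y0 ya] z /andP[xz zy]; split; first exact: le_trans xz.
by apply: le_lt_trans ya; rewrite lee_fin.
Qed.

Lemma ray_later t : ray a t -> exists2 s, ray a s & t < s.
Proof.
case: a => [r| |] [t0 ta].
- rewrite lte_fin in ta; exists ((t + r) / 2); last by lra.
  by split; [lra|rewrite lte_fin; lra].
- by exists (t + 1); [split; [lra|exact: ltry]|lra].
- by [].
Qed.

Lemma ray_later2 t t' : ray a t -> ray a t' -> exists s, [/\ ray a s, t < s & t' < s].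
Proof.
move=> rt rt'; have [tt'|t't] := leP t t'.
  by have [s rs ts] := ray_later rt'; exists s; split => //; exact: le_lt_trans ts.
by have [s rs ts] := ray_later rt; exists s; split => //; exact: lt_trans ts.
Qed.

Lemma fat_ray : fat (ray a).
Proof.
split; first exact: ray_interval.
move=> t; have [->|t0] := eqVneq t 0; last by exists 0; [exact: ray0|rewrite eq_sym].
by have [s rs s0] := ray_later ray0; exists s => //; rewrite gt_eqF.
Qed.

Lemma ray_sub r s : ray a r -> ray a s -> `[r, s] `<=` ray a.
Proof. by move=> rr rs t /=; rewrite in_itv/= => ts; exact: ray_interval ts. Qed.

Lemma to_end_filter : Filter (to_end a).
Proof.
apply: filter_from_filter; first by exists 0; exact: ray0.
move=> i j ri rj; have [ij|ji] := leP i j.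
  by exists j => // s [rs js]; split; split => //; exact: le_lt_trans js.
by exists i => // s [rs js]; split; split => //; exact: lt_trans js.
Qed.

End Ray.

Lemma has_deriv0_cst {R : realType} m n (D : set R) (f : R -> 'M[R]_(m, n)) r s :
  is_interval D -> D r -> D s -> (forall t, D t -> has_deriv D f t 0) -> f r = f s.
Proof.
move=> iD; wlog rs : r s / r < s.
  move=> H Dr Ds Hf; have [rs|sr|->//] := ltgtP r s; first exact: H.
  by symmetry; exact: H.
move=> Dr Ds Hf; have DD : [set` `[r, s]] `<=` D.
  by move=> t /=; rewrite in_itv/= => ts; exact: iD ts.
have fD := fat_itv rs.
have H t : [set` `[r, s]] t -> C1_at `[r, s] f t /\ deriv_in `[r, s] f t = 0.
  move=> Dt; apply: (C1_at_intro (f' := fun=> 0) fD Dt); last exact: cvg_cst.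
  by exists 1 => //= q _ Dq; apply: (has_deriv_sub DD); exact/Hf/DD.
have := displacement_le (h := fun=> 0) rs (fun t Dt => (H t Dt).1).
move=> /(_ _ _)/wrap[].
- by apply: continuous_subspaceT => x; exact: cvg_cst.
- by move=> t Dt; rewrite (H t Dt).2 normr0.
rewrite integral0 lee_fin normr_le0 subr_eq0 => /eqP ->//.
Qed.

Section Lift.
Context {R : realType} (M : spacetime R).
Variables (a : \bar R) (gamma : R -> M) (e : R -> tang M 4).
Hypotheses (a0 : (0 < a)%E) (pe : parallel_frame a gamma e).

Lemma parallel_deriv c t : ray a t -> dom M c (pt (e t)) ->
  has_deriv (ray a) (apos c e) t
    (- (apos c e t *m conn c (xpos c e t) (deriv_in (ray a) (xpos c e) t))).
Proof.
have [[_ _ C1e] ge cov] := pe => rt Dt; have [hx ha] := C1e c t rt Dt.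
rewrite ge// in Dt; have := cov c t rt Dt; rewrite /frame_covd /covd => /eqP.
by rewrite addr_eq0 => /eqP <-; exact: C1_has_deriv.
Qed.

(** Differentiating [A *m G *m A^T], the two terms from the transport equation cancel the derivative
    of [G], rewritten by [conn_metric]. *)
Lemma gram_parallel t : ray a t -> gram (metric M) (e t) = gram (metric M) (e 0).
Proof.
move=> rt; apply: (has_deriv0_cst (D := ray a) (f := fun t => gram (metric M) (e t))) => //.
  exact: ray_interval.
move=> {rt} t rt; have [[ce _ C1e] _ _] := pe.
set c := chart_at M (pt (e t)).
have Dc : dom M c (pt (e t)) by exact: dom_chart_at.
have cx : (phi M c @` dom M c) (xpos c e t) by exists (pt (e t)).
have ha := parallel_deriv rt Dc.
have hx := C1_has_deriv (C1e c t rt Dc).1.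
set v := deriv_in _ _ _ in ha hx.
have GE s : dom M c (pt (e s)) -> apos c e s *m gmat c (xpos c e s) *m (apos c e s)^T =
    gram (metric M) (e s).
  by move=> Ds; rewrite (gram_chart Ds) /xpos gmat_phi.
have := has_deriv_mulmx (has_deriv_mulmx ha (has_deriv_gmat cx hx)) (has_deriv_trmx ha).
rewrite -(conn_metric v cx).
set A := apos c e t; set C := conn c _ _; set G := gmat c _.
have Gs : G^T = G by exact: (gmx_sym (metric M) (codom_dom cx)).
rewrite (_ : _ + _ = 0); last first.
  rewrite linearN /= !trmx_mul Gs mulmxDr mulNmx mulmxN !mulmxA addrA addNr add0r.
  by rewrite subrr.
apply: has_deriv_near; first exact: GE.
by apply: filterS (curve_near_dom ce rt Dc) => s Hs /Hs; exact: GE.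
Qed.

Lemma gram_unit (u : tang M 4) : FM M u ->
  exists2 B, B \in unitmx & B *m gram (metric M) u *m B^T = Defs.minkowski R.
Proof.
move=> FMu; set c := chart_at M (pt u).
have Dc : dom M c (pt u) by exact: dom_chart_at.
have [P Pu PE] := gmx_signature (metric M) Dc.
have Au : tcoord u c \in unitmx by exact: FMu.
exists (P *m invmx (tcoord u c)); first by rewrite unitmx_mul Pu unitmx_inv.
rewrite (gram_chart Dc) trmx_mul trmx_inv !mulmxA mulmxKV// mulmxK ?unitmx_tr//.
Qed.

End Lift.

Section OrientationChoice.
Context {R : realType} (M : spacetime R).

Definition flip (i : 'I_4) : 'M[R]_4 := diag_mx (\row_j (if j == i then -1 else 1)).

Lemma flip_minkowski i : flip i *m Defs.minkowski R *m (flip i)^T = Defs.minkowski R.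
Proof.
rewrite /flip /Defs.minkowski tr_diag_mx !mulmx_diag; congr diag_mx.
apply/rowP => j; rewrite !mxE.
by case: ifP => _; case: ifP => _; rewrite ?mulN1r ?mul1r ?mulr1 ?opprK ?mulrN1.
Qed.

Lemma flip_max_row : row ord_max 1%:M *m flip ord_max = - 1%:M *m row ord_max 1%:M :> 'M[R]__.
Proof.
rewrite rowE mulmx1 mulNmx mul1mx -rowE; apply/rowP => j; rewrite !mxE eqxx eq_sym.
by case: eqP; rewrite ?mulr1n ?mulr0n ?oppr0.
Qed.

Lemma flip0_row : row ord_max 1%:M *m flip (lift ord_max ord0) = row ord_max 1%:M :> 'M[R]__.
Proof.
rewrite rowE mulmx1 -rowE; apply/rowP => j; rewrite !mxE eqxx.
by rewrite (negbTE (neq_lift _ _)) [j == _]eq_sym.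
Qed.

Lemma flip0_rowsub : rowsub (lift ord_max) 1%:M *m flip (lift ord_max ord0) =
  flip_first *m rowsub (lift ord_max) 1%:M :> 'M[R]_(3, 4).
Proof.
rewrite mul_rowsub_mx mul1mx; apply/matrixP => i j; rewrite mul_diag_mx !mxE.
by rewrite (inj_eq lift_inj) mulr_natr.
Qed.

(** A past-directed last vector is reversed first, then a spacelike vector if the triad is
    left-handed; the second reversal leaves the timelike vector alone. *)
Lemma orientation_choice (u : tang M 4) : OM M u ->
  exists2 S, S \in unitmx & OplusM M (tmul S u).
Proof.
have flipO v i : OM M v -> OM M (tmul (flip i) v).
  by move=> Ov; rewrite /OM /= gram_tmul Ov flip_minkowski.
have flipu i : flip i \in unitmx.
  rewrite unitmxE det_diag unitfE; apply/prodf_neq0 => j _; rewrite mxE.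
  by case: ifP; rewrite ?oppr_eq0 oner_neq0.
have [_ _ _ Ft] := future_orientation M.
have [_ _ _ Rt] := right_handed_orientation M.
move=> Ou; have [S1 [S1u O1 f1]] : exists S1, [/\ S1 \in unitmx, OM M (tmul S1 u) &
    future (tmul (row ord_max 1%:M) (tmul S1 u))].
  have [fu|fu] := pselect (future (tmul (row ord_max 1%:M) u)).
    exists 1%:M; rewrite unitmx1 (_ : tmul 1%:M u = u); first by split.
    by apply: tang_ext => // c _; rewrite /= mul1mx.
  exists (flip ord_max); split => //; first exact: flipO.
  rewrite tmul_comp flip_max_row -tmul_comp; apply/Ft => //.
  exact: OM_timelike.
set v := tmul S1 u in O1 f1.
have [fv|fv] := pselect (right_handed (tmul (rowsub (lift ord_max) 1%:M) v)).
  by exists S1.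
exists (flip (lift ord_max ord0) *m S1); first by rewrite unitmx_mul flipu.
rewrite -tmul_comp; split; first exact: flipO.
- by rewrite tmul_comp flip0_row.
- rewrite tmul_comp flip0_rowsub -tmul_comp; apply/Rt => //.
  exact: OM_spacelike.
Qed.

End OrientationChoice.

(** * Generalised affine length between two times *)

Section GapLength.
Context {R : realType} (M : spacetime R).
Variables (a : \bar R) (e : R -> tang M 4) (l : R).
Hypotheses (a0 : (0 < a)%E) (C1e : C1_frame_curve (ray a) e).
Hypothesis gl : gap a e @ to_end a --> l%:E.
Local Notation mu := lebesgue_measure.
Let fD := fat_ray a0.

Lemma gap_speed_ge0 t : 0 <= gap_speed a e t.
Proof. exact: sqrtr_ge0. Qed.

Lemma ptheta_gap_speed t : `|ptheta (ray a) e t| <= gap_speed a e t.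
Proof.
apply: mx_norm_le; first exact: gap_speed_ge0.
move=> i j; rewrite ord1 -sqrtr_sqr; apply: ler_wsqrtr.
rewrite (bigD1 j)//= lerDl; apply: sumr_ge0 => k _; exact: sqr_ge0.
Qed.

Lemma gap_speed_continuous : {within ray a, continuous (gap_speed a e)}.
Proof.
apply/within_continuousP => t rt.
have FF : Filter (within (ray a) (nbhs t)) by exact: within_filter.
have /within_continuousP/(_ t rt)/cvg_mxP h := ptheta_continuous fD C1e.
apply: continuous_cvg; first exact: sqrt_continuous.
apply: cvg_sum => i _; rewrite (_ : (fun s => _) = fun s =>
    ptheta (ray a) e s 0 i * ptheta (ray a) e s 0 i).
  by rewrite expr2; apply: cvgM; exact: h.
by apply/funext => s; rewrite expr2.
Qed.

Lemma gap_speed_measurable r s : ray a r -> ray a s ->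
  measurable_fun `[r, s] (EFin \o gap_speed a e).
Proof.
move=> rr rs; apply: measurable_seg.
exact: continuous_subspaceW (ray_sub rr rs) gap_speed_continuous.
Qed.

Definition gap_between r s : \bar R := (\int[mu]_(t in `[r, s]) (gap_speed a e t)%:E)%E.

Lemma gap_between_sub r s r' s' : ray a r' -> ray a s' -> r' <= r -> s <= s' ->
  (gap_between r s <= gap_between r' s')%E.
Proof.
move=> rr' rs' rr ss; apply: ge0_subset_integral => //=.
- exact: gap_speed_measurable.
- by move=> t _; rewrite lee_fin gap_speed_ge0.
- by apply: subset_itv => //; rewrite bnd_simp.
Qed.

Lemma gapD r s : ray a r -> ray a s -> r < s ->
  gap a e s = (gap a e r + gap_between r s)%E.
Proof.
move=> rr rs rs_; have [r0 _] := rr.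
have U : [set` `[0, s]] = [set` `[0, r]] `|` [set` `]r, s]].
  apply/seteqP; split=> t /=; rewrite !in_itv/=.
    by move=> /andP[t0 ts]; have [tr|rt] := leP t r; [left|right]; rewrite ?t0 ?ts.
  by move=> [/andP[t0 tr]|/andP[rt ts]]; apply/andP; split=> //; lra.
have ms := gap_speed_measurable (ray0 a0) rs.
rewrite /gap {1}U ge0_integral_setU//=.
- congr (_ + _)%E; rewrite /gap_between integral_itv_obnd_cbnd//.
  apply: measurable_funS ms => // t /=; rewrite !in_itv/= => /andP[rt ts].
  by rewrite ts andbT ltW// (le_lt_trans r0).
- by rewrite -U.
- by move=> t _; rewrite lee_fin gap_speed_ge0.
- apply/disj_setPS => t [] /=; rewrite !in_itv/= => /andP[_ tr] /andP[rt _].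
  by move: (lt_le_trans rt tr); rewrite ltxx.
Qed.

Lemma gap_near_end (E : R) : 0 < E -> exists2 T, ray a T &
  forall t, ray a t -> T < t -> exists2 x, gap a e t = x%:E & `|l - x| < E.
Proof.
move=> E0; have Fe := to_end_filter a0.
have /fine_cvgP[fin /cvgrPdist_lt/(_ _ E0) H] := gl.
have [T rT HT] := filterI fin H.
exists T => // t rt Tt; have [] := HT t (conj rt Tt) => /= ft lt.
by exists (fine (gap a e t)) => //; rewrite fineK.
Qed.

Lemma gap_between_bounded : exists B : R, forall r s, ray a r -> ray a s ->
  (gap_between r s <= B%:E)%E.
Proof.
have [T rT HT] := gap_near_end ltr01; exists (l + 1) => r s rr rs.
have [s' [rs' ss Ts]] := ray_later2 rs rT.
have [x gx lx] := HT s' rs' Ts.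
apply: (@le_trans _ _ (gap a e s')).
  by apply: gap_between_sub; [exact: ray0|by []|case: rr|exact: ltW].
by rewrite gx lee_fin; move: lx; rewrite distrC ltr_norml => /andP[_]; lra.
Qed.

(** Beyond [T] the values of [gap] lie within [E / 2] of [l], and the length between two times is a
    difference of two such values. *)
Lemma gap_between_tail (E : R) : 0 < E -> exists2 T, ray a T &
  forall r s, ray a r -> ray a s -> T < r -> r < s -> (gap_between r s < E%:E)%E.
Proof.
move=> E0; have E20 : 0 < E / 2 by lra.
have [T rT HT] := gap_near_end E20; exists T => // r s rr rs Tr rs_.
have [x gx lx] := HT r rr Tr; have [y gy ly] := HT s rs (lt_trans Tr rs_).
have := gapD rr rs rs_; rewrite gx gy.
case: (gap_between r s) => [z [yz]| |]//; rewrite lte_fin.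
by move: lx ly; rewrite !ltr_norml => /andP[? ?] /andP[? ?]; lra.
Qed.

End GapLength.

Section LiftedCurve.
Context {R : realType} (M : spacetime R).

Lemma C1_frame_tmul (D : set R) (B : 'M[R]_4) (e : R -> tang M 4) : fat D ->
  B \in unitmx -> C1_frame_curve D e -> C1_frame_curve D (fun t => tmul B (e t)) /\
  forall c t, D t -> dom M c (pt (e t)) ->
    deriv_in D (apos c (fun t => tmul B (e t))) t = B *m deriv_in D (apos c e) t.
Proof.
move=> fD Bu C1; have [ce FMe _] := C1; set u := fun t => _.
have H c t : D t -> dom M c (pt (e t)) -> C1_at D (apos c u) t /\
    deriv_in D (apos c u) t = B *m deriv_in D (apos c e) t.
  move=> Dt Dc; have nC := C1_frame_near C1 Dt Dc.
  have FF : Filter (within D (nbhs t)) by exact: within_filter.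
  apply: (C1_at_intro (f' := fun s => B *m deriv_in D (apos c e) s) fD Dt).
    apply: filterS nC => s Hs Ds; have [_ /C1_has_deriv ha] := Hs Ds.
    by have := has_deriv_mulmx (has_deriv_cst D s B) ha; rewrite mul0mx add0r.
  by apply: cvg_mulmx; [exact: cvg_cst|have [_ []] := nbhs_singleton nC Dt].
split; last by move=> c t Dt Dc; have [] := H c t Dt Dc.
split.
- apply/within_continuousP => t Dt.
  move/within_continuousP : ce => /(_ _ Dt) ce.
  exact: (cvg_comp _ _ ce (@tmul_continuous _ _ _ _ B (e t))).
- by move=> t Dt c Dc; rewrite /= unitmx_mul Bu; exact: FMe.
- move=> c t Dt Dc; split; last by have [] := H c t Dt Dc.
  by have [] := nbhs_singleton (C1_frame_near C1 Dt Dc) Dt.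
Qed.

Variables (a : \bar R) (gamma : R -> M) (e : R -> tang M 4).
Hypotheses (a0 : (0 < a)%E) (pe : parallel_frame a gamma e).
Local Notation mu := lebesgue_measure.
Let fD := fat_ray a0.

Lemma parallel_tmul (B : 'M[R]_4) t : B \in unitmx -> ray a t ->
  pomega (ray a) (fun t => tmul B (e t)) t = 0 /\
  ptheta (ray a) (fun t => tmul B (e t)) t = ptheta (ray a) e t *m invmx B.
Proof.
move=> Bu rt; have [C1e ge cov] := pe; have [C1u du] := C1_frame_tmul fD Bu C1e.
have [_ FMe _] := C1e.
set u := fun t => _ in C1u du *.
set c := chart_at M (pt (e t)).
have Dc : dom M c (pt (e t)) by exact: dom_chart_at.
have Au : tcoord (e t) c \in unitmx by exact: FMe.
have Dg : dom M c (gamma t) by rewrite -ge.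
rewrite (pomega_chart fD C1u rt Dc) (ptheta_chart fD C1u rt Dc) (ptheta_chart fD C1e rt Dc).
rewrite du//; split.
  rewrite /omega -[RHS]trmx0; congr trmx.
  have := cov c t rt Dg; rewrite /frame_covd /covd => cv.
  rewrite /covd -[apos c u t]/(B *m apos c e t) -[xpos c u t]/(xpos c e t).
  by rewrite -mulmxA -mulmxDr cv mulmx0 mul0mx.
rewrite /theta -[apos c u t]/(B *m apos c e t).
have BAu : B *m apos c e t \in unitmx by rewrite unitmx_mul Bu.
by apply: (can_inj (mulmxK BAu)); rewrite mulmxKV// !mulmxA !mulmxKV.
Qed.

Lemma orthonormal_lift : exists2 B, B \in unitmx &
  forall t, ray a t -> OplusM M (tmul B (e t)).
Proof.
have [C1e _ _] := pe; have [_ FMe _] := C1e.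
have [B Bu BE] := gram_unit (FMe 0 (ray0 a0)).
have O0 : OM M (tmul B (e 0)) by rewrite /OM /= gram_tmul BE.
have [S Su OS] := orientation_choice O0.
have SBu : S *m B \in unitmx by rewrite unitmx_mul Su.
have [[cu _ _] _] := C1_frame_tmul fD SBu C1e.
exists (S *m B) => // t rt.
apply: (@OplusM_connected _ _ ((fun t => tmul (S *m B) (e t)) @` ray a)).
- apply: connected_continuous_connected cu.
  by apply/connected_intervalP; exact: ray_interval.
- move=> _ [s rs <-]; have [ OS' _ _] := OS; rewrite /OM /= -[RHS]OS' -!tmul_comp !gram_tmul.
  by rewrite (gram_parallel a0 pe rs).
- exists (tmul (S *m B) (e 0)); split; last by rewrite -tmul_comp.
  by exists 0 => //; exact: ray0.
- by exists t.
Qed.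

Lemma lift_dist (b1 : 'M[R]_4 -> 'M[R]_4 -> R) (b2 : 'rV[R]_4 -> 'rV[R]_4 -> R) (B : 'M[R]_4)
    (u : R -> OplusM M) :
  inner_product b1 -> inner_product b2 -> B \in unitmx ->
  (forall t, ray a t -> set_val (u t) = tmul B (e t)) ->
  exists2 C, 0 < C & forall r s, ray a r -> ray a s -> r < s ->
    (natural_dist b1 b2 (u r) (u s) <= C%:E * gap_between a e r s)%E.
Proof.
move=> ip1 ip2 Bu uE; have [C1e ge cov] := pe.
have [C1u _] := C1_frame_tmul fD Bu C1e.
have [K K0 HK] := natural_speed_upper M ip1 ip2.
(* [theta] is multiplied by [invmx B], which costs the factor [4 * |invmx B|] in sup norm; the added
   1 makes [C] positive. *)
pose C := K * (4%:R * (`|invmx B| + 1)).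
have C0 : 0 < C by rewrite !mulr_gt0// ltr_wpDl.
exists C => // r s rr rs rs_; pose v t := tmul B (e t).
have DD := ray_sub rr rs; have fD' := fat_itv rs_.
have [C1v sp] := C1_frame_restrict fD fD' DD C1u.
apply: (@le_trans _ _ (\int[mu]_(t in `[r, s]) (natural_speed b1 b2 (M := M) `[r, s] v t)%:E)%E).
  apply: ereal_inf_lbound; apply: path_length_curve => //.
  - by move=> t /DD rt; rewrite /v -(uE t rt); exact: set_mem (valP (u t)).
  - exact: uE.
  - exact: uE.
rewrite /gap_between -ge0_integralZl_EFin//=.
- apply: ge0_le_integral => //=.
  + by move=> t _; rewrite lee_fin natural_speed_ge0.
  + by apply: measurable_seg; exact: natural_speed_continuous.
  + apply: (@measurable_seg R r s (fun t => C * gap_speed a e t)).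
    apply: (continuous_subspaceW DD); apply/within_continuousP => t rt.
    apply: cvgM; first exact: cvg_cst.
    by move/within_continuousP : (gap_speed_continuous a0 C1e); apply.
  + move=> t Dt; rewrite -EFinM lee_fin.
    have rt := DD _ Dt.
    have [h1 h2] := sp t Dt; have [k1 k2] := parallel_tmul Bu rt.
    apply: le_trans (HK _ _ _) _; rewrite h1 h2 k1 k2 normr0 add0r /C -mulrA.
    apply: ler_wpM2l; first exact: ltW.
    apply: le_trans (mx_norm_mulmx _ _) _; rewrite -mulrA -[leRHS]mulrA.
    apply: ler_wpM2l => //; rewrite mulrC; apply: ler_pM => //.
      by rewrite lerDl.
    exact: ptheta_gap_speed.
- by move=> t _; rewrite lee_fin gap_speed_ge0.
- exact: gap_speed_measurable.
- exact: ltW.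
Qed.

Variable l : R.
Hypothesis gl : gap a e @ to_end a --> l%:E.

Lemma lift_exists : exists u : R -> OplusM M,
  (forall t, ray a t -> frame_proj (u t) = gamma t) /\
  forall b1 b2, inner_product b1 -> inner_product b2 ->
    (exists B : R, forall t t', ray a t -> ray a t' ->
       (natural_dist b1 b2 (u t) (u t') < B%:E)%E) /\
    (forall E : R, 0 < E -> exists2 T, ray a T &
       forall t t', ray a t -> ray a t' -> T < t -> T < t' ->
       (natural_dist b1 b2 (u t) (u t') < E%:E)%E).
Proof.
have [B Bu OB] := orthonormal_lift; have [C1e ge _] := pe.
have uP t : exists u : OplusM M, ray a t -> set_val u = tmul B (e t).
  have [rt|rt] := pselect (ray a t); first by exists (SigSub (mem_set (OB t rt))).
  by exists (SigSub (mem_set (OB 0 (ray0 a0)))).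
have [u uE] := choice uP; exists u; split; first by move=> t rt; rewrite /frame_proj uE//= ge.
move=> b1 b2 ip1 ip2; have [C C0 HC] := lift_dist ip1 ip2 Bu uE.
have lt_of r s x : ray a r -> ray a s -> r < s -> (gap_between a e r s < x%:E)%E ->
    (natural_dist b1 b2 (u r) (u s) < (C * x)%:E)%E.
  move=> rr rs rs_ gx; apply: le_lt_trans (HC r s rr rs rs_) _.
  by rewrite EFinM lte_pmul2l// lte_fin.
split.
  have [G HG] := gap_between_bounded a0 C1e gl.
  (* The two times are compared through a common later time [s], whatever their order; the added 1
     makes the bounds strict. *)
  exists (C * (G + 1) + C * (G + 1)) => t t' rt rt'.
  have [s [rs ts ts']] := ray_later2 rt rt'.
  have G1 r : ray a r -> (gap_between a e r s < (G + 1)%:E)%E.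
    by move=> rr; apply: le_lt_trans (HG _ _ rr rs) _; rewrite lte_fin ltrDl.
  apply: natural_dist_ltD (lt_of _ _ _ rt rs ts (G1 _ rt)) _.
  by rewrite natural_dist_sym//; exact: (lt_of _ _ _ rt' rs ts' (G1 _ rt')).
move=> E E0; have EC : 0 < E / 2 / C by rewrite !divr_gt0.
have [T rT HT] := gap_between_tail a0 C1e gl EC; exists T => // t t' rt rt' Tt Tt'.
have [s [rs ts ts']] := ray_later2 rt rt'.
rewrite [E](_ : _ = C * (E / 2 / C) + C * (E / 2 / C)); last first.
  by rewrite mulrC divfK ?gt_eqF//; lra.
apply: natural_dist_ltD (lt_of _ _ _ rt rs ts (HT _ _ rt rs Tt ts)) _.
by rewrite natural_dist_sym//; exact: (lt_of _ _ _ rt' rs ts' (HT _ _ rt' rs Tt' ts')).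
Qed.

End LiftedCurve.

(** * The singular region *)

(** The ball is the union of the segments joining [x0] to its points. *)
Lemma norm_ball_connected {R : realType} (V : normedModType R) (x0 : V) (r : R) :
  0 < r -> connected [set x : V | `|x - x0| < r].
Proof.
move=> r0; set B := [set x | _]; pose seg x := (fun s : R => s *: (x - x0) + x0) @` `[0, 1].
have -> : B = \bigcup_(x in B) seg x.
  apply/seteqP; split=> [x Bx|_ [x Bx [s + <-]]].
    by exists x => //; exists 1; rewrite ?scale1r ?subrK//= in_itv/= ler01 lexx.
  rewrite /= in_itv/= => /andP[s0 s1]; rewrite /B /= addrK normrZ ger0_norm//.
  by apply: le_lt_trans Bx; rewrite ler_piMl.
apply: bigcup_connected.
  exists x0 => x _; exists 0; last by rewrite scale0r add0r.
  by rewrite /= in_itv/= lexx ler01.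
move=> x _; apply: connected_continuous_connected.
  by apply/connected_intervalP; exact: interval_is_interval.
by apply/within_continuousP => s Ds; exact: has_deriv_cont (@has_deriv_affine R _ _ (x - x0) x0 s).
Qed.

Section ChartBall.
Context {R : realType} (M : manifold R).
Variables (c : ix M) (x0 : 'rV[R]_4) (r : R).
Hypothesis r0 : 0 < r.
Hypothesis codom_ball : forall x, `|x - x0| < r -> (phi M c @` dom M c) x.

Definition chart_ball : set M := [set psi M c x | x in [set x | `|x - x0| < r]].

Lemma chart_ball_connected : connected chart_ball.
Proof.
apply: connected_continuous_connected; first exact: norm_ball_connected.
apply/within_continuousP => x Bx; have [p Dp <-] := codom_ball Bx.
by apply: cvg_trans (cvg_app _ (cvg_within _)) _; exact: psi_cont.
Qed.

Lemma chart_ball_open : open chart_ball.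
Proof.
rewrite openE => _ [x Bx <-]; have [p Dp px] := codom_ball Bx.
rewrite -px phiK//; have nB : nbhs (phi M c p) [set x | `|x - x0| < r].
  rewrite px; have h : `|y - x0| @[y --> x] --> `|x - x0|.
    have Fx : Filter (nbhs x) by exact: nbhs_filter.
    by apply: cvg_norm; apply: cvgB; [exact: cvg_id|exact: cvg_cst].
  exact: (cvgr_lt _ h).
apply: filterS2 (near_dom Dp) (near_phi Dp nB) => q Dq Bq.
by exists (phi M c q); rewrite ?phiK.
Qed.

End ChartBall.

Section FrameBoxOpen.
Context {R : realType} (M : spacetime R).

Lemma frame_box_open (z : tang M 4) c (r e : R) : open (frame_box z c r e).
Proof.
apply: tang_basic_open; exists c.
exists ([set x | `|x - phi M c (pt z)| < r] `*` [set A | `|A - tcoord z c| < e]); last first.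
  by apply/seteqP; split=> v /=; [move=> [? ? ?]|move=> [? [? ?]]].
have ballE (V : normedModType R) (x0 : V) (d : R) : open [set x | `|x - x0| < d].
  rewrite openE => x /= Bx; have h : `|y - x0| @[y --> x] --> `|x - x0|.
    have Fx : Filter (nbhs x) by exact: nbhs_filter.
    by apply: cvg_norm; apply: cvgB; [exact: cvg_id|exact: cvg_cst].
  exact: (cvgr_lt _ h).
rewrite openE => -[x A] [/= Bx BA].
exists ([set x | `|x - phi M c (pt z)| < r], [set A | `|A - tcoord z c| < e]) => //=.
by split; apply: open_nbhs_nbhs; split => //; exact: ballE.
Qed.

End FrameBoxOpen.

Theorem proposition1 (R : realType) (M : spacetime R) (U : set M)
    (hU : open U)
    (hgamma : exists (a : \bar R) (gamma : R -> M),
        b_incomplete a gamma /\ gamma @` ray a `<=` U) :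
  exists (V : set M) (Vt : set (OplusM M)),
    b_incomplete_singular_region V /\ V `<=` U /\ open Vt /\
    (forall d, natural_distance d -> dist_bounded d Vt) /\
    (forall d, natural_distance d -> cauchy_incomplete d (closure Vt)) /\
    [set frame_proj u | u in Vt] = V.
Proof.
have [a [gamma [bi gU]]] := hgamma; have [a0 [gc _] [e pe [l gl]] noend] := bi.
have [u [ug ud]] := lift_exists a0 pe gl.
pose z t := set_val (u t); pose c t := chart_at M (pt (z t)).
have Dz t : dom M (c t) (pt (z t)) by exact: dom_chart_at.
have Oz t : OplusM M (z t) by exact: set_mem (valP (u t)).
have zg t : ray a t -> pt (z t) = gamma t := ug t.
have nU t : ray a t -> nbhs (pt (z t)) U.
  by move=> rt; rewrite zg//; apply: open_nbhs_nbhs; split => //; apply: gU; exists t.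
have boxP t : exists p : R * R, ray a t -> [/\ 0 < p.1, 0 < p.2,
   forall x, `|x - phi M (c t) (pt (z t))| < p.1 -> [/\ (phi M (c t) @` dom M (c t)) x,
     U (psi M (c t) x) & exists2 v : OplusM M, frame_proj v = psi M (c t) x &
       `|tcoord (set_val v) (c t) - tcoord (z t) (c t)| < p.2] &
   forall v w : OplusM M, frame_box (z t) (c t) p.1 p.2 (set_val v) ->
     frame_box (z t) (c t) p.1 p.2 (set_val w) ->
    forall b1 b2, inner_product b1 -> inner_product b2 -> forall K, 0 < K ->
    (forall D u t, natural_speed b1 b2 (M := M) D u t <=
       K * (`|pomega D u t| + `|ptheta D u t|)) ->
    (natural_dist b1 b2 v w <= (K * 2)%:E)%E].
  have [rt|rt] := pselect (ray a t); last by exists (0, 0).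
  have [r [d H]] := frame_box_small (Oz t) (Dz t) (nU t rt); by exists (r, d).
have [p pP] := choice boxP.
pose P t := chart_ball (c t) (phi M (c t) (pt (z t))) (p t).1.
pose W t : set (OplusM M) := set_val @^-1` frame_box (z t) (c t) (p t).1 (p t).2.
have Wu t : ray a t -> W t (u t).
  by move=> rt; have [p1 p2 _ _] := pP t rt; split; rewrite ?subrr ?normr0//; exact: Dz.
have Pg t : ray a t -> P t (gamma t).
  move=> rt; have [p1 p2 _ _] := pP t rt; exists (phi M (c t) (pt (z t))).
    by rewrite /= subrr normr0.
  by rewrite phiK; [exact: zg|exact: Dz].
pose V := \bigcup_(t in ray a) P t; pose Vt := \bigcup_(t in ray a) W t.
have cb t x : ray a t -> `|x - phi M (c t) (pt (z t))| < (p t).1 ->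
    (phi M (c t) @` dom M (c t)) x.
  by move=> rt; have [_ _ + _] := pP t rt => /[apply] -[].
have gV : gamma @` ray a `<=` V by move=> _ [t rt <-]; exists t => //; exact: Pg.
have cV : connected V.
  (* The image of the curve is added to every ball: each [P t] meets it at [gamma t], and all the
     enlarged sets share [gamma 0]. *)
  have -> : V = \bigcup_(t in ray a) (P t `|` gamma @` ray a).
    apply/seteqP; split=> [q [t rt Pq]|q [t rt [Pq|/gV]]] //; first by exists t => //; left.
    by exists t.
  apply: bigcup_connected.
    by exists (gamma 0) => t rt; right; exists 0 => //; exact: ray0.
  move=> t rt; apply: connectedU.
  - by exists (gamma t); split; [exact: Pg|exists t].
  - have [p1 _ _ _] := pP t rt.
    by apply: chart_ball_connected => // x; exact: cb.
  - apply: connected_continuous_connected gc.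
    by apply/connected_intervalP; exact: ray_interval.
have oV : open V.
  by apply: bigcup_open => t rt; apply: chart_ball_open => x; exact: cb.
exists V, Vt; split; first by split => //; exists a, gamma.
split; first by move=> _ [t rt [x Bx <-]]; have [_ _ /(_ x Bx)[]] := pP t rt.
split.
  apply: bigcup_open => t rt; apply: open_comp; last exact: frame_box_open.
  by move=> v _; exact: initial_continuous.
split; last split.
- move=> _ [b1 [b2 [ip1 ip2 ->]]]; have [K K0 HK] := natural_speed_upper M ip1 ip2.
  have [[B HB] _] := ud b1 b2 ip1 ip2.
  (* The way goes from [v] to the lift inside one box, along the lift at cost [B], and to [w] inside
     another box; each 1 makes a box bound strict. *)
  exists (K * 2 + 1 + (B + (K * 2 + 1))) => v w [t rt Wv] [s rs Ww]; apply: ltW.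
  have near t' v' : ray a t' -> W t' v' -> (natural_dist b1 b2 v' (u t') < (K * 2 + 1)%:E)%E.
    move=> rt' Wv'; have [_ _ _ H] := pP t' rt'.
    by apply: le_lt_trans (H _ _ Wv' (Wu _ rt') _ _ ip1 ip2 _ K0 HK) _; rewrite lte_fin ltrDl.
  apply: natural_dist_ltD (near t v rt Wv) _.
  apply: natural_dist_ltD (HB t s rt rs) _.
  by rewrite natural_dist_sym//; exact: near.
- move=> _ [b1 [b2 [ip1 ip2 ->]]] complete; apply: noend.
  have [_ tail] := ud b1 b2 ip1 ip2.
  have n0 n : 0 < n.+1%:R^-1 :> R by rewrite invr_gt0.
  have small (E : R) : 0 < E -> exists N, forall n, (N <= n)%N -> n.+1%:R^-1 < E.
    move=> /ltr_add_invr[N]; rewrite add0r => NE; exists N => n Nn.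
    by apply: le_lt_trans NE; rewrite lef_pV2 ?posrE// ler_nat.
  (* [Tt.1] is a time after which the lift varies by less than [1 / (n + 1)], and [Tt.2] a later
     time at which the sequence samples it. *)
  have tP n : exists Tt : R * R, [/\ ray a Tt.1, ray a Tt.2, Tt.1 < Tt.2 &
      forall t t', ray a t -> ray a t' -> Tt.1 < t -> Tt.1 < t' ->
       (natural_dist b1 b2 (u t) (u t') < (n.+1%:R^-1)%:E)%E].
    have [T rT HT] := tail _ (n0 n); have [t rt Tt] := ray_later rT.
    by exists (T, t).
  have [f fP] := choice tP.
  have [] := complete (fun n => u (f n).2).
  + move=> n; apply: subset_closure; have [_ rt _ _] := fP n.
    by exists (f n).2 => //; exact: Wu.
  + move=> E E0; have [N HN] := small (E / 2) (divr_gt0 E0 (ltr0n _ 2)).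
    exists N => m n Nm Nn; have [_ rm Tm Hm] := fP m; have [_ rn Tn Hn] := fP n.
    have [s [rs ms ns]] := ray_later2 rm rn.
    have -> : E = E / 2 + E / 2 by lra.
    apply: (natural_dist_ltD (y := u s)).
      apply: lt_trans (Hm _ _ rm rs Tm (lt_trans Tm ms)) _.
      by rewrite lte_fin HN.
    apply: lt_trans (Hn _ _ rs rn (lt_trans Tn ns) Tn) _.
    by rewrite lte_fin HN.
  (* The contradiction with the absence of an endpoint: [gamma] converges to the projection of [x].
     Every time after [(f n).1] is close to the sampled one, which is close to [x] when [n] is
     large, so the whole tail converges and not only the sequence. *)
  move=> x _ cx; exists (frame_proj x) => N nN.
  have [E E0 HE] := natural_dist_near ip1 ip2 (@carrier_hausdorff _ M) nN.
  have E20 : 0 < E / 2 by lra.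
  have [N1 HN1] := small _ E20; have [N2 HN2] := cx _ E20.
  pose n := maxn N1 N2; have [rT rn Tn Hn] := fP n.
  exists (f n).1 => // t [rt Tt] /=; rewrite -ug//; apply: HE.
  have -> : E = E / 2 + E / 2 by lra.
  apply: natural_dist_ltD (HN2 n (leq_maxr _ _)).
  apply: lt_trans (Hn _ _ rt rn Tt Tn) _.
  by rewrite lte_fin HN1// leq_maxl.
- apply/seteqP; split=> [_ [v [t rt [Dv xv _]] <-]|_ [t rt [x Bx <-]]].
    exists t => //; exists (phi M (c t) (pt (set_val v))) => //.
    by rewrite phiK.
  (* Surjectivity onto the chart ball: this clause of [pP] supplies a frame of the box over each of
     its points. *)
  have [_ _ /(_ x Bx)[cx _ [v vx vA]] _] := pP t rt.
  exists v => //; exists t => //; have Dx := codom_dom cx.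
  have [q Dq qx] := cx; split=> //.
  + by rewrite -vx in Dx.
  + by rewrite -[pt _]/(frame_proj v) vx -qx phiK// qx.
Qed.
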